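(* Let $\sigma\in\mathbb{C}$, $\theta_{2n+1}\in\mathbb{C}$ ($n\ge 0$), $\theta(\lambda):=\sum_{n\ge 0}\theta_{2n+1}\lambda^n$, $J(\lambda):=\lambda F+E$, $\delta:=\sigma\big(\lambda\frac{d}{d\lambda}+\tfrac14\,\mathrm{ad}\,H\big)$, and $X=\sum_{n\ge 0}\theta_{2n+1}\partial_{2n+1}+\sigma\sum_{n\ge 0}(n+\tfrac12)t_{2n+1}\partial_{2n+1}$. Let $g\in LSL(2,\mathbb{C})$. 1. If $g$ satisfies $$\delta g\cdot g^{-1}+\mathrm{Ad}\,g\,K=\theta J$$ for some $K\in B^+\mathfrak{sl}(2,\mathbb{C})$, then the solution $v$ of the modified KdV hierarchy corresponding to $g$ satisfies, with $u=\partial_1v-v^2$, $$\partial_1(\partial_1+2v)\Big(\sum_{n\ge 0}\theta_{2n+1}R_n[u]+\sigma\sum_{n\ge 0}(n+\tfrac12)t_{2n+1}R_n[u]\Big)=0,$$ i.e. $$(\partial_1+2v)\Big(\sum_{n\ge 0}\theta_{2n+1}R_n[u]+\sigma\sum_{n\ge 0}(n+\tfrac12)t_{2n+1}R_n[u]\Big)=c+\frac{\sigma}{4}$$ for some constant $c\in\mathbb{C}$. 2. If $g$ satisfies $\delta g\cdot g^{-1}+\mathrm{Ad}\,g\,K=\theta J$ for some $K\in N^+\mathfrak{sl}(2,\mathbb{C})$, then the solution $w$ of the potential modified KdV hierarchy corresponding to $g$ is self-similar under $X$, i.e. $Xw=0$, and so $v=\partial_1w$ satisfies the last displayed equation wi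th $c=0$.
   Context: Functions depend on infinitely many complex variables $\mathbf{t}=\{t_{2n+1}\}_{n\ge 0}$ and $\partial_{2n+1}:=\partial/\partial t_{2n+1}$, $d=\sum_{n\ge 0} dt_{2n+1}\partial_{2n+1}$. The Gel'fand--Dickii potentials $R_n[u]$ are the differential polynomials in $u$ (with respect to $\partial_1$) determined by $R_0=\tfrac12$, $\partial_1R_{n+1}=\big(\tfrac14\partial_1^3+u\partial_1+\tfrac12(\partial_1u)\big)R_n$ and $R_{n+1}[0]=0$ (so $R_1=u/4$). With $u=\partial_1v-v^2$ and $S_n[v]:=(\partial_1+2v)R_n[u]$, the modified KdV hierarchy is $\partial_{2n+1}v=\partial_1S_n[v]$, $n\ge 0$, and the potential modified KdV hierarchy for $w$ is $\partial_{2n+1}w=S_n[v]$, $n\ge 0$, $v=\partial_1w$. $E=\begin{pmatrix}0&1\\0&0\end{pmatrix}$, $H=\mathrm{diag}(1,-1)$, $F=\begin{pmatrix}0&0\\1&0\end{pmatrix}$. $LSL(2,\mathbb{C})$ is the group of smooth loops $S^1=\{|\lambda|=1\}\to SL(2,\mathbb{C})$, with Lie algebra $L\mathfrak{sl}(2,\mathbb{C})$. $B^+SL(2,\mathbb{C})$ (resp. $N^+SL(2,\mathbb{C})$) is the subgroup of loops extending holomorphically to $|\lambda|<1$ whose value at $\lambda=0$ is upper triangular (resp. upper triangular with $1$'s on the diagonal). $B^-SL(2,\mathbb{C})$ (resp. $N^-SL(2,\mathbb{C})$) is the subgroup of loops extending holomorphically to $|\lambda|>1$, including $\infty$, whose value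 at $\infty$ is lower triangular (resp. lower triangular with $1$'s on the diagonal). $B^\pm\mathfrak{sl}(2,\mathbb{C})$, $N^\pm\mathfrak{sl}(2,\mathbb{C})$ are their Lie algebras. On matrix-valued loops, $\delta g=\sigma\big(\lambda\frac{dg}{d\lambda}+\tfrac14[H,g]\big)$. Correspondence. Given $g$, set $\psi(\mathbf{t},\lambda)=\exp\big(\sum_{n\ge 0}t_{2n+1}\lambda^nJ(\lambda)\big)\cdot g(\lambda)$. (a) Where the factorization $\psi=\psi_-^{-1}\psi_+$, $\psi_-\in N^-SL(2,\mathbb{C})$, $\psi_+\in B^+SL(2,\mathbb{C})$ exists, $\psi_-$ is parametrized by a solution $v$ of the modified KdV hierarchy, the solution corresponding to $g$, with $\partial_1\psi_+\cdot\psi_+^{-1}=\begin{pmatrix}-v&1\\ \lambda&v\end{pmatrix}$. In this case $\xi=d\psi_+\cdot\psi_+^{-1}=\sum_{n\ge 0}\ell_{2n+1}dt_{2n+1}$, where, with $\rho_n(\lambda)=2\sum_{m=0}^n\lambda^mR_{n-m}[u]$, $$\ell_{2n+1}=\begin{pmatrix}-(\partial_1+2v)\rho_n/2&\rho_n\\ \lambda\rho_n-\partial_1(\partial_1+2v)(\rho_n/2-R_n)&(\partial_1+2v)\rho_n/2\end{pmatrix}.$$ (b) Where the factorization $\psi=\tilde\psi_-^{-1}\tilde\psi_+$, $\tilde\psi_-\in B^-SL(2,\mathbb{C})$, $\tilde\psi_+\in N^+SL(2,\mathbb{C})$ exists, the corresponding solution $w$ of the potential modified KdV hierarchy is given by: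 the diagonal part of $\tilde\psi_-|_{\lambda=\infty}$ is $\mathrm{diag}(e^w,e^{-w})$; equivalently $\partial_1\tilde\psi_+\cdot\tilde\psi_+^{-1}=\begin{pmatrix}0&e^{2w}\\ \lambda e^{-2w}&0\end{pmatrix}$. In this case $\eta=d\tilde\psi_+\cdot\tilde\psi_+^{-1}=\sum_{n\ge 0}\tilde\ell_{2n+1}dt_{2n+1}$ with $$\tilde\ell_{2n+1}=\begin{pmatrix}-(\partial_1+2v)(\rho_n/2-R_n)&e^{2w}\rho_n\\ e^{-2w}\big(\lambda\rho_n-\partial_1(\partial_1+2v)(\rho_n/2-R_n)\big)&(\partial_1+2v)(\rho_n/2-R_n)\end{pmatrix}.$$ Infinite sums over $n$ are assumed to make sense and be differentiable termwise. *)

(* Defs.v *)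
From HB Require Import structures.
From mathcomp Require Import all_boot all_order all_algebra.
From mathcomp Require Import all_classical all_reals all_analysis.
From mathcomp Require Import complex.

Set Implicit Arguments.
Unset Strict Implicit.
Unset Printing Implicit Defensive.

Import Order.TTheory GRing.Theory Num.Theory.
Import numFieldNormedType.Exports.

Local Open Scope classical_set_scope.
Local Open Scope ring_scope.

(* R[i] behind a constant of type numClosedFieldType, so that the topology and
   the normed-module structures of numFieldNormedType are inferred on it and on
   matrices over it. *)
Definition Cplx (R : realType) : numClosedFieldType := R[i].

Section Loops.
Variable R : realType.
Local Notation C := (Cplx R).
Local Notation M2 := 'M[C]_2.

Definition mx22 (a b c d : C) : M2 :=
  \matrix_(i, j) if i == 0 then (if j == 0 then a else b)
                 else (if j == 0 then c else d).

Definition matE : M2 := mx22 0 1 0 0.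
Definition matH : M2 := mx22 1 0 0 (- 1).
Definition matF : M2 := mx22 0 0 1 0.
Definition matJ (l : C) : M2 := l *: matF + matE.

Definition circle : set C := [set l | `|l| = 1].

(* A loop is a function of lambda of which only the values on the unit circle
   matter.  Its derivative d/dlambda is the limit of the difference quotient
   along the circle; as dlambda = i lambda dphi for lambda = e^(i phi), a loop
   is smooth in phi iff it is infinitely differentiable in this sense. *)
Definition circle_quot (f : C -> M2) (l m : C) : M2 :=
  (m - l)^-1 *: (f m - f l).

Definition circle_deriv (f : C -> M2) (l : C) : M2 :=
  lim (circle_quot f l m @[m --> within circle l^']).

Definition smooth_loop (f : C -> M2) : Prop :=
  forall (k : nat) (l : C), circle l ->
    cvg (circle_quot (iter k circle_deriv f) l m @[m --> within circle l^']).

Definition LSL (f : C -> M2) : Prop :=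
  smooth_loop f /\ forall l, circle l -> \det (f l) = 1.

Definition Lsl (f : C -> M2) : Prop :=
  smooth_loop f /\ forall l, circle l -> \tr (f l) = 0.

(* f extends to a continuous function on the closed unit disc, holomorphic in
   the open disc, with value A at 0. *)
Definition extends_in (f : C -> M2) (A : M2) : Prop :=
  exists Phi : C -> M2,
    [/\ forall l, circle l -> Phi l = f l,
        {within [set l : C | `|l| <= 1], continuous Phi},
        forall l : C, `|l| < 1 -> derivable Phi l 1
      & Phi 0 = A].

(* The same for the exterior of the circle, including infinity, where f takes
   the value A: 1 / lambda is a local coordinate at infinity. *)
Definition extends_out (f : C -> M2) (A : M2) : Prop :=
  extends_in (fun l => f l^-1) A.

Definition upper (A : M2) : Prop := A 1 0 = 0.
Definition lower (A : M2) : Prop := A 0 1 = 0.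
Definition unit_diag (A : M2) : Prop := A 0 0 = 1 /\ A 1 1 = 1.
Definition zero_diag (A : M2) : Prop := A 0 0 = 0 /\ A 1 1 = 0.

Definition BpSL (f : C -> M2) : Prop :=
  LSL f /\ exists2 A, extends_in f A & upper A.
Definition NpSL (f : C -> M2) : Prop :=
  LSL f /\ exists2 A, extends_in f A & upper A /\ unit_diag A.
Definition BmSL (f : C -> M2) : Prop :=
  LSL f /\ exists2 A, extends_out f A & lower A.
Definition NmSL (f : C -> M2) : Prop :=
  LSL f /\ exists2 A, extends_out f A & lower A /\ unit_diag A.

Definition Bpsl (f : C -> M2) : Prop :=
  Lsl f /\ exists2 A, extends_in f A & upper A.
Definition Npsl (f : C -> M2) : Prop :=
  Lsl f /\ exists2 A, extends_in f A & upper A /\ zero_diag A.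

Definition delta (sigma : C) (f : C -> M2) (l : C) : M2 :=
  sigma *: (l *: circle_deriv f l + 4%:R^-1 *: (matH * f l - f l * matH)).

Definition mexp (A : M2) : M2 :=
  lim (series (fun k => (k`!%:R)^-1 *: A ^+ k) @ \oo).

Definition cexp (z : C) : C :=
  ((expR (complex.Re z) * cos (complex.Im z))
     +i* (expR (complex.Re z) * sin (complex.Im z)))%C.

Definition csum (a : nat -> C) : C := lim (series a @ \oo).

Definition loop_series (a : nat -> C) (l : C) : C :=
  csum (fun n => a n * l ^+ n).

(* The series sum_n a_n lambda^n converges on the unit circle together with all
   the series obtained from it by applying lambda d/dlambda termwise. *)
Definition smooth_series (a : nat -> C) : Prop :=
  forall (k : nat) (l : C), circle l ->
    cvgn (series (fun n => n%:R ^+ k * a n * l ^+ n)).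

End Loops.

Arguments matE {R}.
Arguments matH {R}.
Arguments matF {R}.
Arguments circle {R}.

Section Times.
Variable R : realType.
Local Notation C := (Cplx R).
Local Notation M2 := 'M[C]_2.

(* t n stands for the time t_{2n+1}, and the index n below always refers to
   t_{2n+1}; in particular index 0 is the variable t_1. *)
Definition times : Type := nat -> C.

Definition set_time (t : times) (n : nat) (z : C) : times :=
  fun m => if m == n then z else t m.

Definition pd (n : nat) (f : times -> C) (t : times) : C :=
  derive1 (fun z : C => f (set_time t n z)) (t n).

Definition pderivable (n : nat) (f : times -> C) (t : times) : Prop :=
  derivable (fun z : C => f (set_time t n z)) (t n) 1.

Definition is_pd (n : nat) (f : times -> C) (t : times) (y : C) : Prop :=
  is_derive (t n) 1 (fun z : C => f (set_time t n z)) y.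

(* Y is the derivative of Psi with respect to t_{2n+1} at t, where Psi is seen
   as a function with values in loops, for uniform convergence on the circle. *)
Definition is_loop_pd (n : nat) (Psi : times -> C -> M2) (t : times)
    (Y : C -> M2) : Prop :=
  {uniform circle,
    (fun l => h^-1 *: (Psi (set_time t n (t n + h)) l - Psi t l)) @[h --> 0^']
    --> Y}.

Definition open_in_times (D : set times) : Prop :=
  forall t n, D t -> \forall z \near t n, D (set_time t n z).

(* Differential polynomials in one function u: DVar k stands for d^k u. *)
Inductive dpoly : Type :=
| DConst of C
| DVar of nat
| DAdd of dpoly & dpoly
| DMul of dpoly & dpoly.

Fixpoint dder (p : dpoly) : dpoly :=
  match p with
  | DConst _ => DConst 0
  | DVar k => DVar k.+1
  | DAdd p q => DAdd (dder p) (dder q)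
  | DMul p q => DAdd (DMul (dder p) q) (DMul p (dder q))
  end.

Fixpoint deval (x : nat -> C) (p : dpoly) : C :=
  match p with
  | DConst c => c
  | DVar k => x k
  | DAdd p q => deval x p + deval x q
  | DMul p q => deval x p * deval x q
  end.

(* Equality of the polynomials denoted by two expressions; C being infinite, it
   is the equality of the polynomial functions in the variables u, du, ... *)
Definition deq (p q : dpoly) : Prop := forall x, deval x p = deval x q.

Definition GelfandDickii (Rn : nat -> dpoly) : Prop :=
  [/\ deq (Rn 0%N) (DConst (2%:R^-1)),
      forall n, deq (dder (Rn n.+1))
        (DAdd (DMul (DConst (4%:R^-1)) (dder (dder (dder (Rn n)))))
        (DAdd (DMul (DVar 0) (dder (Rn n)))
              (DMul (DMul (DConst (2%:R^-1)) (DVar 1)) (Rn n))))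
    & forall n, deval (fun=> 0) (Rn n.+1) = 0].

Definition dsubst (p : dpoly) (u : times -> C) (t : times) : C :=
  deval (fun k => iter k (pd 0) u t) p.

Definition miura (v : times -> C) (t : times) : C := pd 0 v t - v t ^+ 2.

Definition mkdvS (Rn : nat -> dpoly) (v : times -> C) (n : nat) (t : times) : C :=
  pd 0 (dsubst (Rn n) (miura v)) t + 2%:R * v t * dsubst (Rn n) (miura v) t.

Definition smooth_t1 (D : set times) (v : times -> C) : Prop :=
  forall k t, D t -> pderivable 0 (iter k (pd 0) v) t.

Definition mkdv_solution (Rn : nat -> dpoly) (D : set times) (v : times -> C) :
    Prop :=
  smooth_t1 D v /\
  forall n t, D t -> is_pd n v t (pd 0 (mkdvS Rn v n) t).

Definition pmkdv_solution (Rn : nat -> dpoly) (D : set times) (w : times -> C) :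
    Prop :=
  smooth_t1 D (pd 0 w) /\
  forall n t, D t -> is_pd n w t (mkdvS Rn (pd 0 w) n t).

Definition psi (g : C -> M2) (t : times) (l : C) : M2 :=
  mexp (loop_series t l *: matJ l) * g l.

(* On a set D of times where sum_n t_{2n+1} lambda^n is a smooth loop, psi_-
   and psi_+ are families of loops, differentiable in each time variable, such
   that psi = psi_-^-1 psi_+; dpsip n t is the derivative of psi_+ with respect
   to t_{2n+1}. *)
Definition factorization (g : C -> M2) (D : set times)
    (minus plus : (C -> M2) -> Prop) (psim psip : times -> C -> M2)
    (dpsip : nat -> times -> C -> M2) : Prop :=
  [/\ open_in_times D,
      forall t, D t -> smooth_series t,
      forall t, D t -> minus (psim t) /\ plus (psip t),
      forall t l, D t -> circle l -> psi g t l = (psim t l)^-1 * psip t l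
    & forall n t, D t ->
        is_loop_pd n psip t (dpsip n t) /\ exists Y, is_loop_pd n psim t Y].

Definition mkdv_corresponds (Rn : nat -> dpoly) (g : C -> M2) (D : set times)
    (v : times -> C) : Prop :=
  mkdv_solution Rn D v /\
  exists psim psip dpsip,
    factorization g D (@NmSL R) (@BpSL R) psim psip dpsip /\
    forall t l, D t -> circle l ->
      dpsip 0%N t l * (psip t l)^-1 = mx22 (- v t) 1 l (v t).

Definition pmkdv_corresponds (Rn : nat -> dpoly) (g : C -> M2) (D : set times)
    (w : times -> C) : Prop :=
  pmkdv_solution Rn D w /\
  exists psim psip dpsip,
    factorization g D (@BmSL R) (@NpSL R) psim psip dpsip /\
    forall t, D t -> exists2 A, extends_out (psim t) A &
      A 0 0 = cexp (w t) /\ A 1 1 = cexp (- w t).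

Definition termwise_t1 (D : set times) (f : nat -> times -> C) : Prop :=
  forall t, D t ->
    [/\ cvgn (series (fun n => f n t)),
        forall n, pderivable 0 (f n) t,
        cvgn (series (fun n => pd 0 (f n) t))
      & is_pd 0 (fun s => csum (fun n => f n s)) t (csum (fun n => pd 0 (f n) t))].

Definition theta_term (Rn : nat -> dpoly) (theta : nat -> C) (v : times -> C)
    (n : nat) (t : times) : C :=
  theta n * dsubst (Rn n) (miura v) t.

Definition sigma_term (Rn : nat -> dpoly) (v : times -> C)
    (n : nat) (t : times) : C :=
  (n%:R + 2%:R^-1) * t n * dsubst (Rn n) (miura v) t.

Definition string_sum (Rn : nat -> dpoly) (theta : nat -> C) (sigma : C)
    (v : times -> C) (t : times) : C :=
  csum (fun n => theta_term Rn theta v n t)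
  + sigma * csum (fun n => sigma_term Rn v n t).

Definition string_lhs (Rn : nat -> dpoly) (theta : nat -> C) (sigma : C)
    (v : times -> C) (t : times) : C :=
  pd 0 (string_sum Rn theta sigma v) t
  + 2%:R * v t * string_sum Rn theta sigma v t.

(* (X f)(t) is defined and equal to y. *)
Definition is_X (theta : nat -> C) (sigma : C) (f : times -> C) (t : times)
    (y : C) : Prop :=
  exists a b : C,
    [/\ series (fun n => theta n * pd n f t) @ \oo --> a,
        series (fun n => (n%:R + 2%:R^-1) * t n * pd n f t) @ \oo --> b
      & y = a + sigma * b].

End Times.

(* Main.v *)
Require Import Defs.
From mathcomp Require Import all_boot all_order all_algebra.
From mathcomp Require Import all_classical all_reals all_analysis.
From mathcomp Require Import complex.
From mathcomp Require Import ring lra.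
Import Order.TTheory GRing.Theory Num.Theory.
Import numFieldNormedType.Exports.

Set Implicit Arguments.
Unset Strict Implicit.
Unset Printing Implicit Defensive.

Local Open Scope classical_set_scope.
Local Open Scope ring_scope.

(* Write [m = psi_-], [p = psi_+].  Functions on the circle that extend
   holomorphically inside or outside are handled through their Fourier
   coefficients; the mean over the circle is multiplicative on each of the two
   classes and gives the value at 0, resp. at infinity.

   Differentiating [p = m exp(sum t_n lambda^n J) g] in [t_n] gives
   [p_n p^-1 = m_n m^-1 + lambda^n m J m^-1], and applying [delta] to it, with
   the hypothesis on [g], gives
   [delta p p^-1 + p K p^-1 = delta m m^-1 + (theta + Theta_t) m J m^-1], where
   [Theta_t = sigma sum (n + 1/2) t_n lambda^n].  The mean of the (0,0) entry of
   the latter reads [sum (theta_n + sigma (n + 1/2) t_n) a_n = K(0)_00], where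
   [a_n] is the coefficient of [lambda^-n] in [(m J m^-1)_00].

   It remains to see that [a_n = - S_n].  For the potential hierarchy the mean
   of the (0,0) entry of the first relation says [a_n = - dw/dt_n].  For mKdV,
   [det (m J m^-1) = - lambda] and the first relation for [t_1] yield the
   quadratic recursion that characterises the Gel'fand-Dickii potentials.  So the
   string equation holds with [c = - K(0)_00]. *)

(** * Complex numbers and complex-valued functions of a real variable *)

(** The data in [extends_in] and [extends_out] are continuity up to the circle and complex
    differentiability off it: neither a continuous derivative nor a power series is given. The
    coefficient conditions [In] and [Out] are preferred because they survive uniform limits on the
    circle, hence differentiation in a time, without rebuilding extensions. Reaching them requires
    Goursat's lemma, and multiplicativity of the mean requires approximation by Laurent polynomials.
    Both factorizations are treated as one, with [psi_-] in [BmSL] and [psi_+] in [BpSL]; the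
    unipotent normalisations enter only in the identification of [a_n]. The weights [n + 1/2] appear
    because [lambda dJ/dlambda + [H, J] / 4 = J / 2]. The [delta] terms drop out of the mean because
    [lambda d/dlambda] annihilates constant terms, [ad H] kills the diagonal, and triangularity at 0
    and at infinity removes the other products. The constant [sigma / 4] is [sigma * 1/2 * R_0],
    produced by the explicit [t_1] in the summand [n = 0]. *)

Section ComplexBasics.
Variable R : realType.
Local Notation C := (Cplx R).

Definition re (z : C) : R := complex.Re z.
Definition im (z : C) : R := complex.Im z.
Definition rc (x : R) : C := (x +i* 0)%C.
Definition ci : C := (0 +i* 1)%C.
Definition nrm (z : C) : R := re `|z|.

Lemma complex_ext (z w : C) : re z = re w -> im z = im w -> z = w.
Proof. by case: z => a b; case: w => c d /=; rewrite /re /im /= => -> ->. Qed.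

Lemma reD (z w : C) : re (z + w) = re z + re w.
Proof. by case: z; case: w. Qed.
Lemma imD (z w : C) : im (z + w) = im z + im w.
Proof. by case: z; case: w. Qed.
Lemma reN (z : C) : re (- z) = - re z.
Proof. by case: z. Qed.
Lemma imN (z : C) : im (- z) = - im z.
Proof. by case: z. Qed.
Lemma reM (z w : C) : re (z * w) = re z * re w - im z * im w.
Proof. by case: z; case: w. Qed.
Lemma imM (z w : C) : im (z * w) = re z * im w + im z * re w.
Proof. by case: z => a b; case: w => c d. Qed.
Lemma re0 : re 0 = 0. Proof. by []. Qed.
Lemma im0 : im 0 = 0. Proof. by []. Qed.
Lemma re1 : re 1 = 1. Proof. by []. Qed.
Lemma im1 : im 1 = 0. Proof. by []. Qed.
Lemma re_rc x : re (rc x) = x. Proof. by []. Qed.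
Lemma im_rc x : im (rc x) = 0. Proof. by []. Qed.
Lemma re_ci : re ci = 0. Proof. by []. Qed.
Lemma im_ci : im ci = 1. Proof. by []. Qed.
Definition reimE := (reD, imD, reN, imN, reM, imM, re_rc, im_rc, re_ci, im_ci,
  re0, im0, re1, im1).

Lemma rcD x y : rc (x + y) = rc x + rc y.
Proof. by apply: complex_ext; rewrite !reimE ?addr0. Qed.
Lemma rcN x : rc (- x) = - rc x.
Proof. by apply: complex_ext; rewrite !reimE ?oppr0. Qed.
Lemma rcM x y : rc (x * y) = rc x * rc y.
Proof. by apply: complex_ext; rewrite !reimE; ring. Qed.
Lemma rc0 : rc 0 = 0. Proof. by []. Qed.
Lemma rc1 : rc 1 = 1. Proof. by []. Qed.
Lemma rc_nat n : rc n%:R = n%:R.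
Proof. by elim: n => // n IH; rewrite -natr1 rcD IH rc1 natr1. Qed.
Lemma rc_inj : injective rc. Proof. by move=> x y []. Qed.
Lemma rcV x : rc x^-1 = (rc x)^-1.
Proof.
have [->|x0] := eqVneq x 0; first by rewrite invr0 rc0 invr0.
apply: (@mulfI _ (rc x)); first by apply: contra x0 => /eqP /rc_inj ->.
by rewrite -rcM !divff // -rc0 (inj_eq rc_inj).
Qed.
Lemma reimP (z : C) : z = rc (re z) + ci * rc (im z).
Proof. by apply: complex_ext; rewrite !reimE; ring. Qed.
Lemma rc_lt x y : (rc x < rc y) = (x < y).
Proof. exact: ltcR. Qed.
Lemma rc_le x y : (rc x <= rc y) = (x <= y).
Proof. exact: lecR. Qed.

Lemma nrmE (z : C) : nrm z = Num.sqrt (re z ^+ 2 + im z ^+ 2).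
Proof. by rewrite /nrm normc_def. Qed.
Lemma normE (z : C) : `|z| = rc (nrm z).
Proof. by rewrite nrmE normc_def. Qed.
Lemma nrm_ge0 z : 0 <= nrm z. Proof. by rewrite nrmE sqrtr_ge0. Qed.
Lemma nrm0 : nrm 0 = 0. Proof. by rewrite /nrm normr0. Qed.
Lemma nrm1 : nrm 1 = 1. Proof. by rewrite /nrm normr1. Qed.
Lemma nrmN z : nrm (- z) = nrm z. Proof. by rewrite /nrm normrN. Qed.
Lemma nrmB z w : nrm (z - w) = nrm (w - z). Proof. by rewrite /nrm distrC. Qed.
Lemma nrmM z w : nrm (z * w) = nrm z * nrm w.
Proof. by apply: rc_inj; rewrite rcM -!normE normrM. Qed.
Lemma nrmV z : nrm z^-1 = (nrm z)^-1.
Proof. by apply: rc_inj; rewrite rcV -!normE normfV. Qed.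
Lemma nrmX z n : nrm (z ^+ n) = nrm z ^+ n.
Proof. by elim: n => [|n IH]; rewrite ?expr0 ?nrm1 // !exprS nrmM IH. Qed.
Lemma nrmD z w : nrm (z + w) <= nrm z + nrm w.
Proof. by rewrite -rc_le rcD -!normE ler_normD. Qed.
Lemma nrm_re z : `|re z| <= nrm z.
Proof.
rewrite nrmE -sqrtr_sqr ler_wsqrtr // lerDl; exact: sqr_ge0.
Qed.
Lemma nrm_im z : `|im z| <= nrm z.
Proof.
rewrite nrmE -sqrtr_sqr ler_wsqrtr // lerDr; exact: sqr_ge0.
Qed.
Lemma nrm_rc x : nrm (rc x) = `|x|.
Proof. by rewrite nrmE !reimE expr0n addr0 sqrtr_sqr. Qed.
Lemma nrm_ci : nrm ci = 1.
Proof. by rewrite nrmE !reimE expr0n expr1n add0r sqrtr1. Qed.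
Lemma nrm_le_reim z : nrm z <= `|re z| + `|im z|.
Proof.
rewrite {1}(reimP z); apply: le_trans (nrmD _ _) _.
by rewrite nrmM nrm_ci !nrm_rc mul1r.
Qed.
Lemma nrm_eq0 z : (nrm z == 0) = (z == 0).
Proof. by rewrite -(inj_eq rc_inj) -normE normr_eq0. Qed.
Lemma nrm_nat n : nrm n%:R = n%:R.
Proof. by rewrite -rc_nat nrm_rc normr_nat. Qed.

Lemma gt0_rc (e : C) : 0 < e -> e = rc (re e) /\ 0 < re e.
Proof.
case: e => a b; rewrite ltcE /= => /andP[/eqP -> a0]; split => //.
Qed.

Lemma cvg_nrmP {T} {F : set_system T} {FF : Filter F} (f : T -> C) (l : C) :
  f @ F --> l <-> forall e : R, 0 < e -> \forall x \near F, nrm (l - f x) < e.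
Proof.
split=> [/cvgrPdist_lt H e e0|H].
  have := H (rc e); rewrite -[X in X < _]rc0 rc_lt => /(_ e0).
  by apply: filterS => x; rewrite normE rc_lt.
apply/cvgrPdist_lt => e /gt0_rc[-> e0].
by apply: filterS (H _ e0) => x; rewrite normE rc_lt.
Qed.

Lemma re_cvg {T} {F : set_system T} {FF : Filter F} (f : T -> C) (l : C) :
  f @ F --> l -> (fun x => re (f x)) @ F --> re l.
Proof.
move=> /cvg_nrmP H; apply/cvgrPdist_lt => e e0.
apply: filterS (H _ e0) => x; apply: le_lt_trans.
by rewrite -reN -reD nrm_re.
Qed.
Lemma im_cvg {T} {F : set_system T} {FF : Filter F} (f : T -> C) (l : C) :
  f @ F --> l -> (fun x => im (f x)) @ F --> im l.
Proof.
move=> /cvg_nrmP H; apply/cvgrPdist_lt => e e0.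
apply: filterS (H _ e0) => x; apply: le_lt_trans.
by rewrite -imN -imD nrm_im.
Qed.
Lemma reim_cvg {T} {F : set_system T} {FF : Filter F} (f : T -> C) (l : C) :
  (fun x => re (f x)) @ F --> re l -> (fun x => im (f x)) @ F --> im l ->
  f @ F --> l.
Proof.
move=> /cvgrPdist_lt H1 /cvgrPdist_lt H2; apply/cvg_nrmP => e e0.
have e2 : 0 < e / 2 by rewrite divr_gt0.
apply: filterS2 (H1 _ e2) (H2 _ e2) => x h1 h2.
apply: le_lt_trans (nrm_le_reim _) _.
by rewrite (splitr e) !reimE ltrD.
Qed.
End ComplexBasics.
Arguments ci {R}.

(** * Primitives and integrals of continuous functions of a real variable *)

Section ZeroDerivative.
Variable R : realType.
Implicit Types h H : R -> R.

Lemma der0_cst H (a x y : R) :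
  (forall z, a < z -> is_derive z 1 H 0) -> a < x -> a < y -> H x = H y.
Proof.
move=> dH; wlog: x y / x < y => [W ax ay|xy ax ay].
  have [xy|yx|->//] := ltgtP x y; first exact: W.
  by apply/esym; apply: W.
have [z|z|c _ /eqP] := @MVT R H (fun=> 0) x y xy.
- by rewrite inE/= => /andP[xz _]; apply: dH; exact: lt_trans xz.
- apply: derivable_within_continuous => t; rewrite inE/= => /andP[xt _].
  by have [] := dH t (lt_le_trans ax xt).
by rewrite mul0r subr_eq0 => /eqP.
Qed.
End ZeroDerivative.

Section Primitives.
Variable R : realType.
Local Notation C := (Cplx R).
Local Notation mu := lebesgue_measure.
Implicit Types h H : R -> R.

Lemma rderN (f : R -> R) (x a : R) : is_derive x 1 f a ->
  is_derive x 1 (fun y => - f y) (- a).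
Proof. exact: is_deriveN. Qed.

Lemma rderD (f g : R -> R) (x a b : R) : is_derive x 1 f a -> is_derive x 1 g b ->
  is_derive x 1 (fun y => f y + g y) (a + b).
Proof. exact: is_deriveD. Qed.

Lemma rderB (f g : R -> R) (x a b : R) : is_derive x 1 f a -> is_derive x 1 g b ->
  is_derive x 1 (fun y => f y - g y) (a - b).
Proof. exact: is_deriveB. Qed.

Lemma rderM (f g : R -> R) (x a b : R) : is_derive x 1 f a -> is_derive x 1 g b ->
  is_derive x 1 (fun y => f y * g y) (a * g x + f x * b).
Proof.
move=> df dg; apply: (is_derive_eq (is_deriveM df dg)).
by rewrite /GRing.scale /=; ring.
Qed.

Lemma rder_continuous (f : R -> R) (x a : R) : is_derive x 1 f a ->
  {for x, continuous f}.
Proof. by move=> [df _]; apply/differentiable_continuous/derivable1_diffP. Qed.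

Lemma prim_gt h (a : R) : continuous h ->
  exists H : R -> R, forall x : R, a < x -> is_derive x 1 H (h x).
Proof.
move=> ch; exists (fun x => (\int[mu]_(t in [set` `[a, x]]) h t)%R) => x ax.
have xx : x < x + 1 by rewrite ltrDl.
have hi : mu.-integrable `[a, x + 1] (EFin \o h).
  apply: continuous_compact_integrable; first exact: segment_compact.
  exact: continuous_subspaceT.
have [d1 d2] := @continuous_FTC1_closed R h a x (x + 1) xx hi ax (ch x).
have e : 'D_1 (fun x : R => \int[mu]_(t in `[a, x]) h t) x = h x by rewrite -derive1E d2.
exact: DeriveDef d1 e.
Qed.

Lemma der_unique_gt h H1 H2 (a x y : R) :
  (forall z, a < z -> is_derive z 1 H1 (h z)) ->
  (forall z, a < z -> is_derive z 1 H2 (h z)) -> a < x -> a < y ->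
  H1 y - H1 x = H2 y - H2 x.
Proof.
move=> d1 d2 ax ay.
suff : (H1 - H2) x = (H1 - H2) y by rewrite !fctE; lra.
apply: (@der0_cst _ _ a) => // z az.
have := d1 z az; have := d2 z az => D2 D1.
by apply: is_derive_eq; rewrite subrr.
Qed.

(** The fundamental theorem of calculus supplies a primitive only to the right of a base point.
    Primitives with different base points differ by a constant where both are defined, so
    normalising each to vanish at 0 glues them into a global one; [aa x] is a base point to the left
    of both [x] and 0. *)
Lemma prim_exists h : continuous h ->
  exists H : R -> R, forall x : R, is_derive x 1 H (h x).
Proof.
move=> ch; have [G dG] := choice (fun a => @prim_gt h a ch).
pose aa x : R := Num.min x 0 - 1.
exists (fun x => G (aa x) x - G (aa x) 0) => x0.
pose a0 := aa x0 - 1.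
have aax (x : R) : aa x < x /\ aa x < 0.
  rewrite /aa minEle; case: ifP => [H|/negbT]; first lra.
  rewrite -ltNge; lra.
have E x : a0 < aa x -> G (aa x) x - G (aa x) 0 = G a0 x - G a0 0.
  move=> ax; have [H1 H2] := aax x.
  apply: (@der_unique_gt h _ _ (aa x)) => // z az; apply: dG => //.
  exact: lt_trans az.
have [x1 x2] := aax x0.
apply: (@near_eq_is_derive _ _ _ (fun x => G a0 x - G a0 0)); last first.
  have D : is_derive x0 1 (G a0) (h x0) by apply: dG; rewrite /a0; lra.
  have := @is_deriveB _ _ _ _ (cst (G a0 0)) x0 1 _ _ D (is_derive_cst _ _ _).
  by rewrite subr0.
near=> x; symmetry; apply: E; rewrite /a0 /aa.
have : x0 - 1 < x by near: x; apply: lt_nbhsr; rewrite gtrBl.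
rewrite !minEle; case: ifP; case: ifP => //; try lra.
Unshelve. all: by end_near. Qed.

(** A choice of primitive, the zero function by default when there is none. Integrals are
    differences of its values, so endpoints may come in any order. *)
Definition prim h : R -> R :=
  xget (fun=> 0) [set H : R -> R | forall x : R, is_derive x 1 H (h x)].

Lemma primP h (x : R) : continuous h -> is_derive x 1 (prim h) (h x).
Proof.
move=> /prim_exists[H dH]; rewrite /prim.
by case: xgetP => [G _ /(_ x)|/(_ H)] //.
Qed.

Lemma prim_eq h H (a b : R) : continuous h -> (forall x : R, is_derive x 1 H (h x)) ->
  prim h b - prim h a = H b - H a.
Proof.
move=> ch dH.
have m : Num.min a b - 1 < a /\ Num.min a b - 1 < b.
  by rewrite minEle; case: ifP => [|/negbT]; rewrite -?ltNge; lra.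
by apply: (@der_unique_gt h _ _ (Num.min a b - 1) a b _ _ m.1 m.2) => z _ //; exact: primP.
Qed.

Lemma le_prim h k (a b : R) : continuous h -> continuous k -> a <= b ->
  (forall x, a <= x <= b -> h x <= k x) ->
  prim h b - prim h a <= prim k b - prim k a.
Proof.
move=> ch ck ab hk; rewrite -subr_ge0.
have dd (x : R) : is_derive x 1 (fun y => prim k y - prim h y) (k x - h x).
  exact: rderB (primP x ck) (primP x ch).
have [|c + E] := @MVT_segment R (fun y => prim k y - prim h y) (fun x => k x - h x) a b ab.
  by apply: derivable_within_continuous => t _; have [] := dd t.
rewrite inE/= => cab.
suff : 0 <= prim k b - prim h b - (prim k a - prim h a) by lra.
by rewrite E mulr_ge0 // subr_ge0 // hk.
Qed.

(** Componentwise, so that the calculus of curves in the complex plane reduces to real functions. *)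
Definition cder (F : R -> C) (x : R) (d : C) : Prop :=
  is_derive x 1 (fun y => re (F y)) (re d) /\
  is_derive x 1 (fun y => im (F y)) (im d).

Lemma cder_cst (c : C) x : cder (fun=> c) x 0.
Proof. by split; exact: is_derive_cst. Qed.

Lemma cder_eq F x d e : cder F x d -> d = e -> cder F x e.
Proof. by move=> + <-. Qed.

Lemma cderD F G x d e : cder F x d -> cder G x e ->
  cder (fun y => F y + G y) x (d + e).
Proof.
move=> [F1 F2] [G1 G2]; split; rewrite reimE.
- by under eq_fun do rewrite reD; exact: is_deriveD.
- by under eq_fun do rewrite imD; exact: is_deriveD.
Qed.

Lemma cderM F G x d e : cder F x d -> cder G x e ->
  cder (fun y => F y * G y) x (d * G x + F x * e).
Proof.
move=> [F1 F2] [G1 G2]; split; rewrite !reimE.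
- under eq_fun do rewrite reM.
  apply: (is_derive_eq (rderB (rderM F1 G1) (rderM F2 G2))).
  ring.
- under eq_fun do rewrite imM.
  apply: (is_derive_eq (rderD (rderM F1 G2) (rderM F2 G1))).
  ring.
Qed.

Lemma cderZ c F x d : cder F x d -> cder (fun y => c * F y) x (c * d).
Proof.
by move=> dF; apply: (cder_eq (cderM (cder_cst c x) dF)); rewrite mul0r add0r.
Qed.

Lemma cderN F x d : cder F x d -> cder (fun y => - F y) x (- d).
Proof.
move=> /(cderZ (-1)); rewrite mulN1r.
by under eq_fun do rewrite mulN1r.
Qed.

Lemma cderB F G x d e : cder F x d -> cder G x e ->
  cder (fun y => F y - G y) x (d - e).
Proof. by move=> dF /cderN; exact: cderD. Qed.

Lemma cderX F x d n : cder F x d ->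
  cder (fun y => F y ^+ n) x (n%:R * F x ^+ n.-1 * d).
Proof.
move=> dF; elim: n => [|n IH].
  rewrite !mul0r; under eq_fun do rewrite expr0; exact: cder_cst.
under eq_fun do rewrite exprS.
apply: (cder_eq (cderM dF IH)); case: n {IH} => [|n] /=; first by rewrite !expr0; ring.
by rewrite -[in RHS]natr1 exprS; ring.
Qed.

Lemma cder_id x : cder (fun y => rc y) x 1.
Proof. by split; [exact: is_derive_id|exact: is_derive_cst]. Qed.

Lemma cder_comp F (g : R -> R) x d e : cder F (g x) d -> is_derive x 1 g e ->
  cder (fun y => F (g y)) x (d * rc e).
Proof.
move=> [F1 F2] G; split; rewrite !reimE ?mulr0 ?subr0 ?add0r.
- exact: (@is_derive1_comp _ (fun y => re (F y)) g).
- exact: (@is_derive1_comp _ (fun y => im (F y)) g).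
Qed.

Lemma cder_continuous F x d : cder F x d -> {for x, continuous F}.
Proof.
move=> [F1 F2]; apply: reim_cvg.
- exact: (rder_continuous F1).
- exact: (rder_continuous F2).
Qed.

Lemma cder_unique F x d e : cder F x d -> cder F x e -> d = e.
Proof.
move=> [F1 F2] [G1 G2]; apply: complex_ext.
- by rewrite -(@derive_val _ _ _ _ _ _ _ F1) -(@derive_val _ _ _ _ _ _ _ G1).
- by rewrite -(@derive_val _ _ _ _ _ _ _ F2) -(@derive_val _ _ _ _ _ _ _ G2).
Qed.

Definition cint (f : R -> C) (a b : R) : C :=
  Complex (prim (fun x => re (f x)) b - prim (fun x => re (f x)) a)
          (prim (fun x => im (f x)) b - prim (fun x => im (f x)) a).

Implicit Types (f g : R -> C) (c : C).

Lemma continuous_re (f : R -> C) : continuous f -> continuous (fun x => re (f x)).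
Proof. by move=> cf x; apply: re_cvg; exact: cf. Qed.
Lemma continuous_im (f : R -> C) : continuous f -> continuous (fun x => im (f x)).
Proof. by move=> cf x; apply: im_cvg; exact: cf. Qed.

Lemma cint_FTC (f F : R -> C) a b : continuous f -> (forall x, cder F x (f x)) ->
  cint f a b = F b - F a.
Proof.
move=> cf dF; apply: complex_ext; rewrite !reimE.
- apply: (@prim_eq _ (fun x => re (F x)) a b (continuous_re cf)) => x; exact: (dF x).1.
- apply: (@prim_eq _ (fun x => im (F x)) a b (continuous_im cf)) => x; exact: (dF x).2.
Qed.

Lemma cprim (f : R -> C) : continuous f -> exists F, (forall x, cder F x (f x)) /\
  forall a b, cint f a b = F b - F a.
Proof.
move=> cf.
have dF x : cder (fun x => Complex (prim (fun x => re (f x)) x)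
   (prim (fun x => im (f x)) x) : C) x (f x).
  by split; apply: primP; [exact: continuous_re|exact: continuous_im].
by eexists; split; [exact: dF|move=> a b; exact: cint_FTC].
Qed.

Lemma cintD f g a b : continuous f -> continuous g ->
  cint (fun x => f x + g x) a b = cint f a b + cint g a b.
Proof.
move=> cf cg; have [F [dF ->]] := cprim cf; have [G [dG ->]] := cprim cg.
rewrite (@cint_FTC _ (fun x => F x + G x)); first ring.
- by move=> x; apply: cvgD; [exact: cf|exact: cg].
- by move=> x; exact: cderD.
Qed.

Lemma cintZ c f (a b : R) : continuous f ->
  cint (fun x => c * f x) a b = c * cint f a b.
Proof.
move=> cf; have [F [dF ->]] := cprim cf.
rewrite (@cint_FTC _ (fun x => c * F x)); first ring.
- by move=> x; apply: cvgM; [exact: cvg_cst|exact: cf].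
- by move=> x; exact: cderZ.
Qed.

Lemma cintB f g a b : continuous f -> continuous g ->
  cint (fun x => f x - g x) a b = cint f a b - cint g a b.
Proof.
move=> cf cg; have [F [dF ->]] := cprim cf; have [G [dG ->]] := cprim cg.
rewrite (@cint_FTC _ (fun x => F x - G x)); first ring.
- by move=> x; apply: cvgB; [exact: cf|exact: cg].
- by move=> x; exact: cderB.
Qed.

Lemma cint_cst c a b : cint (fun=> c) a b = c * rc (b - a).
Proof.
rewrite (@cint_FTC _ (fun x => c * rc x)); first by rewrite rcD rcN; ring.
- by move=> x; exact: cvg_cst.
- by move=> x; apply: (cder_eq (cderZ c (cder_id x))); rewrite mulr1.
Qed.

Lemma cint_chasles f (a b c : R) : cint f a b + cint f b c = cint f a c.
Proof. by apply: complex_ext; rewrite !reimE /cint /re /im /=; ring. Qed.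

Lemma is_derive_addr (c x : R) : is_derive x 1 (fun y : R => y + c) 1.
Proof. exact: is_derive_shift. Qed.

Lemma cint_shift f (c a b : R) : continuous f ->
  cint (fun x => f (x + c)) a b = cint f (a + c) (b + c).
Proof.
move=> cf; have [F [dF ->]] := cprim cf.
apply: (@cint_FTC _ (fun x => F (x + c))).
- by move=> x; apply: continuous_comp; [apply: cvgD; [exact: cvg_id|exact: cvg_cst]|exact: cf].
- move=> x; have := @cder_comp F (fun y => y + c) x _ 1 (dF (x + c)) (is_derive_addr c x).
  by rewrite rc1 mulr1.
Qed.

Lemma cint_opp f (a b : R) : continuous f ->
  cint (fun x => f (- x)) a b = cint f (- b) (- a).
Proof.
move=> cf; have [F [dF ->]] := cprim cf.
rewrite (@cint_FTC _ (fun x => - F (- x))); first ring.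
- by move=> x; apply: continuous_comp; [exact: opp_continuous|exact: cf].
- move=> x; apply: cder_eq.
    by apply: cderN; apply: (@cder_comp F -%R); exact: dF.
  by rewrite rcN rc1 mulrN1 opprK.
Qed.

Lemma cint_periodic f (T c : R) : continuous f -> (forall x : R, f (x + T) = f x) ->
  cint f c (c + T) = cint f 0 T.
Proof.
move=> cf pf; have := cint_shift T 0 c cf.
under eq_fun do rewrite pf.
rewrite add0r -(cint_chasles f 0 c T) -(cint_chasles f c T (c + T)) => ->.
by rewrite addrC.
Qed.

(** Real and imaginary parts are estimated separately, whence the factor 2; it is harmless in
    estimates whose bound can be made arbitrarily small. *)
Lemma cint_bound f (h : R -> R) a b : continuous f -> continuous h -> a <= b ->
  (forall x, a <= x <= b -> nrm (f x) <= h x) ->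
  nrm (cint f a b) <= 2 * (prim h b - prim h a).
Proof.
move=> cf ch ab fh; apply: le_trans (nrm_le_reim _) _.
have ch' : continuous (fun x => - h x) by move=> x; apply: cvgN; exact: ch.
have E : prim (fun x => - h x) b - prim (fun x => - h x) a = - (prim h b - prim h a).
  apply: (etrans (@prim_eq _ (fun x => - prim h x) a b ch' _)); first by move=> x; apply: rderN; exact: primP.
  by rewrite opprD.
have K (k : R -> R) : continuous k -> (forall x, `|k x| <= nrm (f x)) ->
    `|prim k b - prim k a| <= prim h b - prim h a.
  move=> ck kf; rewrite ler_norml -E; apply/andP; split; apply: le_prim => // x xab.
  - have := le_trans (kf x) (fh x xab); rewrite ler_norml => /andP[]; lra.
  - have := le_trans (kf x) (fh x xab); rewrite ler_norml => /andP[]; lra.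
have := K _ (continuous_re cf) (fun x => nrm_re _).
have := K _ (continuous_im cf) (fun x => nrm_im _).
rewrite /cint /re /im /=; lra.
Qed.

Lemma cint_le f (M : R) a b : continuous f -> a <= b ->
  (forall x, a <= x <= b -> nrm (f x) <= M) ->
  nrm (cint f a b) <= 2 * M * (b - a).
Proof.
move=> cf ab fM; apply: le_trans (@cint_bound f (fun=> M) a b cf _ ab fM) _.
  by move=> x; exact: cvg_cst.
have cM : continuous (fun _ : R => M) by move=> x; exact: cvg_cst.
rewrite (@prim_eq _ (fun x => M * x) a b cM _) -?mulrBr ?mulrA // => x.
by apply: (is_derive_eq (rderM (is_derive_cst M x 1) (is_derive_id x 1))); rewrite mul0r add0r mulr1.
Qed.

End Primitives.

(** * The complex exponential and the unit circle *)

Section Exp.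
Variable R : realType.
Local Notation C := (Cplx R).
Implicit Types (z w : C) (x y : R).

Lemma cder_bound (F dF : R -> C) (M a b : R) : (forall x : R, cder F x (dF x)) ->
  continuous dF -> a <= b -> (forall x : R, a <= x <= b -> nrm (dF x) <= M) ->
  nrm (F b - F a) <= 2 * M * (b - a).
Proof.
by move=> dFE cdF ab bF; rewrite -(cint_FTC a b cdF dFE); exact: cint_le.
Qed.

Definition cis x : C := Complex (cos x) (sin x).

Lemma cisD x y : cis (x + y) = cis x * cis y.
Proof. by apply: complex_ext; rewrite !reimE /re /im /= ?cosD ?sinD; ring. Qed.
Lemma cis0 : cis 0 = 1. Proof. by rewrite /cis cos0 sin0. Qed.
Lemma cis2pi : cis (2 * pi) = 1.
Proof. by rewrite /cis mulr_natl cos2pi sin2pi. Qed.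
Lemma cis_periodic x : cis (x + 2 * pi) = cis x.
Proof. by rewrite cisD cis2pi mulr1. Qed.
Lemma nrm_cis x : nrm (cis x) = 1.
Proof. by rewrite nrmE /re /im /= cos2Dsin2 sqrtr1. Qed.
Lemma circle_nrm z : circle z <-> nrm z = 1.
Proof.
rewrite /circle /= normE -rc1; split; first exact: rc_inj.
by move=> ->.
Qed.
Lemma circle_cis x : circle (cis x).
Proof. by apply/circle_nrm; exact: nrm_cis. Qed.
Lemma cis_neq0 x : cis x != 0.
Proof. by rewrite -nrm_eq0 nrm_cis oner_eq0. Qed.
Lemma cisN x : cis (- x) = (cis x)^-1.
Proof.
by apply: (@mulfI _ (cis x)); rewrite ?cis_neq0 // -cisD subrr cis0 divff ?cis_neq0.
Qed.
Lemma circle_neq0 z : circle z -> z != 0.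
Proof. by move=> /circle_nrm E; rewrite -nrm_eq0 E oner_eq0. Qed.
Lemma circleV z : circle z -> circle z^-1.
Proof. by move=> /circle_nrm E; apply/circle_nrm; rewrite nrmV E invr1. Qed.
Lemma circleM z w : circle z -> circle w -> circle (z * w).
Proof. by move=> /circle_nrm E /circle_nrm F; apply/circle_nrm; rewrite nrmM E F mulr1. Qed.

(** The angle is [acos] of the real part, with the sign of the imaginary part. Confining it to a
    compact interval lets compactness arguments run on the parameter. *)
Lemma circleP z : circle z -> exists2 x, - pi <= x <= pi & z = cis x.
Proof.
move=> /circle_nrm; rewrite nrmE => E.
have E2 : re z ^+ 2 + im z ^+ 2 = 1.
  by rewrite -[LHS]sqr_sqrtr ?E ?expr1n // addr_ge0 ?sqr_ge0.
have b : -1 <= re z <= 1.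
  rewrite -ler_norml -(@ler_pXn2r _ 2) ?nnegrE // expr1n real_normK ?num_real //.
  by rewrite -E2 lerDl sqr_ge0.
have S : sin (acos (re z)) = `|im z|.
  by rewrite sin_acos // -E2 addrC addKr sqrtr_sqr.
have [i0|i0] := leP 0 (im z).
- exists (acos (re z)).
    by rewrite acos_lepi // andbT (le_trans _ (acos_ge0 b)) // oppr_le0 pi_ge0.
  apply: complex_ext; rewrite [RHS]/= /re /im /= -/(re z) -/(im z).
  + by rewrite acosK.
  + by rewrite S ger0_norm.
- exists (- acos (re z)).
    by rewrite lerN2 acos_lepi //= (le_trans _ (pi_ge0 _)) // oppr_le0 acos_ge0.
  apply: complex_ext; rewrite [RHS]/= /re /im /= -/(re z) -/(im z).
  + by rewrite cosN acosK.
  + by rewrite sinN S ltr0_norm ?opprK.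
Qed.

Lemma cexpE z : cexp z = rc (expR (re z)) * cis (im z).
Proof. by apply: complex_ext; rewrite !reimE /re /im /=; ring. Qed.
Lemma cexpD z w : cexp (z + w) = cexp z * cexp w.
Proof. by rewrite !cexpE reD imD expRD cisD rcM; ring. Qed.
Lemma cexp0 : cexp (0 : C) = 1.
Proof. by rewrite cexpE re0 im0 expR0 cis0 mul1r. Qed.
Lemma cexpV z : cexp z * cexp (- z) = 1.
Proof. by rewrite -cexpD subrr cexp0. Qed.
Lemma nrm_cexp z : nrm (cexp z) = expR (re z).
Proof. by rewrite cexpE nrmM nrm_cis mulr1 nrm_rc gtr0_norm // expR_gt0. Qed.
Lemma nrm_cexp_le z : nrm (cexp z) <= expR (nrm z).
Proof. by rewrite nrm_cexp ler_expR; apply: le_trans (ler_norm _) (nrm_re _). Qed.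

Lemma cder_cis x : cder cis x (ci * cis x).
Proof.
split; rewrite !reimE mul0r mul1r ?sub0r ?add0r.
- exact: is_derive_cos.
- exact: is_derive_sin.
Qed.

Lemma cder_rc (f : R -> R) x a : is_derive x 1 f a -> cder (fun y => rc (f y)) x (rc a).
Proof. by move=> df; split; [exact: df|exact: is_derive_cst]. Qed.

Lemma cder_cexp (F : R -> C) x d : cder F x d ->
  cder (fun y => cexp (F y)) x (cexp (F x) * d).
Proof.
move=> [F1 F2].
under eq_fun do rewrite cexpE.
have e1 : is_derive x 1 (fun y => expR (re (F y))) (expR (re (F x)) * re d).
  exact: (is_derive1_comp (is_derive_expR _) F1).
have := cderM (cder_rc e1) (cder_comp (cder_cis (im (F x))) F2).
move/cder_eq; apply.
by rewrite cexpE [X in _ = _ * X](reimP d) rcM; ring.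
Qed.

Lemma cderl z x : cder (fun y => rc y * z) x z.
Proof.
by apply: (cder_eq (cderM (cder_id x) (cder_cst z x))); rewrite mul1r mulr0 addr0.
Qed.

Lemma cder_cexpl z x : cder (fun y => cexp (rc y * z)) x (cexp (rc x * z) * z).
Proof. exact: cder_cexp (cderl z x). Qed.

Lemma nrm_cexp01 z x : 0 <= x <= 1 -> nrm (cexp (rc x * z)) <= expR (nrm z).
Proof.
move=> /andP[x0 x1]; apply: le_trans (nrm_cexp_le _) _; rewrite ler_expR nrmM.
by rewrite nrm_rc ger0_norm // ler_piMl ?nrm_ge0.
Qed.

Lemma cexp_sub1 z x : 0 <= x <= 1 ->
  nrm (cexp (rc x * z) - 1) <= 2 * (expR (nrm z) * nrm z).
Proof.
move=> /andP[x0 x1].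
have := @cder_bound (fun y => cexp (rc y * z)) (fun y => cexp (rc y * z) * z)
  (expR (nrm z) * nrm z) 0 x (cder_cexpl z) _ x0 _.
rewrite rc0 mul0r cexp0 => H.
apply: le_trans (H _ _) _.
- move=> y; apply: cder_continuous.
  exact: (cderM (cder_cexpl z y) (cder_cst z y)).
- move=> y /andP[y0 yx]; rewrite nrmM ler_wpM2r ?nrm_ge0 // nrm_cexp01 // y0.
  exact: le_trans x1.
- rewrite subr0 ler_piMr // mulr_ge0 // mulr_ge0 ?nrm_ge0 //; exact: expR_ge0.
Qed.

(** Mean value inequality along the segment from 0 to [z], the derivative [z (e^(y z) - 1)] being
    controlled by [cexp_sub1]. *)
Lemma cexp_taylor z :
  nrm (cexp z - 1 - z) <= 4 * expR (nrm z) * nrm z ^+ 2.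
Proof.
have := @cder_bound (fun y => cexp (rc y * z) - rc y * z)
  (fun y => cexp (rc y * z) * z - z)
  (2 * (expR (nrm z) * nrm z) * nrm z) 0 1 _ _ ler01 _.
rewrite rc0 mul0r cexp0 rc1 mul1r subr0 => H.
rewrite addrAC; apply: le_trans (H _ _ _) _.
- by move=> y; apply: cderB; [exact: cder_cexpl|exact: cderl].
- move=> y; apply: cder_continuous.
  exact: (cderB (cderM (cder_cexpl z y) (cder_cst z y)) (cder_cst z y)).
- move=> y y01.
  have -> : cexp (rc y * z) * z - z = (cexp (rc y * z) - 1) * z by ring.
  rewrite nrmM ler_wpM2r ?nrm_ge0 //; exact: cexp_sub1.
- by rewrite subr0 expr2; lra.
Qed.

Lemma nbhs_nrm z d : 0 < d -> \forall w \near z, nrm (z - w) < d.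
Proof.
move=> d0; have H : (fun w : C => w) @ nbhs z --> z by exact: cvg_id.
by have /cvg_nrmP/(_ _ d0) := H.
Qed.

Lemma dnbhs_nrm d : 0 < d -> \forall h \near (0 : C)^', h != 0 /\ nrm h < d.
Proof.
move=> d0; rewrite /dnbhs /within /=.
by apply: filterS (nbhs_nrm 0 d0) => h; rewrite sub0r nrmN.
Qed.

Lemma is_derive_cexp z : is_derive z 1 (@cexp R) (cexp z).
Proof.
suff H : h^-1 *: (cexp (h *: (1 : C^o) + z) - cexp z) @[h --> 0^'] --> (cexp z : C^o).
  by apply: DeriveDef; [apply/cvg_ex; eexists; exact: H|exact: cvg_lim H].
apply/cvg_nrmP => e e0.
pose K := 4 * expR 1 * nrm (cexp z) + 1.
have K0 : 0 < K by rewrite ltr_pwDr // mulr_ge0 ?nrm_ge0 // mulr_ge0 // expR_ge0.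
have d0 : 0 < Num.min 1 (e / K) by rewrite lt_min ltr01 divr_gt0.
apply: filterS (dnbhs_nrm d0) => h [h0].
rewrite lt_min => /andP[h1]; rewrite ltr_pdivlMr // => he.
rewrite /GRing.scale /= mulr1.
have -> : cexp z - h^-1 * (cexp (h + z) - cexp z) = - (cexp z * h^-1 * (cexp h - 1 - h)).
  by rewrite cexpD; field.
have hp : 0 < nrm h by rewrite lt_neqAle nrm_ge0 eq_sym nrm_eq0 h0.
rewrite nrmN !nrmM nrmV; apply: le_lt_trans he.
apply: (@le_trans _ _ (nrm (cexp z) / nrm h * (4 * expR (nrm h) * nrm h ^+ 2))).
  by rewrite ler_wpM2l ?cexp_taylor // divr_ge0 ?nrm_ge0.
have -> : nrm (cexp z) / nrm h * (4 * expR (nrm h) * nrm h ^+ 2) =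
   nrm h * (4 * expR (nrm h) * nrm (cexp z)) by field; rewrite gt_eqF.
rewrite ler_wpM2l ?nrm_ge0 // /K.
apply: (@le_trans _ _ (4 * expR 1 * nrm (cexp z))); last by rewrite lerDl.
by rewrite ler_wpM2r ?nrm_ge0 // ler_wpM2l // ler_expR ltW.
Qed.

Definition expsum (n : nat) (w : C) : C := \sum_(k < n) (k`!%:R)^-1 * w ^+ k.

Lemma expsum0 w : expsum 0 w = 0.
Proof. by rewrite /expsum big_ord0. Qed.

Lemma expsumS n w : expsum n.+1 w = expsum n w + (n`!%:R)^-1 * w ^+ n.
Proof. by rewrite /expsum big_ord_recr. Qed.

(** With [E_n] the partial sum, the derivative in [y] of [E_(n+1)(y z) e^(- y z)] telescopes to
    [- z (y z)^n / n! e^(- y z)]. Integrating over [[0, 1]] bounds [E_(n+1)(z) e^(- z) - 1] by a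
    multiple of [|z|^n / n!], which tends to 0. *)
Lemma cexp_series z : (fun n => expsum n z) @ \oo --> cexp z.
Proof.
pose E := expsum.
have dE n x : cder (fun y => E n (rc y * z)) x (z * E n.-1 (rc x * z)).
  rewrite /E; elim: n => [|n IH].
    rewrite expsum0 mulr0; under eq_fun do rewrite expsum0; exact: cder_cst.
  under eq_fun do rewrite expsumS.
  have := cderD IH (cderZ (n`!%:R)^-1 (cderX n (cderl z x))).
  move/cder_eq; apply; case: n {IH} => [|n] /=.
    by rewrite expsum0; ring.
  rewrite expsumS mulrDr; congr (_ + _).
  rewrite factS natrM invfM; field.
  by rewrite !pnatr_eq0 -lt0n fact_gt0 nat1r pnatr_eq0.
have B n : nrm (E n.+1 z * cexp (- z) - 1) <=
    2 * (expR (nrm z) * nrm z) * exp_coeff (nrm z) n.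
  have := @cder_bound (fun y => E n.+1 (rc y * z) * cexp (rc y * - z))
    (fun x => - (z * ((n`!%:R)^-1 * (rc x * z) ^+ n)) * cexp (rc x * - z))
    (expR (nrm z) * nrm z * exp_coeff (nrm z) n) 0 1 _ _ ler01 _.
  rewrite rc0 !mul0r cexp0 rc1 !mul1r subr0 mulr1.
  have -> : E n.+1 0 = 1.
    rewrite /E /expsum big_ord_recl expr0 fact0 invr1 mulr1 big1 ?addr0 // => i _.
    by rewrite expr0n /= mulr0.
  rewrite mulr1 mulrA => H; apply: H.
  - move=> x; have := cderM (dE n.+1 x) (cder_cexpl (- z) x).
    move/cder_eq; apply; rewrite /E expsumS /=; ring.
  - move=> x; apply: cvgM; last by apply: cder_continuous; exact: cder_cexpl.
    apply: (@cvgN _ C^o); apply: cvgM; first exact: cvg_cst.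
    apply: cvgM; first exact: cvg_cst.
    by apply: (cder_continuous (cderX n (cderl z x))).
  - move=> x x01; rewrite nrmM nrmN !nrmM mulrC -!mulrA; apply: ler_pM.
    + exact: nrm_ge0.
    + by rewrite !mulr_ge0 ?nrm_ge0.
    + by rewrite -(nrmN z); exact: nrm_cexp01.
    + rewrite ler_wpM2l ?nrm_ge0 // /exp_coeff nrmV nrm_nat mulrC nrmX ler_wpM2r ?invr_ge0 //.
      rewrite lerXn2r ?nnegrE ?nrm_ge0 // nrmM nrm_rc; case/andP: x01 => x0 x1.
      by rewrite ger0_norm // ler_piMl ?nrm_ge0.
apply/cvg_nrmP => e e0.
have c0 : exp_coeff (nrm z) @ \oo --> 0.
  exact: cvg_series_cvg_0 (is_cvg_series_exp_coeff (nrm z)).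
pose K := 2 * (expR (nrm z) * nrm z) * nrm (cexp z) + 1.
have K0 : 0 < K.
  by rewrite ltr_pwDr // !mulr_ge0 ?nrm_ge0 // expR_ge0.
have /cvgrPdist_lt/(_ _ (divr_gt0 e0 K0)) := c0.
case => N _ HN; exists N.+1 => // -[//|n] /= Nn.
have := HN n Nn; rewrite /= sub0r normrN => Hn.
have -> : cexp z - expsum n.+1 z = - ((E n.+1 z * cexp (- z) - 1) * cexp z).
  rewrite mulrBl -mulrA [cexp (- z) * _]mulrC cexpV /E; ring.
rewrite nrmN nrmM.
apply: (@le_lt_trans _ _ (K * `|exp_coeff (nrm z) n|)).
  apply: le_trans (ler_wpM2r (nrm_ge0 _) (B n)) _.
  rewrite mulrAC; apply: ler_pM.
  - by rewrite !mulr_ge0 ?nrm_ge0 // expR_ge0.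
  - by rewrite exp_coeff_ge0 ?nrm_ge0.
  - by rewrite /K lerDl.
  - exact: ler_norm.
by rewrite mulrC -ltr_pdivlMr.
Qed.

End Exp.

(** * The mean over the circle and Fourier coefficients *)

Section Mean.
Variable R : realType.
Local Notation C := (Cplx R).
Implicit Types (z w l : C) (x y : R) (f g : C -> C).

(** Tube lemma: compactness of the segment turns a condition holding near each point into one
    holding at all points at once. *)
Lemma seg_unif I (F : set_system I) (FF : Filter F) (P : I -> R -> Prop) (a b : R) :
  (forall x, a <= x <= b -> \forall x' \near x & i \near F, P i x') ->
  \forall i \near F, forall x, a <= x <= b -> P i x.
Proof.
move=> H; have K := (compact_near_coveringP _).1 (@segment_compact R a b).
have HK : \near F, `[a, b] `<=` P F.
  by apply: K => x; rewrite /= in_itv /= => /H.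
by apply: filterS HK => i Hi x ab; apply: Hi; rewrite /= in_itv.
Qed.

Lemma nrm_cvg {T} {F : set_system T} {FF : Filter F} (f : T -> C) (l : C) :
  f @ F --> l -> (fun t => nrm (f t)) @ F --> nrm l.
Proof.
move=> /cvg_nrmP H; apply/cvgrPdist_lt => e e0; apply: filterS (H _ e0) => x.
apply: le_lt_trans; rewrite ler_norml; apply/andP; split.
- have := nrmD (f x - l) l; rewrite subrK nrmB; lra.
- have := nrmD (l - f x) (f x); rewrite subrK; lra.
Qed.

Lemma continuous_cis : continuous (@cis R).
Proof. by move=> x; exact: cder_continuous (cder_cis x). Qed.

(* A record, so that unification does not unfold [continuous]. *)
Record ccont f : Prop := CCont { ccontP : continuous (fun x : R => f (cis x)) }.

Lemma ccont_cst c : ccont (fun=> c).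
Proof. by split => x; exact: cvg_cst. Qed.
Lemma ccont_id : ccont (fun l => l).
Proof. by split; exact: continuous_cis. Qed.
Lemma ccontD f g : ccont f -> ccont g -> ccont (fun l => f l + g l).
Proof. by move=> [cf] [cg]; split => x; apply: cvgD; [exact: cf|exact: cg]. Qed.
Lemma ccontB f g : ccont f -> ccont g -> ccont (fun l => f l - g l).
Proof. by move=> [cf] [cg]; split => x; apply: cvgB; [exact: cf|exact: cg]. Qed.
Lemma ccontN f : ccont f -> ccont (fun l => - f l).
Proof. by move=> [cf]; split => x; apply: cvgN; exact: cf. Qed.
Lemma ccontM f g : ccont f -> ccont g -> ccont (fun l => f l * g l).
Proof. by move=> [cf] [cg]; split => x; apply: cvgM; [exact: cf|exact: cg]. Qed.
Lemma ccontX f n : ccont f -> ccont (fun l => f l ^+ n).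
Proof.
move=> cf; elim: n => [|n IH]; first exact: ccont_cst.
by under eq_fun do rewrite exprS; exact: (ccontM cf IH).
Qed.
Lemma ccont_comp_inv f : ccont f -> ccont (fun l => f l^-1).
Proof.
move=> [cf]; split => x; under eq_fun do rewrite -cisN.
by apply: (@continuous_comp _ _ _ -%R (fun y => f (cis y))); [exact: opp_continuous|exact: cf].
Qed.
Lemma ccontV : ccont (fun l => l^-1).
Proof. exact: (ccont_comp_inv ccont_id). Qed.
Lemma ccont_sum I (r : seq I) (F : I -> C -> C) :
  (forall i, ccont (F i)) -> ccont (fun l => \sum_(i <- r) F i l).
Proof.
move=> cF; elim: r => [|i r IH].
  by under eq_fun do rewrite big_nil; exact: ccont_cst.
by under eq_fun do rewrite big_cons; exact: (ccontD (cF i) IH).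
Qed.
Lemma ccont_rot f l : circle l -> ccont f -> ccont (fun m => f (l * m)).
Proof.
move=> /circleP[t _ ->] [cf]; split => x; under eq_fun do rewrite -cisD.
apply: (@continuous_comp _ _ _ (fun y => t + y) (fun y => f (cis y))); last exact: cf.
by apply: cvgD; [exact: cvg_cst|exact: cvg_id].
Qed.
Lemma eq_ccont f g : (forall l, circle l -> f l = g l) -> ccont f -> ccont g.
Proof.
move=> fg [cf]; split.
by under eq_fun do rewrite -(fg _ (circle_cis _)).
Qed.

Lemma ccont_bound f : ccont f -> exists2 M, 0 < M & forall l, circle l -> nrm (f l) <= M.
Proof.
move=> [cf]; have [||c _ Hc] := @EVT_max R (fun x => nrm (f (cis x))) (- pi) pi.
- by have := pi_ge0 R; lra.
- by apply: continuous_subspaceT => x; apply: nrm_cvg; exact: cf.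
exists (nrm (f (cis c)) + 1); first by rewrite ltr_wpDl ?nrm_ge0.
move=> _ /circleP[x xpi ->]; apply: (@le_trans _ _ (nrm (f (cis c)))); last by rewrite lerDl.
by apply: Hc; rewrite inE /= ?in_itv.
Qed.

Lemma ccont_unif f (e : R) : ccont f -> 0 < e -> exists2 d : R, 0 < d &
  forall x l, `|x| < d -> circle l -> nrm (f (l * cis x) - f l) < e.
Proof.
move=> [cf] e0.
have : \forall x \near (0 : R), forall y, - pi <= y <= pi ->
    nrm (f (cis y * cis x) - f (cis y)) < e.
  apply: (@seg_unif _ (nbhs (0 : R)) _
    (fun x y => nrm (f (cis y * cis x) - f (cis y)) < e)) => y _.
  have e2 : 0 < e / 2 by rewrite divr_gt0.
  have /cvg_nrmP/(_ _ e2)/nbhs_ballP[d /= d0 Hd] := cf y.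
  have d2 : 0 < d / 2 by rewrite divr_gt0.
  exists (ball y (d / 2), ball 0 (d / 2)).
    by split; apply: nbhsx_ballx.
  move=> [y' x] /= [/= yy' xx]; rewrite -cisD.
  rewrite -(subrKA (f (cis y))) [e]splitr; apply: le_lt_trans (nrmD _ _) _.
  rewrite [X in X + _]nrmB; apply: ltrD; apply: Hd; rewrite /ball /=.
  + move: yy' xx; rewrite /ball /= sub0r normrN => yy' xx.
    have -> : y - (y' + x) = (y - y') - x by ring.
    apply: le_lt_trans (ler_normB _ _) _; lra.
  + move: yy'; rewrite /ball /=; lra.
move=> /nbhs_ballP[d /= d0 Hd]; exists d => // x l xd /circleP[y yp ->].
by apply: Hd => //; rewrite /ball /= sub0r normrN.
Qed.

Definition mean f : C := (rc (2 * pi))^-1 * cint (fun x => f (cis x)) 0 (2 * pi).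

Lemma twopi_gt0 : 0 < 2 * pi :> R.
Proof. by rewrite mulr_gt0 // pi_gt0. Qed.
Lemma rc2pi_neq0 : rc (2 * pi) != 0 :> C.
Proof. by rewrite -rc0 (inj_eq (@rc_inj R)) gt_eqF // twopi_gt0. Qed.

Lemma eq_mean f g : (forall l, circle l -> f l = g l) -> mean f = mean g.
Proof.
move=> fg; congr (_ * cint _ _ _); apply/funext => x; exact: fg (circle_cis x).
Qed.
Lemma meanD f g : ccont f -> ccont g -> mean (fun l => f l + g l) = mean f + mean g.
Proof. by move=> [cf] [cg]; rewrite /mean (cintD 0 (2 * pi) cf cg) mulrDr. Qed.
Lemma meanB f g : ccont f -> ccont g -> mean (fun l => f l - g l) = mean f - mean g.
Proof. by move=> [cf] [cg]; rewrite /mean (cintB 0 (2 * pi) cf cg) mulrBr. Qed.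
Lemma meanZ c f : ccont f -> mean (fun l => c * f l) = c * mean f.
Proof. by move=> [cf]; rewrite /mean (cintZ c 0 (2 * pi) cf) mulrCA. Qed.
Lemma mean_cst c : mean (fun=> c) = c.
Proof. by rewrite /mean cint_cst subr0 mulrCA mulVf ?mulr1 // rc2pi_neq0. Qed.
Lemma mean_sum I (r : seq I) (F : I -> C -> C) : (forall i, ccont (F i)) ->
  mean (fun l => \sum_(i <- r) F i l) = \sum_(i <- r) mean (F i).
Proof.
move=> cF; elim: r => [|i r IH].
  rewrite big_nil -[RHS](mean_cst 0); apply: eq_mean => l _; by rewrite big_nil.
rewrite big_cons -IH -meanD //; last exact: ccont_sum.
by apply: eq_mean => l _; rewrite big_cons.
Qed.
Lemma mean_le f M : ccont f -> (forall l, circle l -> nrm (f l) <= M) ->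
  nrm (mean f) <= 2 * M.
Proof.
move=> cf fM; rewrite /mean nrmM nrmV nrm_rc gtr0_norm ?twopi_gt0 //.
rewrite mulrC ler_pdivrMr ?twopi_gt0 //.
have := @cint_le R (fun x => f (cis x)) M 0 (2 * pi) (ccontP cf) (ltW twopi_gt0).
by rewrite subr0; apply => x _; apply: fM; exact: circle_cis.
Qed.
Lemma mean_shift f c : ccont f -> mean f =
  (rc (2 * pi))^-1 * cint (fun x => f (cis x)) c (c + 2 * pi).
Proof.
by move=> [cf]; rewrite (cint_periodic c cf) // => x; rewrite cis_periodic.
Qed.
Lemma mean_rot f l : circle l -> ccont f -> mean (fun m => f (l * m)) = mean f.
Proof.
move=> /circleP[t _ ->] cf; rewrite (mean_shift t cf) /mean; congr (_ * _).
have := cint_shift t 0 (2 * pi) (ccontP cf); rewrite add0r [2 * pi + t]addrC => <-.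
by congr (cint _ _ _); apply/funext => x; rewrite addrC cisD.
Qed.
Lemma mean_inv f : ccont f -> mean (fun l => f l^-1) = mean f.
Proof.
move=> cf; rewrite (mean_shift (- (2 * pi)) cf) /mean addNr; congr (_ * _).
have := cint_opp 0 (2 * pi) (ccontP cf); rewrite oppr0 => <-.
by congr (cint _ _ _); apply/funext => x; rewrite cisN.
Qed.

(** An angular derivative integrates to 0 over a full period; this is the source of every
    integration by parts below. *)
Lemma mean_der f g : (forall x, cder (fun y => f (cis y)) x (g (cis x))) ->
  ccont g -> mean g = 0.
Proof.
move=> dfg cg; rewrite /mean (cint_FTC _ _ (ccontP cg) dfg) cis2pi cis0 subrr mulr0 //.
Qed.

(** For [a <> b] the monomial is an eigenvector of the angular derivative with nonzero eigenvalue
    [i (a - b)], while an angular derivative has mean 0. *)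
Lemma mean_mono (a b : nat) :
  mean (fun l => l ^+ a * l^-1 ^+ b) = (a == b)%:R.
Proof.
have [->|ab] := eqVneq a b.
  rewrite -[RHS]mean_cst; apply: eq_mean => l /circle_neq0 l0.
  by rewrite -exprMn divff // expr1n.
have cc : ccont (fun l => l ^+ a * l^-1 ^+ b).
  exact: (ccontM (ccontX a ccont_id) (ccontX b ccontV)).
suff : ci * (a%:R - b%:R) * mean (fun l => l ^+ a * l^-1 ^+ b) = 0.
  move/eqP; rewrite mulf_eq0 => /orP[|/eqP //]; rewrite mulf_eq0 => /orP[|].
    by rewrite -nrm_eq0 nrm_ci oner_eq0.
  by rewrite subr_eq0 eqr_nat (negbTE ab).
rewrite -(meanZ _ cc).
apply: (@mean_der (fun l => l ^+ a * l^-1 ^+ b)).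
  move=> x; have d1 := cderX a (cder_cis x).
  have d2 : cder (fun y => (cis y)^-1) x (- (ci * (cis x)^-1)).
    under eq_fun do rewrite -cisN.
    have := @cder_comp R (@cis R) -%R x _ (-1) (cder_cis (- x)) (is_deriveNid _ _).
    by rewrite rcN rc1 mulrN1 cisN.
  apply: (cder_eq (cderM d1 (cderX b d2))).
  have c0 := cis_neq0 x.
  case: a {ab cc d1} => [|a]; case: b {d2} => [|b] /=; rewrite ?exprS ?expr0; field.
  1-4: exact: c0.
exact: (ccontM (ccont_cst _) cc).
Qed.

End Mean.

Ltac cc := repeat match goal with
  | H : ccont ?f |- ccont ?f => exact: H
  | H : forall _, ccont _ |- ccont _ => exact: H
  | |- ccont (fun _ => ?c) => exact: ccont_cst
  | |- ccont (fun l => l) => exact: ccont_id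
  | |- ccont (fun l => l^-1) => exact: ccontV
  | |- ccont (fun l => @?f l * @?g l) => apply: (@ccontM _ f g)
  | |- ccont (fun l => @?f l + - @?g l) => apply: (@ccontB _ f g)
  | |- ccont (fun l => @?f l + @?g l) => apply: (@ccontD _ f g)
  | |- ccont (fun l => - @?f l) => apply: (@ccontN _ f)
  | |- ccont (fun l => @?f l ^+ ?n) => apply: (@ccontX _ f n)
  | |- ccont (fun l => \sum_(i < _) _) => apply: ccont_sum => ?
  | |- ccont _ => eassumption
  end.

(** * Boundary values: the classes [Out] and [In] and their Fourier coefficients *)

Section OutAlgebra.
Variable R : realType.
Local Notation C := (Cplx R).
Implicit Types (z w l c : C) (f g F : C -> C).

Definition rint (h : R -> R) (a b : R) : R := prim h b - prim h a.

Lemma rint_cst (c a b : R) : rint (fun=> c) a b = c * (b - a).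
Proof.
have cM : continuous (fun _ : R => c) by move=> x; exact: cvg_cst.
rewrite /rint (@prim_eq _ _ (fun x => c * x) a b cM _) -?mulrBr // => x.
by apply: (is_derive_eq (rderM (is_derive_cst c x 1) (is_derive_id x 1))); rewrite mul0r add0r mulr1.
Qed.

Lemma rintDZ (h k : R -> R) (u v a b : R) : continuous h -> continuous k ->
  rint (fun x => u * h x + v * k x) a b = u * rint h a b + v * rint k a b.
Proof.
move=> ch ck.
have c : continuous (fun x => u * h x + v * k x).
  by move=> x; apply: cvgD; apply: cvgM; try exact: cvg_cst; [exact: ch|exact: ck].
rewrite /rint (@prim_eq _ _ (fun x => u * prim h x + v * prim k x) a b c _); first ring.
move=> x; have D1 := rderM (is_derive_cst u x 1) (primP x ch).
have D2 := rderM (is_derive_cst v x 1) (primP x ck).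
by apply: (is_derive_eq (rderD D1 D2)); rewrite !mul0r !add0r.
Qed.

Lemma rint_ge (h : R -> R) (m a b : R) : continuous h -> a <= b ->
  (forall x, a <= x <= b -> m <= h x) -> m * (b - a) <= rint h a b.
Proof.
move=> ch ab hm; rewrite -rint_cst; apply: le_prim => //.
by move=> x; exact: cvg_cst.
Qed.

(* [(2 + 2 cos x) ^ N], suitably normalised, is an approximate identity; it is the
   value at [cis x] of the Laurent polynomial [(2 + l + l^-1) ^ N]. *)
Definition pker (x : R) : R := 2 + 2 * cos x.

Lemma pker_ge0 x : 0 <= pker x.
Proof. by have := cos_geN1 x; rewrite /pker; lra. Qed.

Lemma pkerX_continuous N : continuous (fun x => pker x ^+ N).
Proof.
move=> x; apply: (@continuous_comp _ _ _ pker (fun y : R => y ^+ N)).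
  apply: cvgD; first exact: cvg_cst.
  by apply: cvgM; [exact: cvg_cst|exact: continuous_cos].
exact: exprn_continuous.
Qed.

Lemma cis_pker x : 2 + cis x + (cis x)^-1 = rc (pker x) :> C.
Proof.
have -> : (2 : C) = rc 2 by rewrite -(rc_nat R 2).
rewrite -cisN; apply: complex_ext; rewrite !reimE /pker /re /im /=.
- by rewrite cosN; ring.
- by rewrite sinN; ring.
Qed.

Lemma cos_le_pos (d x : R) : 0 <= d -> d <= `|x| -> `|x| <= pi -> cos x <= cos d.
Proof.
move=> d0 dx xpi; have -> : cos x = cos `|x|.
  by case: (ger0P x) => // _; rewrite cosN.
rewrite leNgt; apply/negP; rewrite ltr_cos ?in_itv /= ?d0 ?normr_ge0 ?xpi //.
  by rewrite ltNge dx.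
exact: le_trans xpi.
Qed.

Definition lker (m : C) : C := 2 + m + m^-1.

Lemma ccont_lkerX N : ccont (fun m : C => lker m ^+ N).
Proof.
by rewrite /lker; cc.
Qed.

Lemma mean_pi f : ccont f ->
  mean f = (rc (2 * pi))^-1 * cint (fun x => f (cis x)) (- pi) pi.
Proof.
move=> cf; rewrite (mean_shift (- pi) cf); congr (_ * cint _ _ _); ring.
Qed.

Lemma mean_lker N : mean (fun m => lker m ^+ N) =
  rc ((2 * pi)^-1 * rint (fun x => pker x ^+ N) (- pi) pi).
Proof.
rewrite (mean_pi (ccont_lkerX N)) [RHS]rcM [X in _ = X * _]rcV; congr (_ * _).
have cp := @pkerX_continuous N.
rewrite (@cint_FTC R _ (fun x => rc (prim (fun x => pker x ^+ N) x)) _ _ (ccontP (ccont_lkerX N))).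
  by rewrite /rint rcD rcN.
move=> x; apply: (cder_eq (cder_rc (primP x cp))).
rewrite /lker cis_pker; elim: N {cp} => [|N IH]; first by rewrite !expr0.
by rewrite !exprS rcM IH.
Qed.

(** Rotations by an angle below [d] move [g] by less than [e / 4]. For larger angles the kernel is
    at most [q1 ^ N], while its integral is at least [d q2 ^ N] thanks to the angles below [d / 2];
    as [q1 < q2], the far part is negligible for large [N]. The factor [kap] is the inverse of the
    mean of the kernel. *)
Lemma kernel_approx g (e : R) : ccont g -> 0 < e ->
  exists N (kap : C), forall l, circle l ->
    nrm (g l - kap * mean (fun m => g (l * m^-1) * lker m ^+ N)) <= e.
Proof.
move=> cg e0; have [B B0 HB] := ccont_bound cg.
have [d0 d0p Hd0] := ccont_unif cg (divr_gt0 e0 (ltr0n R 4)).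
pose d := Num.min d0 1.
have d_gt0 : 0 < d by rewrite lt_min d0p ltr01.
have d_le : d <= d0 by rewrite ge_min lexx.
have d_pi : d <= pi.
  have := pi_ge2 R; have : d <= 1 by rewrite ge_min lexx orbT.
  lra.
have Hd (x : R) l : `|x| < d -> circle l -> nrm (g (l * cis x) - g l) < e / 4.
  by move=> xd; apply: Hd0; exact: lt_le_trans d_le.
pose q1 := pker d; pose q2 := pker (d / 2).
have q12 : q1 < q2.
  rewrite /q1 /q2 /pker ltrD2l ltr_pM2l // ltr_cos ?in_itv /= ?(ltW d_gt0) ?d_pi //; lra.
have q10 : 0 <= q1 by exact: pker_ge0.
have q20 : 0 < q2 by exact: le_lt_trans q12.
have : (fun n => (q1 / q2) ^+ n) @ \oo --> (0 : R).
  by apply: cvg_expr; rewrite ger0_norm ?divr_ge0 // ?ltr_pdivrMr ?mul1r // ltW.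
have pi0 : 0 < pi :> R by exact: pi_gt0.
(* Chosen so that, once [(q1 / q2) ^ N < eta], the angles beyond [d] contribute at most half of
   [e I], where [I] is the integral of the kernel; see [K1] and [K2]. *)
pose eta := e * d / (16 * pi * B).
have eta0 : 0 < eta by rewrite /eta divr_gt0 // ?mulr_gt0.
move=> /cvgrPdist_lt/(_ _ eta0)[N _ /(_ N (leqnn N))] /=.
rewrite sub0r normrN ger0_norm ?exprn_ge0 ?divr_ge0 // 1?ltW // expr_div_n => HN.
pose h := fun x => pker x ^+ N.
have ch : continuous h by exact: pkerX_continuous.
pose J := (2 * pi)^-1 * rint h (- pi) pi.
have JB : d * q2 ^+ N <= rint h (- pi) pi.
  have -> : rint h (- pi) pi = rint h (- pi) (- (d / 2)) + rint h (- (d / 2)) (d / 2) + rint h (d / 2) pi.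
    by rewrite /rint; ring.
  have P1 : 0 * (- (d / 2) - - pi) <= rint h (- pi) (- (d / 2)).
    by apply: rint_ge => //; [lra|move=> x _; rewrite exprn_ge0 // pker_ge0].
  have P2 : 0 * (pi - d / 2) <= rint h (d / 2) pi.
    by apply: rint_ge => //; [lra|move=> x _; rewrite exprn_ge0 // pker_ge0].
  have P3 : q2 ^+ N * (d / 2 - - (d / 2)) <= rint h (- (d / 2)) (d / 2).
    apply: rint_ge => //; first lra.
    move=> x xd; rewrite lerXn2r ?nnegrE ?pker_ge0 //.
    rewrite /q2 /pker lerD2l ler_pM2l //.
    rewrite -[X in cos X <= _](@ger0_norm _ (d/2)); last lra.
    have -> : cos x = cos `|x| by case: (ger0P x) => // _; rewrite cosN.
    have nx : `|x| <= d / 2 by rewrite ler_norml.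
    rewrite leNgt ltr_cos ?in_itv /= ?normr_ge0 //=; last 2 first.
      by rewrite ger0_norm; lra.
      by apply: le_trans nx _; lra.
    by rewrite -leNgt (le_trans nx) // ler_norm.
  move: P1 P2 P3; rewrite !mul0r => P1 P2 P3; lra.
have RI0 : 0 < rint h (- pi) pi by apply: lt_le_trans JB; rewrite mulr_gt0 // exprn_gt0.
have J0 : 0 < J by rewrite /J mulr_gt0 // invr_gt0 mulr_gt0.
exists N, (rc J^-1) => l cl.
have Jn : rc J != 0 by rewrite -rc0 (inj_eq (@rc_inj R)) gt_eqF.
have cg' : ccont (fun m => g (l * m^-1)).
  exact: (ccont_comp_inv (ccont_rot cl cg)).
have cD : ccont (fun m => (g (l * m^-1) - g l) * lker m ^+ N).
  exact: (ccontM (ccontB cg' (ccont_cst _)) (ccont_lkerX N)).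
have -> : g l - rc J^-1 * mean (fun m => g (l * m^-1) * lker m ^+ N) =
   - (rc J^-1 * mean (fun m => (g (l * m^-1) - g l) * lker m ^+ N)).
  have -> : mean (fun m => (g (l * m^-1) - g l) * lker m ^+ N) =
     mean (fun m => g (l * m^-1) * lker m ^+ N) - g l * rc J.
    rewrite -mean_lker -(meanZ _ (ccont_lkerX N)) -meanB.
    + by apply: eq_mean => m _; rewrite mulrBl.
    + exact: (ccontM cg' (ccont_lkerX N)).
    + exact: (ccontM (ccont_cst _) (ccont_lkerX N)).
  by rewrite rcV; field.
rewrite nrmN nrmM nrm_rc gtr0_norm ?invr_gt0 //.
(* A common majorant: the first summand serves the angles below [d], the second the others, [2 B]
   bounding the variation of [g]. *)
pose H x := (e / 4) * h x + (2 * B * q1 ^+ N) * 1.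
have cH : continuous H.
  move=> x; apply: cvgD; last exact: cvg_cst.
  by apply: cvgM; [exact: cvg_cst|exact: ch].
have bnd : nrm (cint (fun x => (g (l * (cis x)^-1) - g l) * lker (cis x) ^+ N) (- pi) pi)
   <= 2 * rint H (- pi) pi.
  apply: (@cint_bound R (fun x => (g (l * (cis x)^-1) - g l) * lker (cis x) ^+ N) H _ _ (ccontP cD) cH); first lra.
  move=> x xpi; rewrite nrmM nrmX /lker cis_pker nrm_rc ger0_norm ?pker_ge0 //.
  rewrite /H mulr1; have px0 : 0 <= pker x ^+ N by rewrite exprn_ge0 // pker_ge0.
  have q1N : 0 <= 2 * B * q1 ^+ N by rewrite mulr_ge0 ?exprn_ge0 // mulr_ge0 // ltW.
  have [xd|xd] := ltP `|x| d.
    apply: (@le_trans _ _ (e / 4 * h x)); last by rewrite lerDl.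
    by rewrite ler_wpM2r // -cisN ltW // Hd // normrN.
  apply: (@le_trans _ _ (2 * B * q1 ^+ N)); last first.
    by rewrite lerDr mulr_ge0 // divr_ge0 // ltW.
  apply: ler_pM => //; first exact: nrm_ge0.
    apply: le_trans (nrmD _ _) _; rewrite nrmN mulr_natl mulr2n lerD // HB //.
    by apply: circleM => //; apply: circleV; exact: circle_cis.
  rewrite lerXn2r ?nnegrE ?pker_ge0 // /q1 /pker lerD2l ler_pM2l //.
  by apply: cos_le_pos => //; [exact: ltW|rewrite ler_norml].
have c1 : continuous (fun _ : R => 1 : R) by move=> x; exact: cvg_cst.
rewrite (rintDZ _ _ _ _ ch c1) rint_cst mul1r in bnd.
rewrite (mean_pi cD) nrmM nrmV nrm_rc gtr0_norm ?twopi_gt0 //.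
have -> : J^-1 = 2 * pi / rint h (- pi) pi by rewrite /J invfM invrK.
set I := rint h _ _ in RI0 JB bnd *.
set X := nrm _ in bnd *.
have aux (a b x : R) : a != 0 -> b != 0 -> a / b * (a^-1 * x) = x / b.
  by move=> a0 b0; field; rewrite a0 b0.
rewrite aux ?gt_eqF ?twopi_gt0 //.
rewrite ler_pdivrMr //; apply: le_trans bnd _.
have K1 : q1 ^+ N * (16 * pi * B) <= e * d * q2 ^+ N.
  move: HN; rewrite ltr_pdivrMr ?exprn_gt0 // /eta => /ltW HN.
  have PB : 0 < 16 * pi * B by rewrite !mulr_gt0.
  rewrite -ler_pdivlMr //; apply: le_trans HN _; rewrite le_eqVlt; apply/orP; left.
  by apply/eqP; ring.
have K2 : e * (d * q2 ^+ N) <= e * I by rewrite ler_pM2l.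
have -> : 2 * (e / 4 * I + 2 * B * q1 ^+ N * (pi - - pi)) =
  e * I / 2 + (q1 ^+ N * (16 * pi * B)) / 2 by field.
lra.
Qed.

(* For continuous [f], the vanishing of the coefficients of positive powers means
   that [f] extends holomorphically outside the circle. *)
Definition Out f : Prop :=
  ccont f /\ forall k : nat, mean (fun l => l^-1 ^+ k.+1 * f l) = 0.

Lemma ccontVX k : ccont (fun l : C => l^-1 ^+ k).
Proof. exact: (@ccontX R (fun l => l^-1) k (@ccontV R)). Qed.
Lemma ccont_pow k : ccont (fun l : C => l ^+ k).
Proof. exact: (@ccontX R (fun l => l) k (@ccont_id R)). Qed.

(** Since [2 + q + q^-1 = q^-1 (q + 1)^2], the power [N] is a binomial expansion of degree [2 N]
    shifted by [- N]; each of its terms separates [l] from [m]. *)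
Lemma lker_expand N l m : circle l -> circle m ->
  lker (l * m^-1) ^+ N = \sum_(k < (N + N).+1)
    'C(N + N, k)%:R * (l ^+ k * l^-1 ^+ N) * (m ^+ N * m^-1 ^+ k).
Proof.
move=> cl cm; have l0 := circle_neq0 cl; have m0 := circle_neq0 cm.
have -> : lker (l * m^-1) = (l^-1 * m) * (l * m^-1 + 1) ^+ 2.
  by rewrite /lker; field; rewrite l0 m0.
rewrite exprMn -exprM mul2n -addnn addrC exprDn mulr_sumr; apply: eq_bigr => k _.
by rewrite expr1n mul1r !exprMn -mulr_natl; ring.
Qed.

Lemma mulXV_le k n l : circle l -> (k <= n)%N -> l ^+ k * l^-1 ^+ n = l^-1 ^+ (n - k).
Proof.
move=> /circle_neq0 l0 kn; rewrite !exprVn expfB_cond; last by rewrite (negbTE l0).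
by rewrite invf_div.
Qed.

Lemma mulVX_le k n l : circle l -> (k <= n)%N -> l ^+ n * l^-1 ^+ k = l ^+ (n - k).
Proof.
move=> /circle_neq0 l0 kn; rewrite !exprVn expfB_cond //; by rewrite (negbTE l0).
Qed.

(** Convolution with the kernel replaces [g] by a uniformly close Laurent polynomial [P] whose
    coefficients are multiples of those of [g]. Hence [P] has only nonpositive powers, and the mean
    of [F] against each of them is 0. *)
Lemma Out_mul0 F g : ccont F -> Out g ->
  (forall k : nat, mean (fun l => l^-1 ^+ k * F l) = 0) ->
  mean (fun l => F l * g l) = 0.
Proof.
move=> cF [cg og] oF.
apply/eqP; rewrite -nrm_eq0 eq_le nrm_ge0 andbT; apply/ler_addgt0Pl => e e0.
rewrite addr0; have [M M0 HM] := ccont_bound cF.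
have d0 : 0 < e / (2 * M) by rewrite divr_gt0 // mulr_gt0.
have [N [kap Hk]] := kernel_approx cg d0.
pose c k := kap * 'C(N + N, k)%:R * mean (fun m => m ^+ N * m^-1 ^+ k * g m).
pose P l := \sum_(k < (N + N).+1) c k * (l ^+ k * l^-1 ^+ N).
have ckl (k : nat) : ccont (fun l : C => l ^+ k * l^-1 ^+ N).
  by cc.
have ckm (k : nat) : ccont (fun l : C => l ^+ N * l^-1 ^+ k).
  by cc.
have ckg (k : nat) : ccont (fun l : C => l ^+ N * l^-1 ^+ k * g l).
  by cc.
have cP : ccont P.
  by rewrite /P; cc.
have PE l : circle l -> P l = kap * mean (fun m => g (l * m^-1) * lker m ^+ N).
  move=> cl; pose G m := g (l * m^-1) * lker m ^+ N.
  have cG : ccont G.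
    exact: (ccontM (ccont_comp_inv (ccont_rot cl cg)) (ccont_lkerX N)).
  rewrite -/G -(mean_inv cG) -(mean_rot (circleV cl) (ccont_comp_inv cG)).
  have -> : mean (fun m => G (l^-1 * m)^-1) = mean (fun m => \sum_(k < (N + N).+1)
     ('C(N + N, k)%:R * (l ^+ k * l^-1 ^+ N)) * (m ^+ N * m^-1 ^+ k * g m)).
    apply: eq_mean => m cm; have l0 := circle_neq0 cl; have m0 := circle_neq0 cm.
    rewrite /G invrK mulrA divff // mul1r.
    have -> : (l^-1 * m)^-1 = l * m^-1 by field; rewrite l0 m0.
    rewrite (lker_expand N cl cm) mulr_sumr; apply: eq_bigr => k _; ring.
  rewrite mean_sum; last by move=> k; cc.
  rewrite mulr_sumr; apply: eq_bigr => k _; rewrite (meanZ _ (ckg k)) /c; ring.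
have FP : mean (fun l => F l * P l) = 0.
  have -> : mean (fun l => F l * P l) =
      mean (fun l => \sum_(k < (N + N).+1) c k * (l ^+ k * l^-1 ^+ N * F l)).
    apply: eq_mean => l _; rewrite /P mulr_sumr; apply: eq_bigr => k _; ring.
  have ckF (k : nat) : ccont (fun l : C => l ^+ k * l^-1 ^+ N * F l).
    by cc.
  rewrite mean_sum; last by move=> k; cc.
  apply: big1 => k _; rewrite (meanZ _ (ckF k)).
  have [kN|Nk] := leqP k N.
    have -> : mean (fun l => l ^+ k * l^-1 ^+ N * F l) = mean (fun l => l^-1 ^+ (N - k) * F l).
      by apply: eq_mean => l cl; rewrite mulXV_le.
    by rewrite oF mulr0.
  rewrite /c; have -> : mean (fun m => m ^+ N * m^-1 ^+ k * g m) = 0.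
    rewrite -(og (k - N).-1); apply: eq_mean => l cl.
    by rewrite prednK ?subn_gt0 // (mulXV_le cl (ltnW Nk)).
  by rewrite mulr0 mul0r.
have -> : mean (fun l => F l * g l) = mean (fun l => F l * (g l - P l)).
  rewrite -[LHS]subr0 -FP -meanB; last 2 first.
  - exact: (ccontM cF cg).
  - exact: (ccontM cF cP).
  by apply: eq_mean => l _; rewrite mulrBr.
apply: le_trans (@mean_le _ _ (M * (e / (2 * M))) (ccontM cF (ccontB cg cP)) _) _.
  move=> l cl; rewrite nrmM; apply: ler_pM; rewrite ?nrm_ge0 ?HM // PE //; exact: Hk.
by rewrite le_eqVlt; apply/orP; left; apply/eqP; field; rewrite gt_eqF.
Qed.

Lemma Out_cst c : Out (fun=> c).
Proof.
split; first exact: ccont_cst.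
move=> k; have -> : mean (fun l => l^-1 ^+ k.+1 * c) = mean (fun l => c * (l ^+ 0 * l^-1 ^+ k.+1)).
  by apply: eq_mean => l _; rewrite expr0 mul1r mulrC.
rewrite (meanZ c (f := fun l => l ^+ 0 * l^-1 ^+ k.+1)); last by cc.
by rewrite mean_mono mulr0.
Qed.

Lemma eq_Out f g : (forall l, circle l -> f l = g l) -> Out f -> Out g.
Proof.
move=> fg [cf of_]; split; first exact: eq_ccont cf.
by move=> k; rewrite -(of_ k); apply: eq_mean => l cl; rewrite fg.
Qed.

Lemma OutD f g : Out f -> Out g -> Out (fun l => f l + g l).
Proof.
move=> [cf of_] [cg og]; split; first exact: ccontD.
move=> k; rewrite -[RHS]addr0 -{1}(of_ k) -(og k) -meanD.
- by apply: eq_mean => l _; rewrite mulrDr.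
- by cc.
- by cc.
Qed.

Lemma OutM f g : Out f -> Out g -> Out (fun l => f l * g l).
Proof.
move=> [cf of_] og; have cg := og.1; split; first by cc.
move=> k; have -> : mean (fun l => l^-1 ^+ k.+1 * (f l * g l)) =
   mean (fun l => (l^-1 ^+ k.+1 * f l) * g l).
  by apply: eq_mean => l _; rewrite mulrA.
apply: Out_mul0 => //; first by cc.
move=> j; rewrite -(of_ (j + k)%N); apply: eq_mean => l _.
by rewrite mulrA -exprD addnS.
Qed.

Lemma OutZ c f : Out f -> Out (fun l => c * f l).
Proof. by move=> of_; apply: OutM => //; exact: Out_cst. Qed.
Lemma OutN f : Out f -> Out (fun l => - f l).
Proof.
by move=> /(OutZ (-1)); apply: eq_Out => l _; rewrite mulN1r.
Qed.
Lemma OutB f g : Out f -> Out g -> Out (fun l => f l - g l).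
Proof. by move=> of_ /OutN; exact: OutD. Qed.

(** The difference [f - mean f] has only negative powers, so [Out_mul0] applies to it. This
    expresses that evaluation at infinity is multiplicative. *)
Lemma mean_OutM f g : Out f -> Out g -> mean (fun l => f l * g l) = mean f * mean g.
Proof.
move=> [cf of_] og; have cg := og.1.
have E : mean (fun l => (f l - mean f) * g l) = 0.
  apply: Out_mul0 => //; first exact: (ccontB cf (ccont_cst _)).
  move=> k; have -> : mean (fun l => l^-1 ^+ k * (f l - mean f)) =
     mean (fun l => l^-1 ^+ k * f l) - mean f * mean (fun l => l ^+ 0 * l^-1 ^+ k).
    have c0k : ccont (fun l : C => l ^+ 0 * l^-1 ^+ k) by cc.
    rewrite -(meanZ _ c0k) -meanB.
    - by apply: eq_mean => l _; rewrite expr0; ring.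
    - by cc.
    - by cc.
  rewrite mean_mono; case: k => [|k] /=.
    rewrite mulr1; apply/eqP; rewrite subr_eq0; apply/eqP; apply: eq_mean => l _.
    by rewrite expr0 mul1r.
  by rewrite of_ mulr0 subr0.
apply/eqP; rewrite -subr_eq0; apply/eqP; rewrite -[RHS]E -(meanZ _ cg) -meanB.
- by apply: eq_mean => l _; rewrite mulrBl.
- exact: (ccontM cf cg).
- by cc.
Qed.

(* The coefficient of [lambda ^- n]. *)
Definition coef (f : C -> C) (n : nat) : C := mean (fun l => l ^+ n * f l).

Lemma coef0E f : coef f 0 = mean f.
Proof. by apply: eq_mean => l _; rewrite mul1r. Qed.

(** Removing from [f] its first [n + 1] terms [S] leaves only powers below [lambda^-n], so
    [lambda^n (f - S)] pairs to 0 with [g]; what remains is the finite Cauchy product. *)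
Lemma coef_mul f g n : Out f -> Out g ->
  coef (fun l => f l * g l) n = \sum_(i < n.+1) coef f i * coef g (n - i)%N.
Proof.
move=> [cf of_] og; have cg := og.1.
pose S l := \sum_(i < n.+1) coef f i * l^-1 ^+ i.
have cS : ccont S.
  by rewrite /S; cc.
have E : mean (fun l => (l ^+ n * (f l - S l)) * g l) = 0.
  apply: Out_mul0 => //.
    by cc.
  move=> k.
  have -> : mean (fun l => l^-1 ^+ k * (l ^+ n * (f l - S l))) =
     mean (fun l => l^-1 ^+ k * (l ^+ n * f l)) -
     \sum_(i < n.+1) coef f i * mean (fun l => l ^+ n * l^-1 ^+ (i + k)).
    have cc (i : nat) : ccont (fun l : C => l ^+ n * l^-1 ^+ (i + k)).
      by cc.
    under eq_bigr do rewrite -(meanZ _ (cc _)).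
    rewrite -mean_sum; last by move=> i; cc.
    rewrite -meanB.
    - apply: eq_mean => l _; rewrite /S !mulrBr; congr (_ - _).
      rewrite !mulr_sumr; apply: eq_bigr => i _; rewrite exprD; ring.
    - by cc.
    - by apply: ccont_sum => i; cc.
  under eq_bigr do rewrite mean_mono.
  have [kn|nk] := leqP k n.
    have kn1 : (n - k < n.+1)%N by rewrite ltnS leq_subr.
    rewrite (bigD1 (Ordinal kn1)) //= subnK // eqxx mulr1 big1 ?addr0.
      apply/eqP; rewrite subr_eq0; apply/eqP; apply: eq_mean => l cl.
      by rewrite mulrA [_ * l ^+ n]mulrC mulVX_le.
    move=> i ni; case: eqP => // e; rewrite ?mulr0 //.
    case/eqP: ni; apply: val_inj => /=; move: e; move: (nat_of_ord i) => j e.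
    by rewrite e addnK.
  rewrite big1 ?subr0 => [|i _]; last first.
    case: eqP => [e|]; rewrite ?mulr0 //; exfalso; move: e; move: (nat_of_ord i) => j e.
    by move: nk; rewrite e ltnNge leq_addl.
  rewrite -(of_ (k - n).-1); apply: eq_mean => l cl.
  by rewrite prednK ?subn_gt0 // mulrA [_ * l ^+ n]mulrC (mulXV_le cl (ltnW nk)).
apply/eqP; rewrite -subr_eq0; apply/eqP; rewrite -[RHS]E /coef.
have cc (i : nat) : ccont (fun l : C => l ^+ i * g l).
  by cc.
under eq_bigr do rewrite -(meanZ _ (cc _)).
rewrite -mean_sum; last by move=> i; cc.
rewrite -meanB; last 2 first.
- by cc.
- by apply: ccont_sum => i; cc.
apply: eq_mean => l cl; rewrite mulrBr mulrBl mulrA; congr (_ - _).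
rewrite /S mulr_sumr mulr_suml; apply: eq_bigr => i _.
by rewrite -(mulVX_le cl (ltn_ord i : i <= n)%N) /coef; ring.
Qed.

(** Vanishing at infinity compensates the pole of [lambda] there. *)
Lemma Out_shift f : Out f -> mean f = 0 -> Out (fun l => l * f l).
Proof.
move=> [cf of_] m0; split; first by cc.
move=> k; have -> : mean (fun l => l^-1 ^+ k.+1 * (l * f l)) = mean (fun l => l^-1 ^+ k * f l).
  by apply: eq_mean => l cl; rewrite exprSr -mulrA mulKf ?circle_neq0.
case: k => [|k //]; rewrite -[RHS]m0; apply: eq_mean => l _; by rewrite mul1r.
Qed.

Lemma ccont_lim f : (forall e : R, 0 < e -> exists2 h, ccont h &
  forall l, circle l -> nrm (f l - h l) <= e) -> ccont f.
Proof.
move=> H; split => x; apply/cvg_nrmP => e e0.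
have e4 : 0 < e / 4 by rewrite divr_gt0.
have [h ch Hh] := H _ e4.
have [ch'] := ch; have /cvg_nrmP/(_ _ e4) := ch' x; apply: filterS => y hy.
have -> : f (cis x) - f (cis y) = (f (cis x) - h (cis x)) + (h (cis x) - h (cis y)) - (f (cis y) - h (cis y)).
  ring.
apply: le_lt_trans (nrmD _ _) _; rewrite nrmN.
have := nrmD (f (cis x) - h (cis x)) (h (cis x) - h (cis y)).
by have := Hh _ (circle_cis x); have := Hh _ (circle_cis y); lra.
Qed.

Lemma mean_near f h (e : R) : ccont f -> ccont h ->
  (forall l, circle l -> nrm (f l - h l) <= e) -> nrm (mean f - mean h) <= 2 * e.
Proof. by move=> cf ch H; rewrite -(meanB cf ch); exact: mean_le (ccontB cf ch) H. Qed.

(** The defining conditions are means of continuous functions and therefore pass to uniform limits.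
    This keeps time derivatives of loops in the class. *)
Lemma Out_lim f : (forall e : R, 0 < e -> exists2 h, Out h &
  forall l, circle l -> nrm (f l - h l) <= e) -> Out f.
Proof.
move=> H; have cf : ccont f.
  by apply: ccont_lim => e /H[h [ch _] Hh]; exists h.
split=> // k; apply/eqP; rewrite -nrm_eq0 eq_le nrm_ge0 andbT; apply/ler_addgt0Pl => e e0.
have [h [ch oh] Hh] := H _ (divr_gt0 e0 (ltr0n R 2)).
rewrite addr0 -[X in nrm X]subr0 -(oh k).
have c1 := ccontM (ccontVX k.+1) cf; have c2 := ccontM (ccontVX k.+1) ch.
apply: le_trans (@mean_near _ _ (e / 2) c1 c2 _) _.
  move=> l cl; rewrite -mulrBr nrmM nrmX nrmV ((circle_nrm _).1 cl) invr1 expr1n mul1r.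
  exact: Hh.
by rewrite mulrC divfK.
Qed.

(** Inversion exchanges the two sides of the circle and preserves means, so the closure properties
    of [Out] transfer directly. *)
Definition In f : Prop := Out (fun l => f l^-1).

Lemma eq_In f g : (forall l, circle l -> f l = g l) -> In f -> In g.
Proof. by move=> fg; apply: eq_Out => l cl; apply: fg; exact: circleV. Qed.
Lemma In_ccont f : In f -> ccont f.
Proof. by move=> [/ccont_comp_inv + _]; apply: eq_ccont => l _; rewrite invrK. Qed.
Lemma InD f g : In f -> In g -> In (fun l => f l + g l).
Proof. exact: OutD. Qed.
Lemma InB f g : In f -> In g -> In (fun l => f l - g l).
Proof. exact: OutB. Qed.
Lemma InM f g : In f -> In g -> In (fun l => f l * g l).
Proof. exact: OutM. Qed.
Lemma InZ c f : In f -> In (fun l => c * f l).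
Proof. exact: OutZ. Qed.
Lemma mean_InM f g : In f -> In g -> mean (fun l => f l * g l) = mean f * mean g.
Proof.
move=> inf ing; have := mean_OutM inf ing.
have cfg := ccontM (In_ccont inf) (In_ccont ing).
by rewrite -(mean_inv cfg) -(mean_inv (In_ccont inf)) -(mean_inv (In_ccont ing)).
Qed.
Lemma In_lim f : (forall e : R, 0 < e -> exists2 h, In h &
  forall l, circle l -> nrm (f l - h l) <= e) -> In f.
Proof.
move=> H; apply: Out_lim => e /H[h ih Hh].
by exists (fun l => h l^-1) => // l cl; apply: Hh; exact: circleV.
Qed.
Lemma InE f : In f <-> ccont f /\ forall k, mean (fun l => l ^+ k.+1 * f l) = 0.
Proof.
have E k : ccont f -> mean (fun l => l^-1 ^+ k.+1 * f l^-1) = mean (fun l => l ^+ k.+1 * f l).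
  by move=> cf; have c := ccontM (ccont_pow k.+1) cf; rewrite -(mean_inv c).
split=> [inf|[cf H]].
  by have cf := In_ccont inf; split => // k; rewrite -E //; exact: inf.2.
by split; [exact: ccont_comp_inv|move=> k; rewrite E].
Qed.
End OutAlgebra.

(** * Goursat's lemma and the mean value property *)

Section Goursat.
Variable R : realType.
Local Notation C := (Cplx R).
Implicit Types (F : R -> R -> C).

(** The integral of [F (du + i dv)] counterclockwise along the boundary of the rectangle with corner
    [(x, y)] and sides [s] and [t], opposite sides being paired. *)
Definition bdint F (x y s t : R) : C :=
  ci * cint (fun v => F (x + s) v - F x v) y (y + t)
  - cint (fun u => F u (y + t) - F u y) x (x + s).

Lemma continuousB (f g : R -> C) : continuous f -> continuous g ->
  continuous (fun x => f x - g x).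
Proof. by move=> cf cg x; apply: cvgB; [exact: cf|exact: cg]. Qed.

Lemma continuous_diff1 F (a b : R) : (forall x, continuous (F x)) ->
  continuous (fun v => F a v - F b v).
Proof. by move=> c1; exact: (continuousB (c1 a) (c1 b)). Qed.

Lemma continuous_diff2 F (a b : R) : (forall y, continuous (F^~ y)) ->
  continuous (fun u => F u a - F u b).
Proof. by move=> c2; exact: (continuousB (c2 a) (c2 b)). Qed.

Lemma cstc (c : C) : continuous (fun _ : R => c).
Proof. by move=> ?; exact: cvg_cst. Qed.

Lemma bdint_splitx F x y s1 s2 t : (forall x, continuous (F x)) ->
  bdint F x y (s1 + s2) t = bdint F x y s1 t + bdint F (x + s1) y s2 t.
Proof.
move=> c1; rewrite /bdint !addrA -(cint_chasles _ x (x + s1) (x + s1 + s2)).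
have -> : cint (fun v => F (x + s1 + s2) v - F x v) y (y + t) =
   cint (fun v => F (x + s1 + s2) v - F (x + s1) v) y (y + t) +
   cint (fun v => F (x + s1) v - F x v) y (y + t).
  rewrite -(cintD _ _ (continuousB (c1 _) (c1 _)) (continuousB (c1 _) (c1 _))).
  by congr (cint _ _ _); apply/funext => v; rewrite subrKA.
ring.
Qed.

Lemma bdint_splity F x y s t1 t2 : (forall y, continuous (F^~ y)) ->
  bdint F x y s (t1 + t2) = bdint F x y s t1 + bdint F x (y + t1) s t2.
Proof.
move=> c2; rewrite /bdint !addrA -(cint_chasles _ y (y + t1) (y + t1 + t2)).
have -> : cint (fun u => F u (y + t1 + t2) - F u y) x (x + s) =
   cint (fun u => F u (y + t1 + t2) - F u (y + t1)) x (x + s) +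
   cint (fun u => F u (y + t1) - F u y) x (x + s).
  rewrite -(cintD _ _ (continuousB (c2 _) (c2 _)) (continuousB (c2 _) (c2 _))).
  by congr (cint _ _ _); apply/funext => v; rewrite subrKA.
ring.
Qed.

(** Complex differentiability at [x + i y], with the remainder measured by the sum of the two real
    increments. *)
Definition cdiff F (x y : R) : Prop := exists d : C, forall e : R, 0 < e ->
  exists2 r : R, 0 < r & forall u v : R, `|u - x| < r -> `|v - y| < r ->
    nrm (F u v - F x y - d * (rc (u - x) + ci * rc (v - y)))
      <= e * (`|u - x| + `|v - y|).

Section Bisection.
Variables (F : R -> R -> C) (x0 y0 s0 t0 : R).
Hypotheses (s00 : 0 <= s0) (t00 : 0 <= t0).
Hypotheses (c1 : forall x, continuous (F x)) (c2 : forall y, continuous (F^~ y)).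
Hypothesis dF : forall x y, x0 <= x <= x0 + s0 -> y0 <= y <= y0 + t0 -> cdiff F x y.

Let s k := s0 / 2 ^+ k.
Let t k := t0 / 2 ^+ k.
Let c := nrm (bdint F x0 y0 s0 t0).
Let bad k (p : R * R) := c / 4 ^+ k <= nrm (bdint F p.1 p.2 (s k) (t k)).

Let sS k : s k = s k.+1 + s k.+1.
Proof. by rewrite /s exprS; field; rewrite expf_neq0. Qed.
Let tS k : t k = t k.+1 + t k.+1.
Proof. by rewrite /t exprS; field; rewrite expf_neq0. Qed.
Let s_ge0 k : 0 <= s k. Proof. by rewrite divr_ge0 // exprn_ge0. Qed.
Let t_ge0 k : 0 <= t k. Proof. by rewrite divr_ge0 // exprn_ge0. Qed.

(** The integral over a rectangle is the sum over its four quarters, so one of them keeps at least a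
    quarter of the modulus. The condition on [p] sits under the existential so that [choice] yields
    a total function. *)
Lemma bad_step k p : exists q : R * R, bad k p -> [/\ bad k.+1 q,
   p.1 <= q.1, q.1 + s k.+1 <= p.1 + s k, p.2 <= q.2 & q.2 + t k.+1 <= p.2 + t k].
Proof.
case: p => x y; rewrite /bad /=.
have [|] := pselect (exists q : R * R, [/\ bad k.+1 q,
   x <= q.1, q.1 + s k.+1 <= x + s k, y <= q.2 & q.2 + t k.+1 <= y + t k]).
  by move=> [q Hq]; exists q.
move=> nq; exists (0, 0) => Hk; exfalso; apply: nq; apply: contrapT => nq.
have N q : (q = (x, y) \/ q = (x + s k.+1, y) \/ q = (x, y + t k.+1) \/
    q = (x + s k.+1, y + t k.+1)) -> nrm (bdint F q.1 q.2 (s k.+1) (t k.+1)) < c / 4 ^+ k.+1.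
  move=> Hq; rewrite ltNge; apply/negP => H; apply: nq; exists q.
  have := s_ge0 k.+1; have := t_ge0 k.+1; have := sS k; have := tS k.
  split => //; move: Hq => [->|[->|[->|->]]] /=; lra.
move: Hk; rewrite leNgt => /negP; apply.
rewrite sS tS (bdint_splitx _ _ _ _ _ c1) !(bdint_splity _ _ _ _ _ c2).
have -> : c / 4 ^+ k = c / 4 ^+ k.+1 + c / 4 ^+ k.+1 + (c / 4 ^+ k.+1 + c / 4 ^+ k.+1).
  by rewrite exprS; field; rewrite expf_neq0.
have n1 := N _ (or_introl erefl).
have n2 := N _ (or_intror (or_introl erefl)).
have n3 := N _ (or_intror (or_intror (or_introl erefl))).
have n4 := N _ (or_intror (or_intror (or_intror erefl))).
apply: le_lt_trans (nrmD _ _) _; apply: ltrD; apply: le_lt_trans (nrmD _ _) _.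
- by apply: ltrD; [exact: n1|exact: n3].
- by apply: ltrD; [exact: n2|exact: n4].
Qed.

Lemma bad_seq : exists p : nat -> R * R, forall k, [/\ bad k (p k),
  x0 <= (p k).1, (p k).1 + s k <= x0 + s0, y0 <= (p k).2 & (p k).2 + t k <= y0 + t0] /\
  [/\ (p k).1 <= (p k.+1).1, (p k.+1).1 + s k.+1 <= (p k).1 + s k,
   (p k).2 <= (p k.+1).2 & (p k.+1).2 + t k.+1 <= (p k).2 + t k].
Proof.
have [f Hf] := choice (fun kp : nat * (R * R) => bad_step kp.1 kp.2).
pose p := fix p (k : nat) : R * R := if k is k'.+1 then f (k', p k') else (x0, y0).
have B k : bad k (p k).
  elim: k => [|k IH].
    by rewrite /bad /= /s /t !expr0 !divr1.
  by have [] := Hf (k, p k) IH.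
have St k := Hf (k, p k) (B k).
exists p => k; split; last by have [] := St k; split.
elim: k => [|k [_ IH1 IH2 IH3 IH4]].
  by split => //=; rewrite /s /t expr0 divr1.
have [b q1 q2 q3 q4] := St k; split => //.
- exact: le_trans q1.
- exact: le_trans IH2.
- exact: le_trans q3.
- exact: le_trans IH4.
Qed.

Lemma nested_point (a b : nat -> R) : (forall k, a k <= a k.+1) ->
  (forall k, b k.+1 <= b k) -> (forall k, a k <= b k) ->
  exists X, forall k, a k <= X <= b k.
Proof.
move=> ma mb ab.
have Ma (i j : nat) : (i <= j)%N -> a i <= a j.
  by move=> /subnK <-; elim: (j - i)%N => // n IH; rewrite addSn (le_trans IH).
have Mb (i j : nat) : (i <= j)%N -> b j <= b i.
  by move=> /subnK <-; elim: (j - i)%N => // n IH; rewrite addSn (le_trans _ IH).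
have AB i j : a i <= b j.
  have [ij|ji] := leqP i j; first exact: le_trans (Ma _ _ ij) (ab j).
  exact: le_trans (ab i) (Mb _ _ (ltnW ji)).
exists (sup (range a)) => k; apply/andP; split.
- apply: sup_upper_bound; last by exists k.
  by split; [exists (a 0%N); exists 0%N|exists (b 0%N) => _ [i _ <-]].
- by apply: ge_sup; [exists (a 0%N); exists 0%N|move=> _ [i _ <-]].
Qed.

(** At the point common to the bisected rectangles, [F] is affine up to a remainder small relative
    to the sides. The affine part integrates to 0, so the integral over a small enough rectangle
    cannot keep its share [c / 4 ^ k]. *)
Lemma goursat : bdint F x0 y0 s0 t0 = 0.
Proof.
apply/eqP; rewrite -nrm_eq0 eq_le nrm_ge0 andbT leNgt; apply/negP => c0.
have [p Hp] := bad_seq.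
have [X HX] : exists X, forall k, (p k).1 <= X <= (p k).1 + s k.
  apply: nested_point => k; try by have [_ []] := Hp k.
  by rewrite lerDl.
have [Y HY] : exists Y, forall k, (p k).2 <= Y <= (p k).2 + t k.
  apply: nested_point => k; try by have [_ []] := Hp k.
  by rewrite lerDl.
have [d Hd] : cdiff F X Y.
  have [[_ _ ? _ ?] _] := Hp 0%N; have := HX 0%N; have := HY 0%N.
  have [[_ ? _ ? _] _] := Hp 0%N.
  by move=> /andP[? ?] /andP[? ?]; apply: dF; lra.
pose A := (s0 + t0) ^+ 2.
have A0 : 0 <= A by exact: sqr_ge0.
(* With [e] this constant, the remainder contributes at most [4 e A / 4 ^ k], which is below
   [c / 4 ^ k]; adding 1 to [A] also covers [A = 0]. *)
have e0 : 0 < c / (8 * (A + 1)) by rewrite divr_gt0 // mulr_gt0 // ltr_wpDl.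
have [r r0 Hr] := Hd _ e0.
set e := c / _ in e0 Hr.
have [k [sk tk]] : exists k, s k < r /\ t k < r.
  have : (fun n => 2^-1 ^+ n) @ \oo --> (0 : R).
    by apply: cvg_expr; rewrite ger0_norm ?invr_ge0 // invf_lt1 // ltr1n.
  have q0 : 0 < r / (s0 + t0 + 1) by rewrite divr_gt0 // ltr_wpDl // addr_ge0.
  move=> /cvgrPdist_lt/(_ _ q0)[k _ /(_ k (leqnn k))] /=.
  rewrite sub0r normrN ger0_norm ?exprn_ge0 ?invr_ge0 // exprVn.
  rewrite ltr_pdivlMr; last by rewrite ltr_wpDl // addr_ge0.
  have P : 0 <= (2 ^+ k)^-1 :> R by rewrite invr_ge0 exprn_ge0.
  move=> H; exists k; split; apply: le_lt_trans H.
    apply: (@le_trans _ _ (2 ^- k * s0)); first by rewrite mulrC.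
    by rewrite ler_wpM2l // -addrA lerDl addr_ge0 // addr_ge0.
  apply: (@le_trans _ _ (2 ^- k * t0)); first by rewrite mulrC.
  by rewrite ler_wpM2l // addrAC addrC lerDl addr_ge0.
have [[bk x1 x2 y1 y2] _] := Hp k.
have := HX k; have := HY k; move: bk x1 x2 y1 y2; rewrite /bad.
have sk0 := s_ge0 k; have tk0 := t_ge0 k.
move: (p k).1 (p k).2 => x y bk x1 x2 y1 y2 /andP[yY Yy] /andP[xX Xx].
pose G u v := F u v - F X Y - d * (rc (u - X) + ci * rc (v - Y)).
have GB u v : x <= u <= x + s k -> y <= v <= y + t k -> nrm (G u v) <= e * (s k + t k).
  move=> /andP[u1 u2] /andP[v1 v2].
  have uX : `|u - X| <= s k by rewrite ler_norml; lra.
  have vY : `|v - Y| <= t k by rewrite ler_norml; lra.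
  apply: le_trans (Hr u v _ _) _; [exact: le_lt_trans sk|exact: le_lt_trans tk|].
  by rewrite ler_wpM2l ?lerD // ltW.
have cu : continuous (fun u => F u (y + t k) - F u y).
  exact: (@continuous_diff2 F (y + t k) y c2).
have cv : continuous (fun v => F (x + s k) v - F x v).
  exact: (@continuous_diff1 F (x + s k) x c1).
(* The affine part of [F] contributes [d s t] here and [i d s t] to [Wu]; the two cancel in
   [bdint]. *)
have Wv : cint (fun v => F (x + s k) v - F x v) y (y + t k) =
    cint (fun v => G (x + s k) v - G x v) y (y + t k) + d * rc (s k) * rc (t k).
  have -> : d * rc (s k) * rc (t k) = cint (fun=> d * rc (s k)) y (y + t k).
    by rewrite cint_cst addrAC subrr add0r.
  rewrite -cintD.
  - by congr (cint _ _ _); apply/funext => v; rewrite /G !rcD !rcN; ring.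
  - have -> : (fun v => G (x + s k) v - G x v) =
      (fun v => (F (x + s k) v - F x v) - d * rc (s k)).
      by apply/funext => v; rewrite /G !rcD !rcN; ring.
    exact: (continuousB cv (@cstc _)).
  - by move=> ?; exact: cvg_cst.
have Wu : cint (fun u => F u (y + t k) - F u y) x (x + s k) =
    cint (fun u => G u (y + t k) - G u y) x (x + s k) + d * ci * rc (t k) * rc (s k).
  have -> : d * ci * rc (t k) * rc (s k) = cint (fun=> d * ci * rc (t k)) x (x + s k).
    by rewrite cint_cst addrAC subrr add0r.
  rewrite -cintD.
  - congr (cint _ _ _); apply/funext => v; rewrite /G !rcD !rcN; ring.
  - have -> : (fun u => G u (y + t k) - G u y) =
      (fun u => (F u (y + t k) - F u y) - d * ci * rc (t k)).
      by apply/funext => v; rewrite /G !rcD !rcN; ring.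
    exact: (continuousB cu (@cstc _)).
  - by move=> ?; exact: cvg_cst.
have gv : continuous (fun v => G (x + s k) v - G x v).
  have -> : (fun v => G (x + s k) v - G x v) = (fun v => (F (x + s k) v - F x v) - d * rc (s k)).
    by apply/funext => v; rewrite /G !rcD !rcN; ring.
  exact: (continuousB cv (@cstc _)).
have gu : continuous (fun u => G u (y + t k) - G u y).
  have -> : (fun u => G u (y + t k) - G u y) = (fun u => (F u (y + t k) - F u y) - d * ci * rc (t k)).
    by apply/funext => v; rewrite /G !rcD !rcN; ring.
  exact: (continuousB cu (@cstc _)).
move: bk; rewrite /bdint Wv Wu.
set I1 := cint _ _ _; set I2 := cint _ _ _.
have -> : ci * (I1 + d * rc (s k) * rc (t k)) - (I2 + d * ci * rc (t k) * rc (s k)) = ci * I1 - I2.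
  ring.
have B1 : nrm I1 <= 2 * (2 * (e * (s k + t k))) * t k.
  have := @cint_le R (fun v => G (x + s k) v - G x v) (2 * (e * (s k + t k))) y (y + t k) gv.
  rewrite [y + t k - y]addrAC subrr add0r; apply; first by rewrite lerDl.
  move=> v vv; apply: le_trans (nrmD _ _) _; rewrite nrmN mulr2n mulrDl mul1r lerD // GB //; lra.
have B2 : nrm I2 <= 2 * (2 * (e * (s k + t k))) * s k.
  have := @cint_le R (fun u => G u (y + t k) - G u y) (2 * (e * (s k + t k))) x (x + s k) gu.
  rewrite [x + s k - x]addrAC subrr add0r; apply; first by rewrite lerDl.
  move=> v vv; apply: le_trans (nrmD _ _) _; rewrite nrmN mulr2n mulrDl mul1r lerD // GB //; lra.
apply/negP; rewrite -ltNge; apply: le_lt_trans (nrmD _ _) _.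
rewrite nrmN nrmM nrm_ci mul1r; apply: le_lt_trans (lerD B1 B2) _.
have -> : 2 * (2 * (e * (s k + t k))) * t k + 2 * (2 * (e * (s k + t k))) * s k = 4 * e * A / 4 ^+ k.
  have e4 : 4 ^+ k = 2 ^+ k * 2 ^+ k :> R by rewrite -exprMn; congr (_ ^+ _); ring.
  by rewrite /A /s /t e4; field; rewrite expf_neq0.
rewrite ltr_pM2r ?invr_gt0 ?exprn_gt0 //.
rewrite /e; have A1 : 0 < A + 1 by rewrite ltr_wpDl.
have -> : 4 * (c / (8 * (A + 1))) * A = c * (A / (2 * (A + 1))) by field; rewrite gt_eqF.
rewrite gtr_pMr // ltr_pdivrMr ?mulr_gt0 // mul1r; lra.
Qed.
End Bisection.
End Goursat.

Section MeanValue.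
Variable R : realType.
Local Notation C := (Cplx R).

Lemma within_disc (f : C -> C) (z : C) (e : R) :
  {within [set l : C | `|l| <= 1], continuous f} -> nrm z <= 1 -> 0 < e ->
  exists2 r : R, 0 < r & forall w, nrm w <= 1 -> nrm (z - w) < r -> nrm (f z - f w) < e.
Proof.
move=> cf z1 e0.
have zD : [set l : C | `|l| <= 1] z by rewrite /= normE -rc1 rc_le.
have /subspace_continuousP/(_ z zD)/cvg_nrmP/(_ _ e0) := cf.
rewrite /within /= => /nbhs_ballP[r /= /gt0_rc[-> r0] Hr].
exists (re r) => // w w1 zw; apply: Hr.
- by rewrite /ball_ /= normE rc_lt.
- by rewrite /= normE -rc1 rc_le.
Qed.

Lemma der_eps (h : C -> C) z : derivable h z 1 -> exists d : C, forall e : R, 0 < e ->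
  exists2 r : R, 0 < r & forall k, nrm k < r -> nrm (h (z + k) - h z - d * k) <= e * nrm k.
Proof.
move=> /cvg_ex[/= d Hd]; exists d => e e0.
move/cvg_nrmP : Hd => /(_ _ e0); rewrite /dnbhs /within /= => /nbhs_ballP[r /= /gt0_rc[-> r0] Hr].
exists (re r) => // k kr; have [->|k0] := eqVneq k 0.
  by rewrite addr0 subrr mulr0 subrr nrm0 mulr0.
have := Hr k; rewrite /ball_ /= sub0r normrN normE rc_lt => /(_ kr k0) /ltW.
rewrite /GRing.scale /= mulr1 [k + z]addrC => H.
have -> : h (z + k) - h z - d * k = - ((d - k^-1 * (h (z + k) - h z)) * k) by field.
by rewrite nrmN nrmM ler_wpM2r ?nrm_ge0.
Qed.

(* Only the punctured disc is needed: in the coordinate [log z] the circles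
   become vertical segments, and Goursat makes the mean over them constant. *)
Lemma mean_value (f : C -> C) :
  {within [set l : C | `|l| <= 1], continuous f} ->
  (forall l : C, `|l| < 1 -> derivable f l 1) -> mean f = f 0.
Proof.
move=> cf df.
(* Capping [x] at 0 sends the whole plane into the closed disc, so that [F] is continuous
   everywhere, as [goursat] asks; [x = 0] gives the unit circle. *)
pose p (x y : R) : C := cexp (rc (Num.min x 0) + ci * rc y).
have pE x y : p x y = rc (expR (Num.min x 0)) * cis y.
  rewrite /p cexpE !reimE; congr (rc (expR _) * cis _); ring.
have p1 x y : nrm (p x y) <= 1.
  by rewrite pE nrmM nrm_cis mulr1 nrm_rc ger0_norm ?expR_ge0 // -expR0 ler_expR ge_min lexx orbT.
pose F x y := f (p x y).
have pc (x y : R) : forall r : R, 0 < r -> \forall u \near x & v \near y, nrm (p x y - p u v) < r.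
  move=> r r0; have r2 : 0 < r / 2 by rewrite divr_gt0.
  have /cvgrPdist_lt/(_ _ r2) : (fun u : R => expR (Num.min u 0)) @ x --> expR (Num.min x 0).
    apply: continuous_comp; last exact: continuous_expR.
    by apply: continuous_min; [exact: cvg_id|exact: cvg_cst].
  have /cvg_nrmP/(_ _ r2) := @continuous_cis R y => Hy Hx.
  near=> u v.
  have -> : p x y - p u v = rc (expR (Num.min x 0) - expR (Num.min u 0)) * cis v +
      rc (expR (Num.min x 0)) * (cis y - cis v).
    by rewrite !pE rcD rcN; ring.
  apply: le_lt_trans (nrmD _ _) _; rewrite [r]splitr; apply: ltr_leD.
    by rewrite nrmM nrm_cis mulr1 nrm_rc; near: u.
  apply: (@le_trans _ _ (1 * nrm (cis y - cis v))).
    rewrite nrmM ler_wpM2r ?nrm_ge0 // nrm_rc ger0_norm ?expR_ge0 //.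
    by rewrite -expR0 ler_expR ge_min lexx orbT.
  by rewrite mul1r ltW //; near: v.
have Fc (x y : R) : forall r : R, 0 < r -> \forall u \near x & v \near y, nrm (F x y - F u v) < r.
  move=> r r0; have [r' r'0 Hr'] := within_disc cf (p1 x y) r0.
  have := pc x y r' r'0; apply: filterS => -[u v] /= H.
  by apply: Hr'.
have c1 x : continuous (F x).
  move=> y; apply/cvg_nrmP => r r0.
  by have [[A B] /= [HA HB] H] := Fc x y r r0; apply: filterS HB => v Bv; apply: (H (x, v)); split => //=; exact: nbhs_singleton HA.
have c2 y : continuous (F^~ y).
  move=> x; apply/cvg_nrmP => r r0.
  by have [[A B] /= [HA HB] H] := Fc x y r r0; apply: filterS HA => v Bv; apply: (H (v, y)); split => //=; exact: nbhs_singleton HB.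
have dF x y : x < 0 -> cdiff F x y.
  move=> x0; pose z : C := rc x + ci * rc y.
  have dh : derivable (fun w : C => f (cexp w)) z 1.
    apply/derivable1_diffP; apply: (@differentiable_comp _ _ _ _ (@cexp R) f).
      by apply/derivable1_diffP; have [] := is_derive_cexp z.
    apply/derivable1_diffP; apply: df; rewrite normE nrm_cexp /z !reimE mul0r mul1r subr0 addr0.
    by rewrite -rc1 rc_lt -expR0 ltr_expR.
  have [d Hd] := der_eps dh; exists d => e e0; have [r r0 Hr] := Hd e e0.
  exists (Num.min (r / 2) (- x)); first by rewrite lt_min divr_gt0 //= oppr_gt0.
  move=> u v; rewrite !lt_min => /andP[u1 u2] /andP[v1 v2].
  have u0 : u < 0 by move: u2; rewrite ltr_norml => /andP[]; lra.
  set k := rc (u - x) + ci * rc (v - y).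
  have kn : nrm k <= `|u - x| + `|v - y|.
    by apply: le_trans (nrmD _ _) _; rewrite nrmM nrm_ci mul1r !nrm_rc.
  have pu : F u v = f (cexp (z + k)).
    rewrite /F /p min_l ?(ltW u0) // /z /k !rcD !rcN; congr (f (cexp _)); ring.
  have px : F x y = f (cexp z) by rewrite /F /p min_l ?(ltW x0).
  rewrite pu px; apply: le_trans (Hr k _) _; last by rewrite ler_wpM2l // ltW.
  by apply: le_lt_trans kn _; rewrite [r]splitr ltrD.
pose I x := cint (F x) 0 (2 * pi).
have pi2 : 0 < 2 * pi :> R by exact: twopi_gt0.
(* The horizontal sides of the rectangle carry equal values by periodicity in the angle, so only the
   vertical integrals remain. *)
have Icst x1 x2 : x1 < x2 -> x2 < 0 -> I x1 = I x2.
  move=> x12 x20.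
  have := @goursat R F x1 0 (x2 - x1) (2 * pi) _ (ltW pi2) c1 c2 _.
  rewrite /bdint subrKC add0r => H.
  have {H} : ci * cint (fun v => F x2 v - F x1 v) 0 (2 * pi) -
      cint (fun u => F u (2 * pi) - F u 0) x1 x2 = 0.
    apply: H; first by rewrite subr_ge0 ltW.
    by move=> x y /andP[_ xx] _; apply: dF; lra.
  have -> : (fun u => F u (2 * pi) - F u 0) = (fun=> 0).
    by apply/funext => u; rewrite /F !pE cis2pi cis0 subrr.
  rewrite cint_cst mul0r subr0 (cintB _ _ (c1 _) (c1 _)) => /eqP.
  rewrite mulf_eq0 -nrm_eq0 nrm_ci oner_eq0 /= subr_eq0 => /eqP.
  by [].
have If : mean f = (rc (2 * pi))^-1 * I 0.
  rewrite /mean; congr (_ * cint _ _ _); apply/funext => y.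
  by rewrite /F pE minxx expR0 rc1 mul1r.
suff : forall e : R, 0 < e -> nrm (mean f - f 0) <= e.
  move=> H; apply/eqP; rewrite -subr_eq0 -nrm_eq0 eq_le nrm_ge0 andbT.
  by apply/ler_addgt0Pl => e e0; rewrite addr0; exact: H.
move=> e e0; have e4 : 0 < e / 4 by rewrite divr_gt0.
have bnd (g : R -> C) : continuous g -> (forall y, 0 <= y <= 2 * pi -> nrm (g y) <= e / 4) ->
    nrm ((rc (2 * pi))^-1 * cint g 0 (2 * pi)) <= e / 2.
  move=> cg Hg; rewrite nrmM nrmV nrm_rc gtr0_norm // mulrC ler_pdivrMr //.
  apply: le_trans (cint_le cg (ltW pi2) Hg) _; rewrite subr0 ler_wpM2r ?(ltW pi2) //; lra.
(* [x2] is so close to 0 that its circle nearly carries the values on the unit circle; [x1] is so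
   far to the left that its circle shrinks to the origin. *)
have [x2 x20 Hx2] : exists2 x2 : R, x2 < 0 & forall y, 0 <= y <= 2 * pi -> nrm (F x2 y - F 0 y) <= e / 4.
  have : \forall x \near (0 : R), forall y, 0 <= y <= 2 * pi -> nrm (F x y - F 0 y) <= e / 4.
    apply: (@seg_unif R _ (nbhs (0 : R)) _ (fun x y => nrm (F x y - F 0 y) <= e / 4)) => y _.
    have e8 : 0 < e / 8 by rewrite divr_gt0.
    have [[A B] /= [HA HB] H] := Fc 0 y (e / 8) e8.
    exists (B, A) => // -[v u] /= [Bv Au].
    have h1 := H (u, v) (conj Au Bv); have h2 := H (0, v) (conj (nbhs_singleton HA) Bv).
    rewrite /= in h1 h2.
    have -> : F u v - F 0 v = (F 0 y - F 0 v) - (F 0 y - F u v) by ring.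
    by apply: le_trans (nrmD _ _) _; rewrite nrmN; lra.
  move=> /nbhs_ballP[r /= r0 Hr]; exists (- (r / 2)); first by rewrite oppr_lt0 divr_gt0.
  apply: Hr; rewrite -ball_normE /= sub0r opprK ger0_norm ?divr_ge0 // ?ltW //; lra.
have [x1 x12 Hx1] : exists2 x1 : R, x1 < x2 & forall y, nrm (F x1 y - f 0) <= e / 4.
  have z1 : nrm (0 : C) <= 1 by rewrite nrm0.
  have [r r0 Hr] := within_disc cf z1 e4.
  pose m := Num.min (x2 - 1) (ln r - 1).
  have m0 : m < 0 by rewrite gt_min; apply/orP; left; lra.
  exists m; first by rewrite gt_min; apply/orP; left; lra.
  move=> y; rewrite nrmB ltW //; apply: Hr; first exact: p1.
  rewrite sub0r nrmN pE nrmM nrm_cis mulr1 nrm_rc ger0_norm ?expR_ge0 // min_l ?(ltW m0) //.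
  apply: (@le_lt_trans _ _ (expR (ln r - 1))); first by rewrite ler_expR ge_min lexx orbT.
  rewrite -[X in _ < X](lnK (x := r)) ?posrE // ltr_expR; lra.
have -> : mean f - f 0 = (rc (2 * pi))^-1 * cint (fun y => F x1 y - f 0) 0 (2 * pi) -
    (rc (2 * pi))^-1 * cint (fun y => F x2 y - F 0 y) 0 (2 * pi).
  have cc0 : continuous (fun _ : R => f 0) by move=> ?; exact: cvg_cst.
  rewrite (cintB _ _ (c1 x1) cc0) (cintB _ _ (c1 x2) (c1 0)) cint_cst subr0.
  rewrite If -/(I x1) -/(I x2) -/(I 0) (Icst _ _ x12 x20).
  by field; exact: rc2pi_neq0.
apply: le_trans (nrmD _ _) _; rewrite nrmN [e]splitr; apply: lerD; apply: bnd => //.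
- apply: continuousB; [exact: c1|by move=> ?; exact: cvg_cst].
- exact: (continuousB (c1 _) (c1 _)).
Unshelve. all: by end_near. Qed.

End MeanValue.

(** * Loops and their derivatives *)

Section Entries.
Variable R : realType.
Local Notation C := (Cplx R).
Local Notation M2 := 'M[C]_2.

Lemma mx_cvgP {T} {F : set_system T} {FF : Filter F} (f : T -> M2) (A : M2) :
  f @ F --> A <-> forall i j, (fun x => f x i j) @ F --> A i j.
Proof.
split=> [H i j|H].
  apply/cvg_nrmP => e e0.
  have /cvg_ballP/(_ (rc e)) := H; rewrite -[X in X < _]rc0 rc_lt => /(_ e0).
  apply: filterS => x; rewrite /ball /= => -[_ /(_ i j)].
  by rewrite /ball /= normE rc_lt.
apply/cvg_ballP => e /gt0_rc[-> e0].
have K (i j : 'I_2) : \forall x \near F, nrm (A i j - f x i j) < re e.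
  by have /cvg_nrmP/(_ _ e0) := H i j.
have K1 (i : 'I_2) : \forall x \near F, forall j : 'I_2, nrm (A i j - f x i j) < re e.
  exact: filter_forall.
have K2 : \forall x \near F, forall i j : 'I_2, nrm (A i j - f x i j) < re e.
  exact: filter_forall.
apply: filterS K2 => x Hx; split; first by rewrite -[X in X < _]rc0 rc_lt.
by move=> i j; rewrite /ball /= normE rc_lt.
Qed.

Lemma derivable_entry (f : C -> M2) (l : C) i j : derivable f l 1 ->
  derivable (fun z => f z i j) l 1.
Proof.
move=> /cvg_ex[/= d /mx_cvgP/(_ i j) Hd]; apply/cvg_ex; exists (d i j).
by move: Hd; under eq_fun do rewrite !mxE.
Qed.

Lemma within_entry (f : C -> M2) (D : set C) i j : {within D, continuous f} ->
  {within D, continuous (fun z => f z i j)}.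
Proof. by move=> cf z; have /mx_cvgP/(_ i j) := cf z. Qed.

Lemma within_pow (g : C -> C) (D : set C) n : {within D, continuous g} ->
  {within D, continuous (fun l => l ^+ n * g l)}.
Proof.
move=> cg; elim: n => [|n IH].
  by have -> : (fun l : C => l ^+ 0 * g l) = g by apply/funext => l; rewrite mul1r.
have -> : (fun l : C => l ^+ n.+1 * g l) = (fun l => l * (l ^+ n * g l)).
  by apply/funext => l; rewrite exprS mulrA.
move=> z; apply: cvgM; last exact: IH.
by apply: (@continuous_subspaceT _ _ _ (fun l : C => l)) => w; exact: cvg_id.
Qed.

(** The mean value property applied to [l ^ k.+1] times the extension, which vanishes at 0, kills
    the coefficients of negative powers; applied to the extension itself it gives the value at 0. *)
Lemma extends_in_In (f : C -> M2) A i j : extends_in f A ->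
  In (fun l => f l i j) /\ mean (fun l => f l i j) = A i j.
Proof.
move=> [Phi [Pf cP dP P0]].
pose g z := Phi z i j.
have cg : {within [set l : C | `|l| <= 1], continuous g} by exact: within_entry.
have dg (l : C) : `|l| < 1 -> derivable g l 1 by move=> /dP; exact: derivable_entry.
have gf l : circle l -> g l = f l i j by move=> /Pf; rewrite /g => ->.
have ccg : ccont g.
  split => x; apply/cvg_nrmP => e e0.
  have n1 : nrm (cis x : C) <= 1 by rewrite nrm_cis.
  have [r r0 Hr] := within_disc cg n1 e0.
  have /cvg_nrmP/(_ _ r0) := @continuous_cis R x; apply: filterS => y Hy.
  by apply: Hr => //; rewrite nrm_cis.
split; last first.
  rewrite -P0 -[RHS]/(g 0) -(mean_value cg dg).
  by apply: eq_mean => l /gf <-.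
apply: (eq_In gf); apply/InE; split => // k.
have cm : {within [set l : C | `|l| <= 1], continuous (fun l : C => l ^+ k.+1 * g l)}.
  exact: within_pow.
have dm (l : C) : `|l| < 1 -> derivable (fun l : C => l ^+ k.+1 * g l) l 1.
  move=> l1; apply: (@derivableM _ _ (fun l : C => l ^+ k.+1) g); last exact: dg.
  exact: exprn_derivable.
by rewrite (mean_value cm dm) exprS !mul0r.
Qed.

Lemma extends_out_Out (f : C -> M2) A i j : extends_out f A ->
  Out (fun l => f l i j) /\ mean (fun l => f l i j) = A i j.
Proof.
move=> /extends_in_In -/(_ i j)[inf <-].
have of_ : Out (fun l => f l i j).
  by move: inf; apply: eq_Out => l _; rewrite invrK.
by split => //; rewrite (mean_inv of_.1).
Qed.

Lemma eqf_cvg {T} {U : topologicalType} (F : set_system T) (f g : T -> U) (l : U) :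
  f =1 g -> f @ F --> l -> g @ F --> l.
Proof. by move=> /funext ->. Qed.

Lemma cder_of_cvg (F : R -> C) (x : R) (d : C) :
  (fun h : R => rc h^-1 * (F (x + h) - F x)) @ 0^' --> d -> cder F x d.
Proof.
move=> H; split.
- have K : (fun h : R => h^-1 *: (re (F (h *: (1 : R^o) + x)) - re (F x))) @ 0^' --> re d.
    apply: eqf_cvg (re_cvg H) => h.
    by rewrite !reimE mul0r subr0 /GRing.scale /= mulr1 [h + x]addrC.
  by apply: DeriveDef; [apply/cvg_ex; eexists; exact: K|exact: cvg_lim K].
- have K : (fun h : R => h^-1 *: (im (F (h *: (1 : R^o) + x)) - im (F x))) @ 0^' --> im d.
    apply: eqf_cvg (im_cvg H) => h.
    by rewrite !reimE mul0r addr0 /GRing.scale /= mulr1 [h + x]addrC.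
  by apply: DeriveDef; [apply/cvg_ex; eexists; exact: K|exact: cvg_lim K].
Qed.

Lemma rder_cvg (f : R -> R) (x a : R) : is_derive x 1 f a ->
  (fun h : R => h^-1 * (f (x + h) - f x)) @ 0^' --> a.
Proof.
move=> [df <-]; have := df; rewrite /derivable => K.
rewrite /derive; apply: cvg_trans K; apply: near_eq_cvg; near=> h.
by rewrite /GRing.scale /= mulr1 [h + x]addrC.
Unshelve. all: by end_near. Qed.

Lemma cder_cvg (F : R -> C) (x : R) (d : C) : cder F x d ->
  (fun h : R => rc h^-1 * (F (x + h) - F x)) @ 0^' --> d.
Proof.
move=> [/rder_cvg F1 /rder_cvg F2]; apply: reim_cvg.
- by apply: eqf_cvg F1 => h; rewrite !reimE mul0r subr0.
- by apply: eqf_cvg F2 => h; rewrite !reimE mul0r addr0.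
Qed.

(** Chain rule along [lambda = cis x], where [d lambda = i lambda dx]: the quotient in the angle is
    that of [cis] times the quotient along the circle. *)
Lemma circle_quot_cder (f : C -> M2) (d : M2) (x : R) i j :
  circle_quot f (cis x) m @[m --> within circle (cis x)^'] --> d ->
  cder (fun y => f (cis y) i j) x (ci * cis x * d i j).
Proof.
move=> /mx_cvgP/(_ i j) Hd; apply: cder_of_cvg.
(* The quotient along the circle is meaningless when the rotated point equals [cis x]; the value
   [d i j] keeps [q] convergent and is then multiplied by 0. *)
pose q h := if cis (x + h) == cis x then d i j else circle_quot f (cis x) (cis (x + h)) i j.
have qd : q @ (0 : R)^' --> d i j.
  apply/cvg_nrmP => e e0; have /cvg_nrmP/(_ _ e0) := Hd.
  rewrite /within /dnbhs /within /= => /nbhs_ballP[r /= /gt0_rc[-> r0] Hr].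
  have cc : (fun h => cis (x + h)) @ (0 : R) --> (cis x : C).
    have : (fun h : R => x + h) @ (0 : R) --> x + 0 by apply: cvgD; [exact: cvg_cst|exact: cvg_id].
    rewrite addr0 => /cvg_comp; apply; exact: continuous_cis.
  have /cvg_nrmP/(_ _ r0) := cc; apply: filterS => h Hh _; rewrite /q.
  have [_|ne] := eqVneq; first by rewrite subrr nrm0.
  by apply: Hr => //; [rewrite /ball_ /= normE rc_lt|exact: circle_cis].
apply: eqf_cvg (cvgM (cder_cvg (cder_cis x)) qd) => h /=.
rewrite /q; have [->|ne] := eqVneq; first by rewrite !subrr !mulr0 mul0r.
by rewrite /circle_quot !mxE -!mulrA; congr (_ * _); rewrite mulVKf // subr_eq0.
Qed.

Lemma smooth_cder (f : C -> M2) (x : R) i j : smooth_loop f ->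
  cder (fun y => f (cis y) i j) x (ci * cis x * circle_deriv f (cis x) i j).
Proof.
move=> sf; apply: circle_quot_cder; have := sf 0%N _ (circle_cis x).
by [].
Qed.

Lemma smooth_deriv_ccont (f : C -> M2) i j : smooth_loop f ->
  ccont (fun l => circle_deriv f l i j).
Proof.
move=> sf; split => x.
have H : circle_quot (circle_deriv f) (cis x) m @[m --> within circle (cis x)^']
  --> circle_deriv (circle_deriv f) (cis x) by exact: (sf 1%N _ (circle_cis x)).
exact: cder_continuous (circle_quot_cder i j H).
Qed.

(** Integration by parts: [lambda d/dlambda] multiplies each Fourier coefficient by its exponent.
    Vanishing coefficients stay 0, and the mean is annihilated. *)
Lemma deriv_Out (f : C -> M2) i j : smooth_loop f -> Out (fun l => f l i j) ->
  Out (fun l => l * circle_deriv f l i j) /\ mean (fun l => l * circle_deriv f l i j) = 0.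
Proof.
move=> sf of_; have cf := smooth_deriv_ccont i j sf.
have cl : ccont (fun l => l * circle_deriv f l i j) by cc.
have ci0 : (ci : C) != 0 by rewrite -nrm_eq0 nrm_ci oner_eq0.
have E k : mean (fun l => l^-1 ^+ k * (l * circle_deriv f l i j)) =
    k%:R * mean (fun l => l^-1 ^+ k * f l i j).
  have cof := of_.1.
  have c1 : ccont (fun l => l^-1 ^+ k * (l * circle_deriv f l i j)) by cc.
  have c2 : ccont (fun l => l^-1 ^+ k * f l i j) by cc.
  have c3 : ccont (fun l => ci * (l^-1 ^+ k * (l * circle_deriv f l i j))) by cc.
  have c4 : ccont (fun l => ci * k%:R * (l^-1 ^+ k * f l i j)) by cc.
  apply: (@mulfI C ci ci0); rewrite [RHS]mulrA -(meanZ ci c1) -(meanZ _ c2).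
  apply/eqP; rewrite -subr_eq0 -(meanB c3 c4).
  apply/eqP; apply: (@mean_der _ (fun l => l^-1 ^+ k * f l i j)); last by cc.
  move=> x; have d2 : cder (fun y => (cis y)^-1) x (- (ci * (cis x)^-1)).
    under eq_fun do rewrite -cisN.
    have := @cder_comp R (@cis R) -%R x _ (-1) (cder_cis (- x)) (is_deriveNid _ _).
    by rewrite rcN rc1 mulrN1 cisN.
  apply: (cder_eq (cderM (cderX k d2) (smooth_cder x i j sf))).
  by case: k {c1 c2 c3 c4} => [|k] /=; rewrite ?exprS ?expr0; ring.
split; last by have := E 0%N; rewrite mul0r => <-; apply: eq_mean => l _; rewrite mul1r.
by split => // k; rewrite E of_.2 mulr0.
Qed.

Lemma deriv_In (f : C -> M2) i j : smooth_loop f -> In (fun l => f l i j) ->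
  In (fun l => l * circle_deriv f l i j) /\ mean (fun l => l * circle_deriv f l i j) = 0.
Proof.
move=> sf inf; have cf := smooth_deriv_ccont i j sf.
have cl : ccont (fun l => l * circle_deriv f l i j) by cc.
have ci0 : (ci : C) != 0 by rewrite -nrm_eq0 nrm_ci oner_eq0.
have cof := In_ccont inf.
have E k : mean (fun l => l ^+ k * (l * circle_deriv f l i j)) =
    - k%:R * mean (fun l => l ^+ k * f l i j).
  have c1 : ccont (fun l => l ^+ k * (l * circle_deriv f l i j)) by cc.
  have c2 : ccont (fun l => l ^+ k * f l i j) by cc.
  have c3 : ccont (fun l => ci * (l ^+ k * (l * circle_deriv f l i j))) by cc.
  have c4 : ccont (fun l => ci * - k%:R * (l ^+ k * f l i j)) by cc.
  apply: (@mulfI C ci ci0); rewrite [RHS]mulrA -(meanZ ci c1) -(meanZ _ c2).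
  apply/eqP; rewrite -subr_eq0 -(meanB c3 c4).
  apply/eqP; apply: (@mean_der _ (fun l => l ^+ k * f l i j)); last by cc.
  move=> x; apply: (cder_eq (cderM (cderX k (cder_cis x)) (smooth_cder x i j sf))).
  by case: k {c1 c2 c3 c4} => [|k] /=; rewrite ?exprS ?expr0; ring.
split; last by have := E 0%N; rewrite oppr0 mul0r => <-; apply: eq_mean => l _; rewrite mul1r.
by apply/InE; split => // k; rewrite E ((InE _).1 inf).2 mulr0.
Qed.

End Entries.

(** * Derivatives in the times, uniform on the circle *)

Section TimeDerivatives.
Variable R : realType.
Local Notation C := (Cplx R).
Local Notation M2 := 'M[C]_2.
Implicit Types (f g : times R -> C -> C) (y z : C -> C) (t : times R).

#[local] Instance dnbhs0_proper : ProperFilter (nbhs (0 : C)^').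
Proof. exact: Proper_dnbhs_numFieldType. Qed.

Lemma set_timeK t n : set_time t n (t n) = t.
Proof. by apply/funext => m; rewrite /set_time; case: eqP => // ->. Qed.

(* The scalar counterpart of [is_loop_pd]. *)
Definition uld f n t y : Prop := forall e : R, 0 < e ->
  \forall h \near (0 : C)^', forall l, circle l ->
    nrm (h^-1 * (f (set_time t n (t n + h)) l - f t l) - y l) <= e.

Lemma is_loop_pd_uld n (Psi : times R -> C -> M2) t Y i j : is_loop_pd n Psi t Y ->
  uld (fun s l => Psi s l i j) n t (fun l => Y l i j).
Proof.
move=> H e e0; pose P := [set F : C -> M2 | forall l, circle l -> nrm (F l i j - Y l i j) <= e].
have : nbhs (Y : {uniform` circle -> M2}) P.
  apply/uniform_nbhs; exists [set p : M2 * M2 | ball p.1 (rc e) p.2]; split.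
    by rewrite -entourage_ballE; exists (rc e) => //=; rewrite -rc0 rc_lt.
  move=> F /= HF l cl; have := HF l cl; rewrite /= => -[_ /(_ i j)].
  by rewrite /ball /= normE rc_lt nrmB => /ltW.
move=> PP; have HH : \forall h \near (0 : C)^', P (fun l => h^-1 *: (Psi (set_time t n (t n + h)) l - Psi t l)).
  exact: H _ PP.
apply: (@filterS _ (nbhs (0 : C)^') _ _ _ _ HH) => h Hh l cl.
by have := Hh l cl; rewrite /= !mxE.
Qed.

Lemma dnbhs_open n t (D : set (times R)) : open_in_times D -> D t ->
  \forall h \near (0 : C)^', D (set_time t n (t n + h)).
Proof.
move=> oD Dt; have H := oD t n Dt.
move: H => /nbhs_ballP[r /= /gt0_rc[-> r0] Hr].
apply: filterS (dnbhs_nrm r0) => h [_ hr].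
have Hb : ball_ (fun z : C => `|z|) (t n) (rc (re r)) (t n + h); last exact: (Hr _ Hb).
by rewrite /ball_ /= opprD addrA subrr sub0r normrN normE rc_lt.
Qed.

(** A time derivative is a uniform limit of difference quotients between two admissible times, so a
    class closed under linear combinations and uniform limits contains it. *)
Lemma uld_near f n t y (P : (C -> C) -> Prop) (D : set (times R)) :
  open_in_times D -> D t -> (forall s, D s -> P (f s)) -> uld f n t y ->
  forall e : R, 0 < e -> exists h : C, [/\ P (f t), P (f (set_time t n (t n + h))) &
   forall l, circle l -> nrm (y l - h^-1 * (f (set_time t n (t n + h)) l - f t l)) <= e].
Proof.
move=> oD Dt HP H e e0.
have [h [Hh Dh]] := @filter_ex _ _ _ _ (@filterI _ _ _ _ _ (H e e0) (dnbhs_open n oD Dt)).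
exists h; split; [exact: HP|exact: HP|move=> l cl; rewrite nrmB; exact: Hh].
Qed.

Lemma uld_ccont f n t y (D : set (times R)) : open_in_times D -> D t ->
  (forall s, D s -> ccont (f s)) -> uld f n t y -> ccont y.
Proof.
move=> oD Dt HP H; apply: ccont_lim => e e0.
have [h [c1 c2 Hh]] := uld_near oD Dt HP H e0.
by eexists; last exact: Hh; cc.
Qed.

Lemma uld_Out f n t y (D : set (times R)) : open_in_times D -> D t ->
  (forall s, D s -> Out (f s)) -> uld f n t y -> Out y.
Proof.
move=> oD Dt HP H; apply: Out_lim => e e0.
have [h [c1 c2 Hh]] := uld_near oD Dt HP H e0.
by eexists; last exact: Hh; apply: OutZ; exact: OutB.
Qed.

Lemma uld_In f n t y (D : set (times R)) : open_in_times D -> D t ->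
  (forall s, D s -> In (f s)) -> uld f n t y -> In y.
Proof.
move=> oD Dt HP H; apply: In_lim => e e0.
have [h [c1 c2 Hh]] := uld_near oD Dt HP H e0.
by eexists; last exact: Hh; apply: InZ; exact: InB.
Qed.

Lemma is_pd_cvg n (G : times R -> C) t (d : C) :
  (fun h => h^-1 * (G (set_time t n (t n + h)) - G t)) @ (0 : C)^' --> d <-> is_pd n G t d.
Proof.
have E : (fun h : C => h^-1 * (G (set_time t n (t n + h)) - G t)) =
  (fun h : C => h^-1 *: (G (set_time t n (h *: (1 : C^o) + t n)) - G (set_time t n (t n)))).
  by apply/funext => h; rewrite set_timeK /GRing.scale /= mulr1 [h + t n]addrC.
rewrite E; split=> [H|[H <-]].
  by apply: DeriveDef; [apply/cvg_ex; eexists; exact: H|exact: cvg_lim H].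
exact: H.
Qed.

(** Uniform convergence on the circle permits differentiation under the mean. *)
Lemma uld_coef f n t y k (D : set (times R)) : open_in_times D -> D t ->
  (forall s, D s -> ccont (f s)) -> uld f n t y ->
  is_pd n (fun s => coef (f s) k) t (coef y k).
Proof.
move=> oD Dt HP H; have cy := uld_ccont oD Dt HP H.
apply/is_pd_cvg/cvg_nrmP => e e0; have e4 : 0 < e / 4 by rewrite divr_gt0.
apply: filterS2 (H _ e4) (dnbhs_open n oD Dt) => h Hh Dh.
have c1 := HP _ Dt; have c2 := HP _ Dh; rewrite /coef.
set f1 := f (set_time _ _ _) in c2 Hh *.
have c3 : ccont (fun l => l ^+ k * y l) by cc.
have c4 : ccont (fun l => l ^+ k * f1 l) by cc.
have c5 : ccont (fun l => l ^+ k * f t l) by cc.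
have c6 : ccont (fun l => l ^+ k * f1 l - l ^+ k * f t l) by cc.
rewrite -(meanB c4 c5) -(meanZ _ c6).
apply: le_lt_trans (mean_near (e := e / 4) c3 _ _) _.
- by cc.
- move=> l cl; have -> : l ^+ k * y l - h^-1 * (l ^+ k * f1 l - l ^+ k * f t l) =
    - (l ^+ k * (h^-1 * (f1 l - f t l) - y l)) by ring.
  by rewrite nrmN nrmM nrmX ((circle_nrm _).1 cl) expr1n mul1r Hh.
- lra.
Qed.

Lemma uldM f g n t y z (D : set (times R)) : open_in_times D -> D t ->
  (forall s, D s -> ccont (f s)) -> (forall s, D s -> ccont (g s)) ->
  uld f n t y -> uld g n t z ->
  uld (fun s l => f s l * g s l) n t (fun l => y l * g t l + f t l * z l).
Proof.
move=> oD Dt cf cg Hf Hg e e0.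
have cy := uld_ccont oD Dt cf Hf; have cz := uld_ccont oD Dt cg Hg.
have [Mf Mf0 Bf] := ccont_bound (cf _ Dt); have [Mg Mg0 Bg] := ccont_bound (cg _ Dt).
have [My My0 By] := ccont_bound cy; have [Mz Mz0 Bz] := ccont_bound cz.
(* [K] collects the coefficients of [d] in the three error terms of the product rule; [Mz + 1]
   bounds the difference quotient of [g] because [d <= 1]. *)
pose K := Mg + (Mz + 1) + My * (Mz + 1) + Mf.
have K0 : 0 < K by rewrite !addr_gt0 // mulr_gt0 // addr_gt0.
pose d := Num.min 1 (e / K).
have d0 : 0 < d by rewrite lt_min ltr01 divr_gt0.
have d1 : d <= 1 by rewrite ge_min lexx.
have dK : d * K <= e by rewrite -ler_pdivlMr // ge_min lexx orbT.
apply: filterS3 (Hf _ d0) (Hg _ d0) (dnbhs_nrm (R := R) d0) => h Hfh Hgh [h0 hd] l cl.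
have A1 := Hfh l cl; have A2 := Hgh l cl.
set f1 := f (set_time _ _ _) l in A1 *; set g1 := g (set_time _ _ _) l in A2 *.
have G : nrm (g1 - g t l) <= d * (Mz + 1).
  have -> : g1 - g t l = h * ((h^-1 * (g1 - g t l) - z l) + z l) by field.
  rewrite nrmM; apply: ler_pM; rewrite ?nrm_ge0 ?(ltW hd) //.
  by apply: le_trans (nrmD _ _) _; have := Bz l cl; lra.
have G1 : nrm g1 <= Mg + (Mz + 1).
  have := nrmD (g1 - g t l) (g t l); rewrite subrK => ?; have := Bg l cl.
  have : d * (Mz + 1) <= Mz + 1 by rewrite ler_piMl // ltW // addr_gt0.
  lra.
have -> : h^-1 * (f1 * g1 - f t l * g t l) - (y l * g t l + f t l * z l) =
   (h^-1 * (f1 - f t l) - y l) * g1 + y l * (g1 - g t l) + f t l * (h^-1 * (g1 - g t l) - z l).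
  ring.
apply: le_trans dK; apply: le_trans (nrmD _ _) _; rewrite nrmM.
have B3 : nrm (f t l) * nrm (h^-1 * (g1 - g t l) - z l) <= Mf * d.
  by apply: ler_pM; rewrite ?nrm_ge0 // Bf.
have B2 : nrm (y l * (g1 - g t l)) <= My * (d * (Mz + 1)).
  by rewrite nrmM; apply: ler_pM; rewrite ?nrm_ge0 // By.
have B1 : nrm ((h^-1 * (f1 - f t l) - y l) * g1) <= d * (Mg + (Mz + 1)).
  by rewrite nrmM; apply: ler_pM; rewrite ?nrm_ge0.
have := nrmD ((h^-1 * (f1 - f t l) - y l) * g1) (y l * (g1 - g t l)).
have -> : d * K = d * (Mg + (Mz + 1)) + My * (d * (Mz + 1)) + Mf * d by rewrite /K; ring.
lra.
Qed.

Lemma uld_lin (c : C) f g n t y z : uld f n t y -> uld g n t z -> nrm c <= 1 ->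
  uld (fun s l => f s l + c * g s l) n t (fun l => y l + c * z l).
Proof.
move=> Hf Hg c1 e e0; have e2 : 0 < e / 2 by rewrite divr_gt0.
apply: filterS2 (Hf _ e2) (Hg _ e2) => h H1 H2 l cl.
set f1 := f (set_time _ _ _) l; set g1 := g (set_time _ _ _) l.
have -> : h^-1 * (f1 + c * g1 - (f t l + c * g t l)) - (y l + c * z l) =
  (h^-1 * (f1 - f t l) - y l) + c * (h^-1 * (g1 - g t l) - z l) by ring.
apply: le_trans (nrmD _ _) _; rewrite nrmM [e]splitr; apply: lerD; first exact: H1.
by apply: le_trans (ler_wpM2r (nrm_ge0 _) c1) _; rewrite mul1r; exact: H2.
Qed.

Lemma uld_circ_mul f n t y : uld f n t y -> uld (fun s l => l * f s l) n t (fun l => l * y l).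
Proof.
move=> Hf e e0; apply: filterS (Hf _ e0) => h H1 l cl.
have -> : h^-1 * (l * f (set_time t n (t n + h)) l - l * f t l) - l * y l =
  l * (h^-1 * (f (set_time t n (t n + h)) l - f t l) - y l) by ring.
by rewrite nrmM ((circle_nrm _).1 cl) mul1r H1.
Qed.

(** Real increments at a fixed point of the circle suffice for identities between derivatives, and
    give access to the product rule and uniqueness of [cder]. *)
Lemma uld_cder f n t y l : uld f n t y -> circle l ->
  cder (fun s : R => f (set_time t n (t n + rc s)) l) 0 (y l).
Proof.
move=> H cl; apply: cder_of_cvg; apply/cvg_nrmP => e e0.
have e2 : 0 < e / 2 by rewrite divr_gt0.
have := H _ e2; rewrite /dnbhs /within /= => /nbhs_ballP[r /= /gt0_rc[-> r0] Hr].
apply/nbhs_ballP; exists (re r) => //= s; rewrite /ball /= sub0r normrN => sr s0.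
rewrite add0r rc0 addr0 set_timeK nrmB rcV.
apply: le_lt_trans (Hr (rc s) _ _ l cl) _.
- by rewrite /ball_ /= sub0r normrN normE rc_lt nrm_rc.
- by rewrite -rc0 (inj_eq (@rc_inj R)).
- lra.
Qed.

End TimeDerivatives.

(** * Loop series and the exponential of [a J] *)

Section LoopSeries.
Variable R : realType.
Local Notation C := (Cplx R).
Implicit Types (a : nat -> C).

Lemma cvg_terms_bounded (f : nat -> C) : cvgn (series f) ->
  exists2 B : R, 0 < B & forall n, nrm (f n) <= B.
Proof.
move=> /cvg_ex[/= L /cvg_nrmP/(_ _ ltr01)[N _ HN]].
exists (2 + \sum_(i < N) nrm (f i)).
  by rewrite ltr_pwDl // sumr_ge0 // => i _; exact: nrm_ge0.
move=> n; have [nN|Nn] := ltnP n N.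
  rewrite (bigD1 (Ordinal nN)) //= addrCA lerDl addr_ge0 // sumr_ge0 // => i _.
  exact: nrm_ge0.
apply: (@le_trans _ _ 2); last by rewrite lerDl sumr_ge0 // => i _; exact: nrm_ge0.
have -> : f n = (L - series f n) - (L - series f n.+1).
  by rewrite /series /= big_nat_recr //=; ring.
apply: le_trans (nrmD _ _) _; rewrite nrmN.
have := HN n Nn; have := HN n.+1 (leqW Nn); rewrite /=; lra.
Qed.

Lemma smooth_bound a k : smooth_series a ->
  exists2 B : R, 0 < B & forall n, n%:R ^+ k * nrm (a n) <= B.
Proof.
have c1 : circle (1 : C) by apply/circle_nrm; exact: nrm1.
move=> /(_ k 1 c1) /cvg_terms_bounded[B B0 HB]; exists B => // n.
by have := HB n; rewrite expr1n mulr1 nrmM nrmX nrm_nat.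
Qed.

Lemma sum_inv_sqr N : \sum_(i < N.+1) (i.+1%:R ^+ 2)^-1 <= 2 - N.+1%:R^-1 :> R.
Proof.
elim: N => [|N IH]; first by rewrite big_ord1 expr1n invr1; lra.
rewrite big_ord_recr /=; apply: le_trans (lerD IH (lexx _)) _.
have n0 : 0 < N.+1%:R :> R by rewrite ltr0n.
have n1 : 0 < N.+2%:R :> R by rewrite ltr0n.
have E : N.+2%:R = N.+1%:R + 1 :> R by rewrite natr1.
rewrite E in n1 *; set x := N.+1%:R in n0 n1 *.
have -> : 2 - x^-1 + ((x + 1) ^+ 2)^-1 = 2 - (x + 1)^-1 - (x * (x + 1) ^+ 2)^-1.
  by field; rewrite !gt_eqF.
by rewrite gerBl invr_ge0 ltW // mulr_gt0 // exprn_gt0.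
Qed.

Lemma sqr_summable (r : nat -> R) B : (forall n, 0 <= r n) ->
  (forall n, n%:R ^+ 2 * r n <= B) -> forall N, \sum_(n < N) r n <= r 0%N + 2 * B.
Proof.
move=> r0 rB [|N].
  have := rB 0%N; rewrite expr0n mul0r => B0.
  by rewrite big_ord0 addr_ge0 // mulr_ge0.
have B0 : 0 <= B by have := rB 0%N; rewrite expr0n mul0r.
rewrite big_ord_recl lerD2l; case: N => [|N].
  by rewrite big_ord0 mulr_ge0.
apply: (@le_trans _ _ (B * \sum_(i < N.+1) (i.+1%:R ^+ 2)^-1)).
  rewrite mulr_sumr ler_sum // => i _; rewrite /= /bump /= add1n.
  by rewrite ler_pdivlMr ?exprn_gt0 ?ltr0n // mulrC.
rewrite mulrC ler_wpM2r //; apply: le_trans (sum_inv_sqr N) _.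
by rewrite gerBl invr_ge0.
Qed.

(** Convergence at [lambda = 1] with weights [n ^ 2] and [n ^ 4] bounds those terms; comparison with
    [1 / n ^ 2] gives both sums. The weighted one serves termwise differentiation in the angle. *)
Lemma smooth_sum_bound a : smooth_series a -> exists2 B : R, 0 < B &
  forall N, \sum_(n < N) nrm (a n) <= B /\ \sum_(n < N) n%:R ^+ 2 * nrm (a n) <= B.
Proof.
move=> sa; have [B2 B20 H2] := smooth_bound 2 sa; have [B4 B40 H4] := smooth_bound 4 sa.
exists (nrm (a 0%N) + 2 * B2 + 2 * B4).
  by rewrite ltr_wpDl ?mulr_gt0 // addr_ge0 ?nrm_ge0 // mulr_ge0 // ltW.
move=> N; split.
  have := @sqr_summable (fun n => nrm (a n)) B2 (fun n => nrm_ge0 _) H2 N.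
  by move=> H; apply: le_trans H _; rewrite lerDl mulr_ge0 // ltW.
have := @sqr_summable (fun n => n%:R ^+ 2 * nrm (a n)) B4 _ _ N => H.
apply: le_trans (H _ _) _.
- by move=> n; rewrite mulr_ge0 ?nrm_ge0 // exprn_ge0.
- by move=> n; rewrite mulrA -exprD; exact: H4.
- by rewrite expr0n mul0r add0r lerDr addr_ge0 ?nrm_ge0 // mulr_ge0 // ltW.
Qed.

Lemma loop_series_cvg a l : smooth_series a -> circle l ->
  series (fun n => a n * l ^+ n) @ \oo --> loop_series a l.
Proof.
move=> sa cl; have := sa 0%N l cl; rewrite /loop_series /csum.
by under [in X in X -> _]eq_fun do rewrite expr0 mul1r.
Qed.

Lemma smooth_seriesM a : smooth_series a -> smooth_series (fun n => n%:R * a n).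
Proof.
move=> sa k l cl; have := sa k.+1 l cl.
by under eq_fun do rewrite exprSr -[_ * _ * a _]mulrA.
Qed.

Definition psum a (N : nat) (l : C) : C := \sum_(n < N) a n * l ^+ n.

Lemma seriesE (f : nat -> C) N : series f N = \sum_(n < N) f n.
Proof. by rewrite /series /= big_mkord. Qed.

Lemma psum_cvg a l : smooth_series a -> circle l ->
  (fun n => psum a n l) @ \oo --> loop_series a l.
Proof.
by move=> sa cl; apply: eqf_cvg (loop_series_cvg sa cl) => n; rewrite seriesE.
Qed.

Lemma psum0 a l : psum a 0 l = 0. Proof. by rewrite /psum big_ord0. Qed.
Lemma psumS a n l : psum a n.+1 l = psum a n l + a n * l ^+ n.
Proof. by rewrite /psum big_ord_recr. Qed.

Lemma psum_ccont a N : ccont (psum a N).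
Proof. by rewrite /psum; cc. Qed.

(** Weierstrass test with the majorant [nrm (a n)]. *)
Lemma loop_series_unif a (e : R) : smooth_series a -> 0 < e ->
  exists N, forall n l, (N <= n)%N -> circle l -> nrm (loop_series a l - psum a n l) <= e.
Proof.
move=> sa e0; have [B B0 HB] := smooth_sum_bound sa.
pose r := series (fun n => nrm (a n)).
have rS n : r n.+1 = r n + nrm (a n) by rewrite /r /series /= big_nat_recr.
have rm : {homo r : n m / (n <= m)%N >-> n <= m}.
  by move=> n m /subnK <-; elim: (m - n)%N => // k IH; rewrite addSn rS (le_trans IH) // lerDl nrm_ge0.
have rc : cvgn r.
  apply: nondecreasing_is_cvgn => //; exists B => _ [n _ <-].
  by rewrite /r /series /= big_mkord; have [] := HB n.
have rl n : r n <= limn r by exact: nondecreasing_cvgn_le.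
have /cvgrPdist_lt/(_ _ e0)[N _ HN] : r @ \oo --> limn r by exact: rc.
exists N => n l Nn cl.
have D m : (n <= m)%N -> nrm (psum a m l - psum a n l) <= r m - r n.
  move=> /subnK <-; elim: (m - n)%N => [|k IH]; first by rewrite add0n !subrr nrm0.
  rewrite addSn rS /psum big_ord_recr /= -/(psum a (k + n) l) addrAC.
  apply: le_trans (nrmD _ _) _; rewrite [leRHS]addrAC lerD //.
  by rewrite nrmM nrmX ((circle_nrm _).1 cl) expr1n mulr1.
have En : limn r - r n <= e.
  by have := HN n Nn; rewrite /= ltr_norml => /andP[_ /ltW].
apply/ler_addgt0Pl => d d0.
have /cvg_nrmP/(_ _ d0)[M _ HM] := loop_series_cvg sa cl.
have := HM (maxn M n) (leq_maxl _ _); rewrite /= seriesE -/(psum a _ l) => H1.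
have H2 := D (maxn M n) (leq_maxr _ _).
have -> : loop_series a l - psum a n l =
  (loop_series a l - psum a (maxn M n) l) + (psum a (maxn M n) l - psum a n l) by ring.
apply: le_trans (nrmD _ _) _; apply: lerD; first exact: ltW.
by apply: le_trans H2 _; apply: le_trans En; rewrite lerD2r.
Qed.

Lemma loop_series_ccont a : smooth_series a -> ccont (loop_series a).
Proof.
move=> sa; apply: ccont_lim => e e0; have [N HN] := loop_series_unif sa e0.
by exists (psum a N); [exact: psum_ccont|move=> l cl; exact: HN].
Qed.

Lemma mean_loop_series a f : smooth_series a -> ccont f ->
  series (fun n => a n * coef f n) @ \oo --> mean (fun l => loop_series a l * f l).
Proof.
move=> sa cf; have ca := loop_series_ccont sa.
have [B B0 HB] := ccont_bound cf.
apply/cvg_nrmP => e e0.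
have d0 : 0 < e / (4 * B) by rewrite divr_gt0 // mulr_gt0.
have [N HN] := loop_series_unif sa d0; exists N => // n /= Nn.
have -> : series (fun n => a n * coef f n) n = mean (fun l => psum a n l * f l).
  have cc0 (k : nat) : ccont (fun l => l ^+ k * f l) by cc.
  rewrite seriesE; under eq_bigr do rewrite /coef -(meanZ _ (cc0 _)).
  rewrite -mean_sum; last by move=> k; cc.
  apply: eq_mean => l _; rewrite /psum mulr_suml; apply: eq_bigr => k _; ring.
have cp := psum_ccont a n.
apply: le_lt_trans (mean_near (e := e / (4 * B) * B) (ccontM ca cf) (ccontM cp cf) _) _.
  move=> l cl; rewrite -mulrBl nrmM; apply: ler_pM; rewrite ?nrm_ge0 ?HB //; exact: HN.
have -> : 2 * (e / (4 * B) * B) = e / 2 by field; rewrite gt_eqF.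
lra.
Qed.

Lemma cis_lip (u v : R) : nrm (cis u - cis v : C) <= 2 * `|u - v|.
Proof.
wlog: u v / v <= u => [W|vu].
  have [vu|uv] := leP v u; first exact: W.
  by rewrite nrmB distrC; apply: W; exact: ltW.
rewrite (ger0_norm (x := u - v)) ?subr_ge0 // -[2]mulr1.
apply: (@cder_bound R (@cis R) (fun y => ci * cis y) 1 v u (@cder_cis R) _ vu).
- by move=> y; apply: cvgM; [exact: cvg_cst|exact: continuous_cis].
- by move=> y _; rewrite nrmM nrm_ci nrm_cis mul1r.
Qed.

Lemma cis_taylor (u : R) : nrm (cis u - 1 - ci * rc u : C) <= 4 * u ^+ 2.
Proof.
pose F (y : R) : C := cis y - ci * rc y.
have dF y : cder F y (ci * (cis y - 1)).
  by apply: (cder_eq (cderB (cder_cis y) (cderZ ci (cder_id y)))); ring.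
have cF : continuous (fun y : R => ci * (cis y - 1) : C).
  by move=> y; exact: cder_continuous (cderZ ci (cderB (cder_cis y) (cder_cst 1 y))).
have F0 : F 0 = 1 by rewrite /F cis0 rc0 mulr0 subr0.
have -> : cis u - 1 - ci * rc u = F u - F 0 by rewrite F0 /F; ring.
have bF y : `|y| <= `|u| -> nrm (ci * (cis y - 1) : C) <= 2 * `|u|.
  move=> yu; rewrite nrmM nrm_ci mul1r -cis0; apply: le_trans (cis_lip _ _) _.
  by rewrite subr0 ler_wpM2l.
have -> : 4 * u ^+ 2 = 2 * (2 * `|u|) * `|u| by rewrite -real_normK ?num_real //; ring.
have [u0|u0] := leP 0 u.
  rewrite {2}(ger0_norm u0) -[X in _ * X]subr0.
  apply: (cder_bound dF cF u0) => y /andP[y0 yu]; apply: bF.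
  by rewrite !ger0_norm // (le_trans y0).
rewrite nrmB {2}(ltr0_norm u0) -[X in _ * X]add0r.
apply: (cder_bound dF cF (ltW u0)) => y /andP[uy y0]; apply: bF.
by rewrite (ler0_norm y0) (ltr0_norm u0) lerN2.
Qed.

Lemma cisX (h : R) n : cis h ^+ n = cis (n%:R * h) :> C.
Proof.
elim: n => [|n IH]; first by rewrite expr0 mul0r cis0.
by rewrite exprS IH -cisD -natr1 mulrDl mul1r addrC.
Qed.

Lemma lim_nrm_le (f : nat -> C) (L : C) (B : R) : f @ \oo --> L ->
  (forall n, nrm (f n) <= B) -> nrm L <= B.
Proof.
move=> /cvg_nrmP H fB; apply/ler_addgt0Pl => e e0.
have [N _ /(_ N (leqnn N)) /= HN] := H e e0.
have := nrmD (L - f N) (f N); rewrite subrK; have := fB N; lra.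
Qed.

(** The second-order remainder of [cis (n h)] is at most [4 n^2 h^2]; summed against [a n], it
    bounds the remainder of the whole series by [4 B h^2]. *)
Lemma loop_series_cder a (x : R) : smooth_series a ->
  cder (fun y => loop_series a (cis y)) x
       (ci * loop_series (fun n => n%:R * a n) (cis x)).
Proof.
move=> sa; have sa1 := smooth_seriesM sa.
have [B B0 HB] := smooth_sum_bound sa.
set d := ci * _.
have E (h : R) : nrm (loop_series a (cis (x + h)) - loop_series a (cis x) - rc h * d) <= 4 * h ^+ 2 * B.
  pose f (n : nat) : C := psum a n (cis (x + h)) - psum a n (cis x)
    - rc h * (ci * psum (fun n => n%:R * a n) n (cis x)).
  apply: (@lim_nrm_le f).
    apply: cvgB; first by apply: cvgB; apply: psum_cvg => //; exact: circle_cis.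
    apply: cvgM; first exact: cvg_cst.
    apply: cvgM; first exact: cvg_cst.
    by apply: psum_cvg => //; exact: circle_cis.
  move=> n; apply: (@le_trans _ _ (4 * h ^+ 2 * \sum_(k < n) k%:R ^+ 2 * nrm (a k))); last first.
    have [_ H2] := HB n; rewrite ler_wpM2l //.
    by apply: mulr_ge0; [exact: ler0n|exact: sqr_ge0].
  elim: n => [|n IH]; first by rewrite /f !psum0 big_ord0 !mulr0 !subr0 nrm0.
  have -> : f n.+1 = f n + a n * cis x ^+ n * (cis (n%:R * h) - 1 - ci * rc (n%:R * h)).
    rewrite /f !psumS cisD exprMn (cisX h) rcM rc_nat.
    move: (psum a n (cis x * cis h)) (psum a n (cis x)) (psum _ n (cis x)) => p q r.
    move: (cis x ^+ n) (cis (n%:R * h)) (rc h) (a n) (n%:R : C) => X Y H A N.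
    ring.
  rewrite big_ord_recr /= [X in _ <= X]mulrDr; apply: le_trans (nrmD _ _) _; apply: lerD => //.
  rewrite nrmM nrmM nrmX nrm_cis expr1n mulr1.
  have -> : 4 * h ^+ 2 * (n%:R ^+ 2 * nrm (a n)) = nrm (a n) * (4 * (n%:R * h) ^+ 2).
    by rewrite exprMn; ring.
  by rewrite ler_wpM2l ?nrm_ge0 // cis_taylor.
apply: cder_of_cvg; apply/cvg_nrmP => e e0.
have r0 : 0 < e / (4 * B) by rewrite divr_gt0 // mulr_gt0.
apply/nbhs_ballP; exists (e / (4 * B)) => //= h; rewrite /ball /= sub0r normrN => hr h0.
have hc : rc h != 0 :> C by rewrite -rc0 (inj_eq (@rc_inj R)).
have -> : d - rc h^-1 * (loop_series a (cis (x + h)) - loop_series a (cis x)) =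
   - (rc h^-1 * (loop_series a (cis (x + h)) - loop_series a (cis x) - rc h * d)).
  by rewrite [in RHS]mulrBr [rc h^-1 * (rc h * d)]mulrA -rcM mulVf // rc1 mul1r opprB.
rewrite nrmN nrmM nrm_rc normfV.
apply: le_lt_trans (ler_wpM2l _ (E h)) _; first by rewrite invr_ge0.
rewrite -[h ^+ 2]real_normK ?num_real //.
have hp : 0 < `|h| by rewrite normr_gt0.
have -> : `|h|^-1 * (4 * `|h| ^+ 2 * B) = `|h| * (4 * B) by field; rewrite gt_eqF.
by rewrite -ltr_pdivlMr // mulr_gt0.
Qed.
End LoopSeries.

Section Exponential.
Variable R : realType.
Local Notation C := (Cplx R).
Local Notation M2 := 'M[C]_2.
Implicit Types (A B : M2) (l kap a b : C).

Lemma I2P (i : 'I_2) : i = 0 \/ i = 1.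
Proof. by case: i => [[|[|//]]] ?; [left|right]; apply: val_inj. Qed.

Lemma mx2_ext A B : A 0 0 = B 0 0 -> A 0 1 = B 0 1 -> A 1 0 = B 1 0 -> A 1 1 = B 1 1 -> A = B.
Proof.
by move=> e00 e01 e10 e11; apply/matrixP => i j;
  case: (I2P i) => ->; case: (I2P j) => ->.
Qed.

Lemma mulE2 A B i j : (A * B) i j = A i 0 * B 0 j + A i 1 * B 1 j.
Proof.
rewrite -mulmxE mxE big_ord_recl big_ord1; congr (_ + _ * _).
  by congr (A i _); apply: val_inj.
by congr (B _ j); apply: val_inj.
Qed.

Lemma addE2 A B i j : (A + B) i j = A i j + B i j. Proof. by rewrite mxE. Qed.
Lemma oppE2 A i j : (- A) i j = - A i j. Proof. by rewrite mxE. Qed.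
Lemma scaleE2 a A i j : (a *: A) i j = a * A i j. Proof. by rewrite mxE. Qed.
Lemma mx22_00 (a b c d : C) : mx22 a b c d 0 0 = a. Proof. by rewrite mxE. Qed.
Lemma mx22_01 (a b c d : C) : mx22 a b c d 0 1 = b. Proof. by rewrite mxE. Qed.
Lemma mx22_10 (a b c d : C) : mx22 a b c d 1 0 = c. Proof. by rewrite mxE. Qed.
Lemma mx22_11 (a b c d : C) : mx22 a b c d 1 1 = d. Proof. by rewrite mxE. Qed.
Lemma oneE2 : ((1 : M2) = mx22 1 0 0 1).
Proof. by apply: mx2_ext; rewrite !mxE. Qed.
Lemma matJE l : matJ l = mx22 0 1 l 0.
Proof. by apply: mx2_ext; rewrite !mxE /=; ring. Qed.

Definition mxE2 := (mulE2, addE2, oppE2, scaleE2, mx22_00, mx22_01, mx22_10, mx22_11).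

(** The exponential of [a J(kap^2)], with entries [cosh (a kap)], [sinh (a kap) / kap] and
    [kap sinh (a kap)]: the eigenvalues of [J(kap^2)] are [kap] and [- kap]. *)
Definition exJ kap a : M2 :=
  mx22 ((cexp (a * kap) + cexp (- (a * kap))) / 2)
       ((cexp (a * kap) - cexp (- (a * kap))) / 2 * kap^-1)
       (kap * ((cexp (a * kap) - cexp (- (a * kap))) / 2))
       ((cexp (a * kap) + cexp (- (a * kap))) / 2).

Lemma powJ kap a n : kap != 0 -> (a *: matJ (kap ^+ 2)) ^+ n =
  mx22 (((a * kap) ^+ n + (- (a * kap)) ^+ n) / 2)
       (((a * kap) ^+ n - (- (a * kap)) ^+ n) / 2 * kap^-1)
       (kap * (((a * kap) ^+ n - (- (a * kap)) ^+ n) / 2))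
       (((a * kap) ^+ n + (- (a * kap)) ^+ n) / 2).
Proof.
move=> k0; elim: n => [|n IH].
  by rewrite !expr0 oneE2; apply: mx2_ext; rewrite !mxE2; field.
by rewrite exprSr IH matJE !exprSr; apply: mx2_ext; rewrite !mxE2; field.
Qed.

Lemma cvg_halfD (u v : nat -> C) (x y : C) : u @ \oo --> x -> v @ \oo --> y ->
  (fun n => (u n + v n) / 2) @ \oo --> (x + y) / 2.
Proof. by move=> ux vy; apply: cvgM; [exact: (cvgD ux vy)|exact: cvg_cst]. Qed.

Lemma cvg_halfB (u v : nat -> C) (x y : C) : u @ \oo --> x -> v @ \oo --> y ->
  (fun n => (u n - v n) / 2) @ \oo --> (x - y) / 2.
Proof. by move=> ux vy; apply: cvgM; [exact: (cvgB ux vy)|exact: cvg_cst]. Qed.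

Lemma cvg_mulr_cst (c : C) (u : nat -> C) (x : C) : u @ \oo --> x ->
  (fun n => u n * c) @ \oo --> x * c.
Proof. by move=> ux; apply: cvgM; [exact: ux|exact: cvg_cst]. Qed.

Lemma cvg_mull_cst (c : C) (u : nat -> C) (x : C) : u @ \oo --> x ->
  (fun n => c * u n) @ \oo --> c * x.
Proof. by move=> ux; apply: cvgM; [exact: cvg_cst|exact: ux]. Qed.

Lemma mexpJ kap a : kap != 0 -> mexp (a *: matJ (kap ^+ 2)) = exJ kap a.
Proof.
move=> k0; rewrite /mexp; apply: cvg_lim => //.
apply/mx_cvgP => i j.
have S n : series (fun k => (k`!%:R)^-1 *: (a *: matJ (kap ^+ 2)) ^+ k) n =
  mx22 ((expsum n (a * kap) + expsum n (- (a * kap))) / 2)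
       ((expsum n (a * kap) - expsum n (- (a * kap))) / 2 * kap^-1)
       (kap * ((expsum n (a * kap) - expsum n (- (a * kap))) / 2))
       ((expsum n (a * kap) + expsum n (- (a * kap))) / 2).
  rewrite /series /= big_mkord; elim: n => [|n IH].
    by rewrite big_ord0 !expsum0; apply: mx2_ext; rewrite !mxE2 ?mxE; ring.
  by rewrite big_ord_recr /= IH powJ // !expsumS; apply: mx2_ext; rewrite !mxE2; ring.
apply: (@eqf_cvg _ _ _ (fun n => mx22 ((expsum n (a * kap) + expsum n (- (a * kap))) / 2)
       ((expsum n (a * kap) - expsum n (- (a * kap))) / 2 * kap^-1)
       (kap * ((expsum n (a * kap) - expsum n (- (a * kap))) / 2))
       ((expsum n (a * kap) + expsum n (- (a * kap))) / 2) i j)) => [n|]; first by rewrite S.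
have cp := @cexp_series R (a * kap); have cm := @cexp_series R (- (a * kap)).
have cD : (fun n => (expsum n (a * kap) + expsum n (- (a * kap))) / 2) @ \oo -->
    (cexp (a * kap) + cexp (- (a * kap))) / 2.
  exact: (@cvg_halfD (fun n => expsum n (a * kap)) (fun n => expsum n (- (a * kap)))).
have cB : (fun n => (expsum n (a * kap) - expsum n (- (a * kap))) / 2) @ \oo -->
    (cexp (a * kap) - cexp (- (a * kap))) / 2.
  exact: (@cvg_halfB (fun n => expsum n (a * kap)) (fun n => expsum n (- (a * kap)))).
case: (I2P i) => ->; case: (I2P j) => ->.
- rewrite /exJ mx22_00; under eq_fun do rewrite mx22_00; exact: cD.
- rewrite /exJ mx22_01; under eq_fun do rewrite mx22_01; exact: (@cvg_mulr_cst _ _ _ cB).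
- rewrite /exJ mx22_10; under eq_fun do rewrite mx22_10; exact: (@cvg_mull_cst _ _ _ cB).
- rewrite /exJ mx22_11; under eq_fun do rewrite mx22_11; exact: cD.
Qed.

Definition mder (F : R -> M2) (x : R) (D : M2) : Prop :=
  forall i j, cder (fun y => F y i j) x (D i j).

Lemma mderM F G x D E : mder F x D -> mder G x E ->
  mder (fun y => F y * G y) x (D * G x + F x * E).
Proof.
move=> dF dG i j; under eq_fun do rewrite mulE2.
apply: cder_eq (cderD (cderM (dF i 0) (dG 0 j)) (cderM (dF i 1) (dG 1 j))) _.
by rewrite !mxE2; ring.
Qed.

Lemma mder_unique F x D E : mder F x D -> mder F x E -> D = E.
Proof. by move=> dD dE; apply/matrixP => i j; exact: cder_unique (dD i j) (dE i j). Qed.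

Lemma mder_cst A x : mder (fun=> A) x 0.
Proof. by move=> i j; rewrite mxE; exact: cder_cst. Qed.

Lemma mder_mx22 (f00 f01 f10 f11 : R -> C) x (d00 d01 d10 d11 : C) D :
  cder f00 x d00 -> cder f01 x d01 -> cder f10 x d10 -> cder f11 x d11 ->
  D = mx22 d00 d01 d10 d11 ->
  mder (fun y => mx22 (f00 y) (f01 y) (f10 y) (f11 y)) x D.
Proof.
move=> c00 c01 c10 c11 -> i j; case: (I2P i) => ->; case: (I2P j) => ->.
- by rewrite mx22_00; under eq_fun do rewrite mx22_00.
- by rewrite mx22_01; under eq_fun do rewrite mx22_01.
- by rewrite mx22_10; under eq_fun do rewrite mx22_10.
- by rewrite mx22_11; under eq_fun do rewrite mx22_11.
Qed.

Lemma exJ_der (K A : R -> C) x (k' a' : C) : K x != 0 -> cder K x k' -> cder A x a' ->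
  cder (fun y => (K y)^-1) x (- k' / (K x) ^+ 2) ->
  mder (fun y => exJ (K y) (A y)) x
   (mx22 ((a' * K x + A x * k') * ((cexp (A x * K x) - cexp (- (A x * K x))) / 2))
         ((a' * K x + A x * k') * ((cexp (A x * K x) + cexp (- (A x * K x))) / 2) / K x
           - (cexp (A x * K x) - cexp (- (A x * K x))) / 2 * (k' / (K x) ^+ 2))
         (k' * ((cexp (A x * K x) - cexp (- (A x * K x))) / 2)
           + K x * ((a' * K x + A x * k') * ((cexp (A x * K x) + cexp (- (A x * K x))) / 2)))
         ((a' * K x + A x * k') * ((cexp (A x * K x) - cexp (- (A x * K x))) / 2))).
Proof.
move=> k0 dK dA dV.
have ez := cderM dA dK.
have ep := cder_cexp ez; have em := cder_cexp (cderN ez).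
have eD := cderM (cderD ep em) (cder_cst 2^-1 x).
have eB := cderM (cderB ep em) (cder_cst 2^-1 x).
apply: (mder_mx22 eD (cderM eB dV) (cderM dK eB) eD).
by apply: mx2_ext; rewrite !mxE2; field.
Qed.

Lemma cder_inv_cis (x c : R) : cder (fun y => (cis (c * y))^-1 : C) x (- (ci * rc c) / cis (c * x)).
Proof.
under eq_fun do rewrite -cisN.
have d : is_derive x (1 : R) (fun y : R => - (c * y)) (- c).
  have := rderN (rderM (is_derive_cst c x 1) (is_derive_id x 1)).
  by rewrite mul0r add0r mulr1.
have := @cder_comp R (@cis R) (fun y => - (c * y)) x _ _ (cder_cis _) d.
by rewrite rcN -cisN => /cder_eq; apply; ring.
Qed.

Lemma cder_cisM (x c : R) : cder (fun y => cis (c * y) : C) x (ci * rc c * cis (c * x)).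
Proof.
have d : is_derive x (1 : R) (fun y : R => c * y) c.
  have := rderM (is_derive_cst c x 1) (is_derive_id x 1).
  by rewrite mul0r add0r mulr1.
have := @cder_comp R (@cis R) (fun y => c * y) x _ _ (cder_cis _) d.
by move=> /cder_eq; apply; ring.
Qed.

(* The square root [cis (x / 2)] of [lambda = cis x] diagonalises [matJ lambda]. *)
Lemma mexp_cis (x : R) a : mexp (a *: matJ (cis x)) = exJ (cis (2^-1 * x)) a.
Proof.
rewrite -(mexpJ a (cis_neq0 (2^-1 * x))) expr2 -cisD.
by have -> : 2^-1 * x + 2^-1 * x = x by field.
Qed.

Lemma mexp_time (A : R -> C) (s x : R) (a' : C) : cder A s a' ->
  mder (fun y => mexp (A y *: matJ (cis x))) s
       ((a' *: matJ (cis x)) * mexp (A s *: matJ (cis x))).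
Proof.
move=> dA; under eq_fun do rewrite mexp_cis.
have k0 : cis (2^-1 * x) != 0 :> C by exact: cis_neq0.
have dV : cder (fun=> (cis (2^-1 * x))^-1 : C) s (- 0 / cis (2^-1 * x) ^+ 2).
  by rewrite oppr0 mul0r; exact: cder_cst.
have := @exJ_der (fun=> cis (2^-1 * x)) A s 0 a' k0 (cder_cst _ s) dA dV.
rewrite mexp_cis matJE.
have -> : cis x = cis (2^-1 * x) ^+ 2 :> C by rewrite expr2 -cisD; congr cis; field.
set k := cis _ in k0 *; move=> H i j.
apply: cder_eq (H i j) _; congr (fun_of_matrix _ i j).
by rewrite /exJ; apply: mx2_ext; rewrite !mxE2; field.
Qed.

(** [J] has degree 1/2 in the sense that [lambda dJ/dlambda + [H, J] / 4 = J / 2]. Hence the angular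
    derivative corrected by [(i / 4) ad H] multiplies the exponential by [(a' + i A / 2) J]; undoing
    the correction leaves the commutator. *)
Lemma mexp_angle (A : R -> C) (x : R) (a' : C) : cder A x a' ->
  mder (fun y => mexp (A y *: matJ (cis y))) x
   (((a' + ci * A x / 2) *: matJ (cis x)) * mexp (A x *: matJ (cis x))
    - (ci / 4) *: (matH * mexp (A x *: matJ (cis x)) - mexp (A x *: matJ (cis x)) * matH)).
Proof.
move=> dA; under eq_fun do rewrite mexp_cis.
have k0 : cis (2^-1 * x) != 0 :> C by exact: cis_neq0.
have dV : cder (fun y => (cis (2^-1 * y))^-1 : C) x
    (- (ci * rc 2^-1 * cis (2^-1 * x)) / cis (2^-1 * x) ^+ 2).
  by apply: cder_eq (cder_inv_cis x 2^-1) _; field.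
have := @exJ_der (fun y => cis (2^-1 * y)) A x _ a' k0 (cder_cisM x 2^-1) dA dV.
rewrite mexp_cis matJE.
have -> : cis x = cis (2^-1 * x) ^+ 2 :> C by rewrite expr2 -cisD; congr cis; field.
have -> : rc 2^-1 = 2^-1 :> C by rewrite rcV (rc_nat R 2).
set k := cis _ in k0 *; move=> H i j.
apply: cder_eq (H i j) _; congr (fun_of_matrix _ i j).
by rewrite /exJ /matH; apply: mx2_ext; rewrite !mxE2; field.
Qed.

Lemma det2E A : \det A = A 0 0 * A 1 1 - A 0 1 * A 1 0.
Proof.
rewrite (expand_det_row _ 0) big_ord_recl big_ord1 /cofactor !det_mx11 !mxE /=.
rewrite expr0 expr1 mul1r mulN1r mulrN; congr (_ * A _ _ - A _ _ * A _ _); exact: val_inj.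
Qed.

Lemma det1E A : \det A = 1 -> A 0 0 * A 1 1 - A 0 1 * A 1 0 = 1.
Proof. by move=> <-; rewrite det2E. Qed.

Lemma inv_det1 A : \det A = 1 -> A^-1 = mx22 (A 1 1) (- A 0 1) (- A 1 0) (A 0 0).
Proof.
move=> d1; set B := mx22 _ _ _ _.
have dE : A 0 0 * A 1 1 - A 0 1 * A 1 0 = 1.
  exact: det1E.
have AB : A * B = 1.
  by rewrite oneE2 /B; apply: mx2_ext; rewrite !mxE2 -?dE; ring.
have uA : A \is a GRing.unit by rewrite unitmxE d1 unitr1.
by rewrite -[B]mul1r -(mulVr uA) -mulrA AB mulr1.
Qed.

Lemma det1_unit A : \det A = 1 -> A \is a GRing.unit.
Proof. by move=> d1; rewrite unitmxE d1 unitr1. Qed.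

End Exponential.

(** * A quadratic identity for the Gel'fand-Dickii potentials *)

Section DPoly.
Variable R : realType.
Local Notation C := (Cplx R).
Implicit Types (p q : dpoly R) (x y : nat -> C).

(** The derivative of the polynomial function at [x] in the direction [y]; for the shifted sequence
    as direction it is the derivation [dder]. *)
Fixpoint ddir x y p : C :=
  match p with
  | DConst _ => 0
  | DVar k => y k
  | DAdd p q => ddir x y p + ddir x y q
  | DMul p q => ddir x y p * deval x q + deval x p * ddir x y q
  end.

Lemma deval_dder x p : deval x (dder p) = ddir x (fun k => x k.+1) p.
Proof. by elim: p => //= p -> q ->. Qed.

Fixpoint dline x y p : {poly C} :=
  match p with
  | DConst c => c%:P
  | DVar k => (x k)%:P + y k *: 'X
  | DAdd p q => dline x y p + dline x y q
  | DMul p q => dline x y p * dline x y q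
  end.

Lemma dlineE x y p z : (dline x y p).[z] = deval (fun k => x k + y k * z) p.
Proof.
elim: p => /= [c|k|p IHp q IHq|p IHp q IHq]; rewrite ?hornerE //.
- by rewrite IHp IHq.
- by rewrite IHp IHq.
Qed.

Lemma dline_deriv x y p z :
  (dline x y p)^`().[z] = ddir (fun k => x k + y k * z) y p.
Proof.
elim: p => /= [c|k|p IHp q IHq|p IHp q IHq].
- by rewrite derivC horner0.
- by rewrite derivD derivC derivZ derivX add0r !hornerE.
- by rewrite derivD hornerD IHp IHq.
- by rewrite derivM hornerD !hornerM IHp IHq !dlineE.
Qed.

Lemma poly_eval_eq (P Q : {poly C}) : (forall z, P.[z] = Q.[z]) -> P = Q.
Proof.
move=> PQ; apply/eqP; rewrite -subr_eq0; apply/negPn/negP => D0.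
pose rs : seq C := [seq n%:R | n <- iota 0 (size (P - Q))].
have rr : all (root (P - Q)) rs.
  by apply/allP => _ /mapP[n _ ->]; rewrite /root !hornerE PQ subrr.
have ur : uniq rs.
  by rewrite map_inj_uniq ?iota_uniq // => m n /eqP; rewrite eqr_nat => /eqP.
by have := max_poly_roots D0 rr ur; rewrite size_map size_iota ltnn.
Qed.

Lemma eq_deval x y p : x =1 y -> deval x p = deval y p.
Proof. by move=> /funext ->. Qed.

Lemma ddirE x y p : ddir x y p = (dline x y p)^`().[0].
Proof.
by rewrite dline_deriv; congr ddir; apply/funext => k; rewrite mulr0 addr0.
Qed.

(** [deq] only compares values, so the derivation must be recovered from values: it is a directional
    derivative, read on the restriction [dline] to a line, and a one-variable polynomial over an
    infinite field is determined by its values. *)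
Lemma deq_dder p q : deq p q -> deq (dder p) (dder q).
Proof.
move=> pq x; rewrite !deval_dder !ddirE; congr (_^`().[_]).
by apply: poly_eval_eq => z; rewrite !dlineE pq.
Qed.

Lemma ddirD x y1 y2 p :
  ddir x (fun k => y1 k + y2 k) p = ddir x y1 p + ddir x y2 p.
Proof. by elim: p => //= [_|p -> q ->|p -> q ->]; ring. Qed.

Lemma ddir0 x p : ddir x (fun=> 0) p = 0.
Proof. by elim: p => //= [p -> q ->|p -> q ->]; ring. Qed.

Lemma deval0_dder p : deval (fun=> 0) (dder p) = 0.
Proof. by rewrite deval_dder ddir0. Qed.

Definition depends_below N p : Prop :=
  forall x y, (forall k, (k < N)%N -> x k = y k) -> deval x p = deval y p.

Lemma depends_below_leq N M p : (N <= M)%N -> depends_below N p -> depends_below M p.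
Proof. by move=> NM pN x y xy; apply: pN => k kN; apply: xy; exact: leq_trans NM. Qed.

Lemma depends_below_exists p : exists N, depends_below N p.
Proof.
elim: p => [c|k|p [N pN] q [M qM]|p [N pN] q [M qM]].
- by exists 0%N.
- by exists k.+1 => x y xy /=; exact: xy.
- exists (maxn N M) => x y xy /=.
  by rewrite (depends_below_leq (leq_maxl N M) pN xy) (depends_below_leq (leq_maxr N M) qM xy).
- exists (maxn N M) => x y xy /=.
  by rewrite (depends_below_leq (leq_maxl N M) pN xy) (depends_below_leq (leq_maxr N M) qM xy).
Qed.

Lemma depends_below_ddir N p x x' y y' : depends_below N p ->
  (forall k, (k < N)%N -> x k = x' k) -> (forall k, (k < N)%N -> y k = y' k) ->
  ddir x y p = ddir x' y' p.
Proof.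
move=> pN xx yy; rewrite !ddirE; congr (_^`().[_]); apply: poly_eval_eq => z.
by rewrite !dlineE; apply: pN => k kN; rewrite xx // yy.
Qed.

Lemma poly_deriv0 (P : {poly C}) z : P^`() = 0 -> P.[z] = P.[0].
Proof.
move=> P0; suff -> : P = (P`_0)%:P by rewrite !hornerC.
apply/polyP => -[|n]; rewrite coefC //=.
have := coef_deriv P n; rewrite P0 coef0 => /esym/eqP.
by rewrite mulrn_eq0 /= => /eqP.
Qed.

(** The derivative is the sum of [x k.+1] times the partial derivative in [x k]. Changing [x N.+1]
    alone, on which [p] does not depend, isolates the partial derivative in [x N], which is
    therefore 0 everywhere. *)
Lemma depends_below_step N p : deq (dder p) (DConst 0) ->
  depends_below N.+1 p -> depends_below N p.
Proof.
move=> dp pN.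
pose e : nat -> C := fun k => (k == N)%:R.
have de x : ddir x e p = 0.
  pose xt (c : C) k := if k == N.+1 then c else x k.
  have H c : ddir x (fun k => xt c k.+1) p = 0.
    have := dp (xt c); rewrite deval_dder /= => <-; apply: (depends_below_ddir pN) => // k kN.
    by rewrite /xt ltn_eqF.
  have := H 1; have := H 0.
  have -> : (fun k => xt 1 k.+1) = (fun k => xt 0 k.+1 + e k).
    apply/funext => k; rewrite /xt /e eqSS.
    by case: eqP => _; rewrite ?add0r ?addr0.
  by rewrite ddirD => ->; rewrite add0r.
move=> x y xy.
have L z : deval (fun k => x k + e k * z) p = deval x p.
  rewrite -dlineE (@poly_deriv0 _ z).
    rewrite dlineE; apply: eq_deval => k; by rewrite mulr0 addr0.
  by apply: poly_eval_eq => w; rewrite dline_deriv de horner0.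
rewrite -(L (y N - x N)); apply: pN => k; rewrite ltnS leq_eqVlt => /predU1P[->|kN].
  by rewrite /e eqxx mul1r addrC subrK.
by rewrite /e ltn_eqF // mul0r addr0 xy.
Qed.

(* A differential polynomial with vanishing derivative is constant: the highest
   variable [DVar k] present would contribute [DVar k.+1] to the derivative. *)
Lemma dder0_const p x : deq (dder p) (DConst 0) -> deval x p = deval (fun=> 0) p.
Proof.
move=> dp; have [N] := depends_below_exists p.
elim: N => [p0|N IH /(depends_below_step dp)//]; exact: p0.
Qed.

Definition conv (f g : nat -> C) n : C := \sum_(i < n.+1) f i * g (n - i)%N.

Lemma convC f g n : conv f g n = conv g f n.
Proof.
rewrite /conv (reindex_inj rev_ord_inj) /=; apply: eq_bigr => i _.
by rewrite subSS subKn 1?mulrC // -ltnS.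
Qed.

Definition dsum (s : seq (dpoly R)) : dpoly R := foldr (@DAdd R) (DConst 0) s.

Lemma deval_dsum x s : deval x (dsum s) = \sum_(p <- s) deval x p.
Proof. by elim: s => [|p s IH]; rewrite ?big_nil //= big_cons -IH. Qed.

Lemma deval_dder_dsum x s : deval x (dder (dsum s)) = \sum_(p <- s) deval x (dder p).
Proof. by elim: s => [|p s IH]; rewrite ?big_nil //= big_cons -IH. Qed.

Variable Rn : nat -> dpoly R.
Hypothesis hRn : GelfandDickii Rn.

Let r k x i := deval x (iter k (@dder R) (Rn i)).

(* Coefficient of [lambda ^- n] in
   [lambda b ^ 2 + b' ^ 2 / 4 - b b'' / 2 - u b ^ 2], [b = sum R_i lambda ^- i]. *)
Definition gdquad n : dpoly R :=
  DAdd (dsum [seq DMul (Rn i) (Rn (n.+1 - i)) | i <- index_iota 0 n.+2])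
  (dsum [seq DAdd (DMul (DConst (4^-1)) (DMul (dder (Rn i)) (dder (Rn (n - i)))))
        (DAdd (DMul (DConst (- 2^-1)) (DMul (Rn i) (dder (dder (Rn (n - i))))))
              (DMul (DConst (-1)) (DMul (DVar R 0) (DMul (Rn i) (Rn (n - i))))))
     | i <- index_iota 0 n.+1]).

Lemma devalD x p q : deval x (DAdd p q) = deval x p + deval x q.
Proof. by []. Qed.

Lemma deval_dderD x p q :
  deval x (dder (DAdd p q)) = deval x (dder p) + deval x (dder q).
Proof. by []. Qed.

Lemma deval_gdquad n x : deval x (gdquad n) =
  conv (r 0 x) (r 0 x) n.+1 + 4^-1 * conv (r 1 x) (r 1 x) n
  - 2^-1 * conv (r 0 x) (r 2 x) n - x 0%N * conv (r 0 x) (r 0 x) n.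
Proof.
rewrite /gdquad devalD !deval_dsum !big_map !big_mkord -!addrA; congr (_ + _).
rewrite -mulNr -[- (x 0%N * _)]mulNr /conv !mulr_sumr -!big_split /=.
apply: eq_bigr => i _; rewrite /r /=; ring.
Qed.

Lemma gd_rec n x : r 1 x n.+1 = 4^-1 * r 3 x n + x 0%N * r 1 x n + 2^-1 * x 1%N * r 0 x n.
Proof. by case: hRn => _ /(_ n x) /= E _; rewrite /r /= E /= addrA. Qed.

Lemma gd_0 x : r 0 x 0%N = 2^-1.
Proof. by case: hRn => /(_ x) E _ _; rewrite /r /= E. Qed.

Lemma gd_1 x : r 1 x 0%N = 0.
Proof. by case: hRn => /deq_dder/(_ x) E _ _; rewrite /r /= E. Qed.

(** In generating form the derivative is [2 b (lambda b' - b''' / 4 - u b' - u' b / 2)], and the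
    bracket vanishes by the recursion together with [R_0' = 0]. *)
Lemma dder_gdquad n : deq (dder (gdquad n)) (DConst 0).
Proof.
move=> x; rewrite /gdquad deval_dderD !deval_dder_dsum !big_map !big_mkord /=.
have -> : \sum_(i < n.+2) (r 1 x i * r 0 x (n.+1 - i)%N + r 0 x i * r 1 x (n.+1 - i)%N) =
    2 * conv (r 0 x) (r 1 x) n.+1.
  by rewrite big_split /= -/(conv _ _ _) -/(conv _ _ _) convC; ring.
have -> : conv (r 0 x) (r 1 x) n.+1 =
    4^-1 * conv (r 0 x) (r 3 x) n + x 0%N * conv (r 0 x) (r 1 x) n
    + 2^-1 * x 1%N * conv (r 0 x) (r 0 x) n.
  rewrite {1}/conv big_ord_recr /= subnn gd_1 mulr0 addr0.
  rewrite /conv !mulr_sumr -!big_split /=; apply: eq_bigr => i _.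
  by rewrite subSn -1?ltnS // gd_rec; ring.
set S := \sum_(i < n.+1) _.
have -> : S = 4^-1 * conv (r 2 x) (r 1 x) n + 4^-1 * conv (r 1 x) (r 2 x) n
   + - 2^-1 * conv (r 1 x) (r 2 x) n + - 2^-1 * conv (r 0 x) (r 3 x) n
   + - x 1%N * conv (r 0 x) (r 0 x) n + - x 0%N * conv (r 1 x) (r 0 x) n
   + - x 0%N * conv (r 0 x) (r 1 x) n.
  rewrite /S /conv !mulr_sumr -!big_split /=; apply: eq_bigr => i _; rewrite /r /=; ring.
rewrite [conv (r 2 x) _ _]convC [conv (r 1 x) (r 0 x) _]convC. field; rewrite ?pnatr_eq0 //=.
Qed.

(** A constant differential polynomial may be evaluated at [u = 0]: derivatives vanish there, and a
    product of two potentials of positive total index contains a factor that vanishes. *)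
Lemma gd_identity n x :
  conv (r 0 x) (r 0 x) n.+1 + 4^-1 * conv (r 1 x) (r 1 x) n
  - 2^-1 * conv (r 0 x) (r 2 x) n - x 0%N * conv (r 0 x) (r 0 x) n = 0.
Proof.
rewrite -deval_gdquad (dder0_const x (dder_gdquad n)) deval_gdquad mul0r subr0.
have [_ _ R0] := hRn.
have d k i : r k.+1 (fun=> 0) i = 0 by rewrite /r iterS deval0_dder.
rewrite /conv !big1 ?mulr0 ?addr0 ?subr0 // => i _; rewrite ?d ?mulr0 ?mul0r //.
case: i => -[|i] /= _; first by rewrite /r /= R0 mulr0.
by rewrite /r /= R0 mul0r.
Qed.
End DPoly.

(** * Differential polynomials evaluated on functions of the times *)

Section TimeCalculus.
Variable R : realType.
Local Notation C := (Cplx R).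
Implicit Types (f g v u : times R -> C) (t : times R) (p : dpoly R) (D : set (times R)).

Lemma is_pdE n f t (d : C) : is_pd n f t d -> pd n f t = d.
Proof. by move=> H; rewrite /pd derive1E; exact: (@derive_val _ _ _ _ _ _ _ H). Qed.

Lemma pderivable_is_pd n f t : pderivable n f t -> is_pd n f t (pd n f t).
Proof. by move=> H; rewrite /pd derive1E; exact: DeriveDef. Qed.

Lemma is_pd_pderivable n f t (d : C) : is_pd n f t d -> pderivable n f t.
Proof. by case. Qed.

Lemma is_pd_cst n (c : C) t : is_pd n (fun=> c) t 0.
Proof. exact: is_derive_cst. Qed.

Lemma is_pdD n f g t (d e : C) : is_pd n f t d -> is_pd n g t e ->
  is_pd n (fun s => f s + g s) t (d + e).
Proof. by move=> H K; exact: (is_deriveD H K). Qed.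

Lemma is_pdM n f g t (d e : C) : is_pd n f t d -> is_pd n g t e ->
  is_pd n (fun s => f s * g s) t (d * g t + f t * e).
Proof.
move=> H K; have := is_deriveM H K; rewrite !set_timeK => L.
apply: (is_derive_eq L); rewrite /GRing.scale /=; ring.
Qed.

Lemma is_pdZ n (c : C) f t (d : C) : is_pd n f t d -> is_pd n (fun s => c * f s) t (c * d).
Proof.
by move=> H; have := is_pdM (is_pd_cst n c t) H; rewrite mul0r add0r.
Qed.

Lemma is_pd_eq n D f g t (d : C) : open_in_times D -> D t -> (forall s, D s -> f s = g s) ->
  is_pd n f t d -> is_pd n g t d.
Proof.
move=> oD Dt fg /is_pd_cvg H; apply/is_pd_cvg/cvg_nrmP => e e0.
move/cvg_nrmP: H => /(_ e e0) H; apply: filterS2 H (dnbhs_open n oD Dt) => h H1 Dh.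
by rewrite -!fg.
Qed.

Lemma is_pd_dsubst D v p t : open_in_times D -> smooth_t1 D v -> D t ->
  is_pd 0 (dsubst p v) t (dsubst (dder p) v t).
Proof.
move=> oD sv Dt; elim: p => [c|k|p IHp q IHq|p IHp q IHq].
- exact: is_pd_cst.
- by apply: pderivable_is_pd; exact: sv.
- exact: is_pdD IHp IHq.
- exact: is_pdM IHp IHq.
Qed.

(** The Miura expression as a differential polynomial in [v], so that smoothness of [v] in [t_1]
    passes to [u] and all its derivatives. *)
Definition dmiura : dpoly R :=
  DAdd (DVar R 1) (DMul (DConst (-1)) (DMul (DVar R 0) (DVar R 0))).

Lemma iter_miura D v k t : open_in_times D -> smooth_t1 D v -> D t ->
  iter k (pd 0) (miura v) t = dsubst (iter k (@dder R) dmiura) v t.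
Proof.
move=> oD sv; elim: k t => [|k IH] t Dt.
  by rewrite /dsubst /= /miura expr2 mulN1r.
rewrite !iterS; apply: is_pdE.
apply: (is_pd_eq oD Dt (fun s Ds => esym (IH s Ds))); exact: (is_pd_dsubst _ oD sv Dt).
Qed.

Lemma smooth_miura D v : open_in_times D -> smooth_t1 D v -> smooth_t1 D (miura v).
Proof.
move=> oD sv k t Dt; apply: (@is_pd_pderivable _ _ _ (dsubst (iter k.+1 (@dder R) dmiura) v t)).
apply: (is_pd_eq oD Dt (fun s Ds => esym (iter_miura k oD sv Ds))); exact: (is_pd_dsubst _ oD sv Dt).
Qed.

Lemma pd_miura_dsubst D v p t : open_in_times D -> smooth_t1 D v -> D t ->
  is_pd 0 (dsubst p (miura v)) t (dsubst (dder p) (miura v) t).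
Proof. by move=> oD sv Dt; apply: (is_pd_dsubst p oD _ Dt); exact: smooth_miura. Qed.

(** Separates the highest coefficient, which occurs linearly with factor [2 f 0], from the lower
    ones; this makes a quadratic relation a recursion. *)
Lemma conv_ends (f : nat -> C) n :
  conv f f n.+1 = 2 * (f 0%N * f n.+1) + \sum_(i < n) f i.+1 * f (n - i)%N.
Proof.
rewrite /conv big_ord_recl big_ord_recr /= /bump /= subn0.
rewrite add1n subSS subnn.
under eq_bigr do rewrite /bump /= add1n subSS.
rewrite mulr_natl mulr2n addrA -addrA [_ + f _ * f _]addrC addrA [f n.+1 * _]mulrC; congr (_ + _).
Qed.

Lemma eq_conv (f1 f2 g1 g2 : nat -> C) n : (forall i, (i <= n)%N -> f1 i = f2 i) ->
  (forall i, (i <= n)%N -> g1 i = g2 i) -> conv f1 g1 n = conv f2 g2 n.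
Proof.
move=> Ef Eg; apply: eq_bigr => i _; rewrite Ef ?Eg ?leq_subr //.
by rewrite -ltnS.
Qed.

Lemma convDl (f1 f2 g : nat -> C) n : conv (fun i => f1 i + f2 i) g n = conv f1 g n + conv f2 g n.
Proof. by rewrite /conv -big_split; apply: eq_bigr => i _; rewrite mulrDl. Qed.

Lemma convZl c (f g : nat -> C) n : conv (fun i => c * f i) g n = c * conv f g n.
Proof. by rewrite /conv mulr_sumr; apply: eq_bigr => i _; rewrite mulrA. Qed.

Lemma convDr (f g1 g2 : nat -> C) n : conv f (fun i => g1 i + g2 i) n = conv f g1 n + conv f g2 n.
Proof. by rewrite convC convDl convC [conv g2 _ _]convC. Qed.

Lemma convZr c (f g : nat -> C) n : conv f (fun i => c * g i) n = c * conv f g n.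
Proof. by rewrite convC convZl convC. Qed.

Variable Rn : nat -> dpoly R.
Hypothesis hRn : GelfandDickii Rn.

(* [lambda B ^ 2 + A ^ 2 + B A' = lambda] together with [B' = - 2 v B - 2 A]
   determines the expansion coefficients of [B] recursively; twice the
   Gel'fand-Dickii series satisfies the same recursion. *)
Lemma resolvent_coef D v (A B dA : nat -> times R -> C) :
  open_in_times D -> smooth_t1 D v ->
  (forall t, D t -> B 0%N t = 1) ->
  (forall n t, D t -> is_pd 0 (B n) t (- 2 * v t * B n t - 2 * A n t)) ->
  (forall n t, D t -> is_pd 0 (A n) t (dA n t)) ->
  (forall n t, D t -> conv (B ^~ t) (B ^~ t) n.+1 + conv (A ^~ t) (A ^~ t) n
     + conv (B ^~ t) (dA ^~ t) n = 0) ->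
  forall n t, D t -> B n t = 2 * dsubst (Rn n) (miura v) t /\ A n t = - mkdvS Rn v n t.
Proof.
move=> oD sv B0 Bd Ad quad.
have P0 p t : D t -> is_pd 0 (dsubst p (miura v)) t (dsubst (dder p) (miura v) t).
  exact: pd_miura_dsubst.
have P1 i t : D t -> is_pd 0 (dsubst (Rn i) (miura v)) t (dsubst (dder (Rn i)) (miura v) t).
  exact: P0.
have P2 i t : D t -> is_pd 0 (dsubst (dder (Rn i)) (miura v)) t
   (dsubst (dder (dder (Rn i))) (miura v) t).
  exact: P0.
have Pv t : D t -> is_pd 0 v t (pd 0 v t).
  by move=> Dt; apply: pderivable_is_pd; exact: (sv 0%N).
have SE n t : D t -> mkdvS Rn v n t =
    dsubst (dder (Rn n)) (miura v) t + 2 * v t * dsubst (Rn n) (miura v) t.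
  by move=> Dt; rewrite /mkdvS (is_pdE (P1 n t Dt)).
(* The differential equation for [B n] yields [A n] as soon as [B n] is known on [D]. *)
have SA n : (forall t, D t -> B n t = 2 * dsubst (Rn n) (miura v) t) ->
   forall t, D t -> A n t = - (dsubst (dder (Rn n)) (miura v) t + 2 * v t * dsubst (Rn n) (miura v) t).
  move=> HB t Dt.
  have := is_pdE (is_pd_eq oD Dt HB (Bd n t Dt)).
  rewrite (is_pdE (is_pdZ 2 (P1 n t Dt))) HB // => H.
  have two : (2 : C) != 0 by rewrite pnatr_eq0.
  apply: (mulfI two); rewrite mulrN mulrDr H; ring.
suff HB n t : D t -> B n t = 2 * dsubst (Rn n) (miura v) t.
  by move=> n t Dt; split; [exact: HB|rewrite SE // SA // => s; exact: HB].
elim/ltn_ind: n t => -[|n] IH t Dt.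
  by rewrite B0 // /dsubst (gd_0 hRn) mulfV // pnatr_eq0.
have HB i s : (i <= n)%N -> D s -> B i s = 2 * dsubst (Rn i) (miura v) s by move=> ?; exact: IH.
have HA i s : (i <= n)%N -> D s ->
    A i s = - (dsubst (dder (Rn i)) (miura v) s + 2 * v s * dsubst (Rn i) (miura v) s).
  by move=> le_i; apply: SA => s'; exact: HB.
have HdA i : (i <= n)%N -> dA i t = - (dsubst (dder (dder (Rn i))) (miura v) t
    + 2 * (pd 0 v t * dsubst (Rn i) (miura v) t + v t * dsubst (dder (Rn i)) (miura v) t)).
  move=> le_i; have := is_pdE (is_pd_eq oD Dt (fun s Ds => HA i s le_i Ds) (Ad i t Dt)).
  rewrite -(is_pdE (Ad i t Dt)).
  have H1 := is_pdD (P2 i t Dt) (is_pdZ 2 (is_pdM (Pv t Dt) (P1 i t Dt))).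
  have H2 := is_pdZ (-1) H1.
  rewrite mulN1r in H2; move=> <-; apply: is_pdE; apply: (is_pd_eq oD Dt _ H2) => s Ds.
  by rewrite mulN1r mulrA.
pose x k := iter k (pd 0) (miura v) t.
have := gd_identity hRn n x.
pose r0 i := dsubst (Rn i) (miura v) t.
pose r1 i := dsubst (dder (Rn i)) (miura v) t.
pose r2 i := dsubst (dder (dder (Rn i))) (miura v) t.
have E0 : (fun i => deval x (iter 0 (@dder R) (Rn i))) = r0 by [].
have E1 : (fun i => deval x (iter 1 (@dder R) (Rn i))) = r1 by [].
have E2 : (fun i => deval x (iter 2 (@dder R) (Rn i))) = r2 by [].
rewrite E0 E1 E2 -[x 0%N]/(pd 0 v t - v t ^+ 2) => gd {E0 E1 E2}.
(* With [B = 2 b] and [A = - (b' + 2 v b)], the terms in [v b b'] cancel, [v' - v ^ 2] recombines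
   into [u], and the relation becomes 4 times [gd_identity]. *)
have := quad n t Dt.
have -> : conv (A ^~ t) (A ^~ t) n =
    conv (fun i => - 1 * r1 i + (- 2 * v t) * r0 i) (fun i => - 1 * r1 i + (- 2 * v t) * r0 i) n.
  by apply: eq_conv => i le_i; rewrite HA // /r0 /r1; ring.
have -> : conv (B ^~ t) (dA ^~ t) n = conv (fun i => 2 * r0 i)
    (fun i => - 1 * r2 i + (- 2 * pd 0 v t * r0 i + (- 2 * v t) * r1 i)) n.
  by apply: eq_conv => i le_i; rewrite ?HB ?HdA // /r0 /r1 /r2; ring.
rewrite !(convDl, convDr, convZl, convZr) [conv r1 r0 n]convC => q.
have {gd q} : conv (B ^~ t) (B ^~ t) n.+1 = 4 * conv r0 r0 n.+1.
  have two : (2 : C) != 0 by rewrite pnatr_eq0.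
  have four : (4 : C) != 0 by rewrite pnatr_eq0.
  move: (conv _ _ n.+1) (conv r0 r0 n.+1) (conv r0 r0 n) (conv r0 r1 n) (conv r1 r1 n)
    (conv r0 r2 n) gd q => X Y p00 p01 p11 p02 gd q.
  have : 4 * (Y + 4^-1 * p11 - 2^-1 * p02 - (pd 0 v t - v t ^+ 2) * p00) = 0 by rewrite gd mulr0.
  move: (pd 0 v t) (v t) q => dv vv q H4.
  move: q; set Q := (Q in Q = 0 -> _); move=> Q0; apply/eqP; rewrite -subr_eq0.
  have -> : X - 4 * Y = Q - 4 * (Y + 4^-1 * p11 - 2^-1 * p02 - (dv - vv ^+ 2) * p00) by rewrite /Q; field.
  by rewrite Q0 H4 subrr.
rewrite !conv_ends B0 // /r0.
have -> : dsubst (Rn 0%N) (miura v) t = 2^-1 by rewrite /dsubst (gd_0 hRn).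
have -> : \sum_(i < n) B i.+1 t * B (n - i)%N t =
    4 * \sum_(i < n) r0 i.+1 * r0 (n - i)%N.
  rewrite mulr_sumr; apply: eq_bigr => i _; rewrite !HB ?leq_subr //; first by rewrite /r0; ring.
have two : (2 : C) != 0 by rewrite pnatr_eq0.
rewrite [X in _ = X]mulrDr => /addIr.
rewrite mul1r => H; apply: (mulfI two); rewrite H; field; rewrite ?pnatr_eq0 //=.
Qed.
End TimeCalculus.

(** * The factorization *)

Section Factorization.
Variable R : realType.
Local Notation C := (Cplx R).
Local Notation M2 := 'M[C]_2.
Implicit Types (t : times R) (l : C) (D : set (times R)).

Lemma cder_near (F G : R -> C) (x : R) d : (\forall h \near (0 : R)^', F (x + h) = G (x + h)) ->
  F x = G x -> cder F x d -> cder G x d.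
Proof.
move=> FG Fx /cder_cvg/cvg_nrmP H; apply: cder_of_cvg; apply/cvg_nrmP => e e0.
by apply: filterS2 FG (H e e0) => h E; rewrite E Fx.
Qed.

Lemma near_set_time n t D : open_in_times D -> D t ->
  \forall s \near (0 : R)^', D (set_time t n (t n + rc s)).
Proof.
move=> oD Dt; have := dnbhs_open n oD Dt.
rewrite /dnbhs /within /= => /nbhs_ballP[r /= /gt0_rc[-> r0] Hr].
apply/nbhs_ballP; exists (re r) => //= s; rewrite /ball /= sub0r normrN => sr s0.
apply: Hr; first by rewrite /ball_ /= sub0r normrN normE rc_lt nrm_rc.
by rewrite -rc0 (inj_eq (@rc_inj R)).
Qed.

Lemma cvg_lincomb (c : C) (u v : nat -> C) (x y : C) : u @ \oo --> x -> v @ \oo --> y ->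
  (fun n => u n + c * v n) @ \oo --> x + c * y.
Proof. by move=> ux vy; apply: cvgD ux _; exact: cvg_mull_cst. Qed.

(** Only the term of index [n] changes, so the partial sums differ by [z * l ^ n] from rank [n + 1]
    on. *)
Lemma loop_series_set_time t n (z : C) l : smooth_series t -> circle l ->
  loop_series (set_time t n (t n + z)) l = loop_series t l + z * l ^+ n.
Proof.
move=> st cl; have H := loop_series_cvg st cl.
suff : series (fun k => set_time t n (t n + z) k * l ^+ k) @ \oo --> loop_series t l + z * l ^+ n.
  by move=> H1; exact: (@cvg_lim _ (@norm_hausdorff _ C) _ _ _ _ _ H1).
have H2 : (fun N => if (n < N)%N then z * l ^+ n else 0) @ \oo --> z * l ^+ n.
  apply/cvg_nrmP => e e0; exists n.+1 => // N /= nN.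
  by rewrite nN subrr nrm0.
apply: eqf_cvg (cvgD H H2) => N.
rewrite -[LHS]/(series (fun k => t k * l ^+ k) N + (if (n < N)%N then z * l ^+ n else 0)) !seriesE.
elim: N => [|N IH]; first by rewrite !big_ord0 addr0.
rewrite !big_ord_recr /= -IH /set_time ltnS leq_eqVlt.
have [->|nN] := eqVneq n N; first by rewrite /= ltnn addr0 mulrDl addrA.
by rewrite /= addrAC.
Qed.

Lemma commJ_mexp (a : C) l : circle l ->
  mexp (a *: matJ l) * matJ l = matJ l * mexp (a *: matJ l).
Proof.
move=> /circleP[x _ ->].
have E : cis x = cis (2^-1 * x) ^+ 2 :> C.
  by rewrite expr2 -cisD; congr cis; field.
have K0 := cis_neq0 (2^-1 * x).
rewrite mexp_cis !E matJE /exJ; move: (cis _) K0 => kap K0.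
move: (cexp _) (cexp _) => p q.
have two : (2 : C) != 0 by rewrite pnatr_eq0.
by apply: mx2_ext; rewrite !mxE2; field.
Qed.

Variables (g : C -> M2) (D : set (times R)) (psim psip : times R -> C -> M2)
  (dpsip : nat -> times R -> C -> M2).
Hypothesis fac : factorization g D (@BmSL R) (@BpSL R) psim psip dpsip.

Let oD : open_in_times D. Proof. by case: fac. Qed.
Let st t : D t -> smooth_series t. Proof. by case: fac => _ H _ _ _; exact: H. Qed.

Let psi_eq t l : D t -> circle l -> psi g t l = (psim t l)^-1 * psip t l.
Proof. by case: fac => _ _ _ H _; exact: H. Qed.

Let smm t : D t -> smooth_loop (psim t).
Proof. by case: fac => _ _ H _ _ /H[[[]]]. Qed.

Let smp t : D t -> smooth_loop (psip t).
Proof. by case: fac => _ _ H _ _ /H[_ [[]]]. Qed.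

Let detm t l : D t -> circle l -> \det (psim t l) = 1.
Proof. by case: fac => _ _ H _ _ /H[[[_ d] _] _]; exact: d. Qed.

Let detp t l : D t -> circle l -> \det (psip t l) = 1.
Proof. by case: fac => _ _ H _ _ /H[_ [[_ d] _]]; exact: d. Qed.

Lemma psim_Out t i j : D t -> Out (fun l => psim t l i j).
Proof. by case: fac => _ _ H _ _ /H[[_ [A /extends_out_Out H1 _]] _]; have [] := H1 i j. Qed.

Lemma psip_In t i j : D t -> In (fun l => psip t l i j).
Proof. by case: fac => _ _ H _ _ /H[_ [_ [A /extends_in_In H1 _]]]; have [] := H1 i j. Qed.

Lemma psim01 t : D t -> mean (fun l => psim t l 0 1) = 0.
Proof.
by case: fac => _ _ H _ _ /H[[_ [A /extends_out_Out H1 lA]] _]; have [_ ->] := H1 0 1.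
Qed.

Lemma psip10 t : D t -> mean (fun l => psip t l 1 0) = 0.
Proof.
by case: fac => _ _ H _ _ /H[_ [_ [A /extends_in_In H1 lA]]]; have [_ ->] := H1 1 0.
Qed.

Definition conjJ t l : M2 := psim t l * matJ l * (psim t l)^-1.

(** Differentiation runs along real increments at fixed [lambda]; the product of the exponential and
    [g] is then eliminated as [psi_-^-1 psi_+]. *)
Lemma psip_time n t l Y : D t -> circle l -> is_loop_pd n psim t Y ->
  dpsip n t l * (psip t l)^-1 = Y l * (psim t l)^-1 + l ^+ n *: conjJ t l.
Proof.
move=> Dt cl HY; have [x _ lx] := circleP cl.
pose T (s : R) := set_time t n (t n + rc s).
have T0 : T 0 = t by rewrite /T rc0 addr0 set_timeK.
have Hp : mder (fun s => psip (T s) l) 0 (dpsip n t l).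
  move=> i j; have [_ _ _ _ /(_ n t Dt)[H _]] := fac.
  exact: (uld_cder (is_loop_pd_uld i j H) cl).
have Hm : mder (fun s => psim (T s) l) 0 (Y l).
  by move=> i j; exact: (uld_cder (is_loop_pd_uld i j HY) cl).
have HA : cder (fun s : R => loop_series t l + rc s * l ^+ n) 0 (l ^+ n).
  apply: (cder_eq (cderD (cder_cst _ _) (cderl (l ^+ n) 0))); exact: add0r.
have := mexp_time x HA; rewrite -lx rc0 mul0r addr0 => HE.
have Hg := mder_cst (g l) (0 : R).
have Hpsi := mderM Hm (mderM HE Hg).
have E s : D (T s) -> psip (T s) l =
    psim (T s) l * (mexp ((loop_series t l + rc s * l ^+ n) *: matJ l) * g l).
  move=> Ds; have := psi_eq Ds cl; rewrite /psi loop_series_set_time //; last exact: st.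
  by move=> ->; rewrite mulrA divrr ?mul1r //; apply: det1_unit; exact: detm.
have Hp2 : mder (fun s => psip (T s) l) 0
   (Y l * (mexp (loop_series t l *: matJ l) * g l) +
    psim t l * (l ^+ n *: matJ l * mexp (loop_series t l *: matJ l) * g l)).
  move=> i j; apply: (@cder_near _ _ 0 _ _ _ (cder_eq (Hpsi i j) _)).
  - have := near_set_time n oD Dt; apply: filterS => s Ds.
    by rewrite add0r -E.
  - by rewrite -E // T0.
  - by rewrite T0 rc0 mul0r !addr0 mulr0 addr0.
rewrite (mder_unique Hp Hp2).
have up : psip t l \is a GRing.unit by apply: det1_unit; exact: detp.
have P : mexp (loop_series t l *: matJ l) * g l = (psim t l)^-1 * psip t l.
  exact: psi_eq.
rewrite -[_ *: _ * _ * g l]mulrA P /conjJ mulrDl -!scalerAl -!scalerAr; congr (_ + _).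
  by rewrite -!mulrA divrr ?mulr1.
by rewrite -scalerAl -!mulrA divrr ?mulr1.
Qed.

Lemma mder_loop (f : C -> M2) (x : R) : smooth_loop f ->
  mder (fun y => f (cis y)) x ((ci * cis x) *: circle_deriv f (cis x)).
Proof. by move=> sf i j; rewrite mxE; exact: smooth_cder. Qed.

(** A formal product rule: commutation with [H] is a derivation, and the commutator in the
    derivative of [E] cancels its share of it. *)
Lemma delta_prod (s s0 q : C) (LP LM LG m E G J H : M2) :
  LP = LM * (E * G) + m * ((s0 *: (J * E) - q *: (H * E - E * H)) * G + E * LG) ->
  s *: (LP + q *: (H * (m * (E * G)) - m * (E * G) * H)) =
  s *: (LM + q *: (H * m - m * H)) * (E * G) + (s * s0) *: (m * J * (E * G))
  + m * E * (s *: (LG + q *: (H * G - G * H))).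
Proof.
have -> : H * (m * (E * G)) - m * (E * G) * H =
   (H * m - m * H) * (E * G) + m * ((H * E - E * H) * G) + m * E * (H * G - G * H).
  by rewrite !(mulrBl, mulrBr, mulrA) !subrKA.
move: (H * m - m * H) (H * E - E * H) (H * G - G * H) => c1 c2 c3 ->.
rewrite -!scalerAl -!scalerAr !(mulrDl, mulrDr, mulNr, mulrN) -!scalerAl -!scalerAr !mulrA.
move: (LM * E * G) (m * J * E * G) (m * c2 * G) (m * E * LG) (c1 * E * G) (m * E * c3).
by move=> x1 x2 x3 x4 x5 x6; apply/matrixP => i j; rewrite !mxE; ring.
Qed.

(** Division by [c = i] turns the derivative in the angle into [lambda d/dlambda]. *)
Lemma angle_quot (c l T T1 : C) (P M G m E g' J H : M2) : c != 0 ->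
  (c * l) *: P = (c * l) *: M * (E * g') +
    m * (((c * T1 + c * T / 2) *: J * E - (c / 4) *: (H * E - E * H)) * g'
      + E * ((c * l) *: G)) ->
  l *: P = (l *: M) * (E * g') +
    m * (((T1 + T / 2) *: (J * E) - 4^-1 *: (H * E - E * H)) * g' + E * (l *: G)).
Proof.
move=> c0 HD; apply: (scalerI c0); rewrite scalerA HD {HD P}.
rewrite -[c * T / 2]mulrA -mulrDr; move: (T1 + T / 2) => s.
move: (H * E - E * H) => X.
rewrite -!scalerAl -!scalerAr !(mulrDl, mulrDr, mulNr, mulrN) -!scalerAl -!scalerAr !mulrA.
move: (M * E * g') (m * J * E * g') (m * X * g') (m * E * G) => x1 x2 x3 x4.
by apply/matrixP => i j; rewrite !mxE; ring.
Qed.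

Section Diagonal.
Variables (s : C) (f : C -> M2).
Hypothesis sf : smooth_loop f.
Hypothesis df : forall l, circle l -> \det (f l) = 1.

(** [ad H] kills the diagonal and doubles the entry [(0, 1)], so the factor 1/4 becomes 1/2. *)
Let deltaE l : circle l -> (delta s f l * (f l)^-1) 0 0 =
  s * (l * circle_deriv f l 0 0) * f l 1 1
  - s * (l * circle_deriv f l 0 1 + 2^-1 * f l 0 1) * f l 1 0.
Proof.
move=> cl; rewrite inv_det1 ?df // /delta /matH !mxE2.
have two : (2 : C) != 0 by rewrite pnatr_eq0.
by field; rewrite ?pnatr_eq0.
Qed.

(** The mean is multiplicative on both products of [deltaE]; the factors [lambda f'] have mean 0,
    and [f 0 1] vanishes at infinity by lower triangularity. *)
Lemma mean_delta_Out : (forall i j, Out (fun l => f l i j)) -> mean (fun l => f l 0 1) = 0 ->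
  ccont (fun l => (delta s f l * (f l)^-1) 0 0) /\
  mean (fun l => (delta s f l * (f l)^-1) 0 0) = 0.
Proof.
move=> of_ f01.
have [Q00 M00] := deriv_Out sf (of_ 0 0); have [Q01 M01] := deriv_Out sf (of_ 0 1).
have Q0 := OutZ s Q00.
have Q1 := OutZ s (OutD Q01 (OutZ 2^-1 (of_ 0 1))).
have P0 := OutM Q0 (of_ 1 1); have P1 := OutM Q1 (of_ 1 0).
split; first by apply: eq_ccont (OutB P0 P1).1 => l /deltaE.
rewrite (eq_mean deltaE) (meanB P0.1 P1.1) (mean_OutM Q0 (of_ 1 1)) (mean_OutM Q1 (of_ 1 0)).
rewrite (meanZ s Q00.1) (meanZ s (OutD Q01 (OutZ 2^-1 (of_ 0 1))).1).
by rewrite (meanD Q01.1 (OutZ 2^-1 (of_ 0 1)).1) (meanZ _ (of_ 0 1).1) M00 M01 f01; ring.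
Qed.

(** Here the second product of [deltaE] disappears because [f 1 0] vanishes at 0, by upper
    triangularity. *)
Lemma mean_delta_In : (forall i j, In (fun l => f l i j)) -> mean (fun l => f l 1 0) = 0 ->
  ccont (fun l => (delta s f l * (f l)^-1) 0 0) /\
  mean (fun l => (delta s f l * (f l)^-1) 0 0) = 0.
Proof.
move=> inf f10.
have [Q00 M00] := deriv_In sf (inf 0 0); have [Q01 M01] := deriv_In sf (inf 0 1).
have Q0 := InZ s Q00.
have Q1 := InZ s (InD Q01 (InZ 2^-1 (inf 0 1))).
have P0 := InM Q0 (inf 1 1); have P1 := InM Q1 (inf 1 0).
have c0 := In_ccont P0; have c1 := In_ccont P1; have c00 := In_ccont Q00.
split; first by apply: eq_ccont (ccontB c0 c1) => l /deltaE.
rewrite (eq_mean deltaE) (meanB c0 c1) (mean_InM Q0 (inf 1 1)) (mean_InM Q1 (inf 1 0)).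
by rewrite (meanZ s c00) M00 f10; ring.
Qed.
End Diagonal.

(* The entries of [conjJ] without inverses, using [det psi_- = 1]. *)
Definition resa t l : C := l * psim t l 0 1 * psim t l 1 1 - psim t l 0 0 * psim t l 1 0.
Definition resb t l : C := psim t l 0 0 * psim t l 0 0 - l * psim t l 0 1 * psim t l 0 1.
Definition resc t l : C := l * (psim t l 1 1 * psim t l 1 1) - psim t l 1 0 * psim t l 1 0.

Lemma conjJE t l : D t -> circle l ->
  conjJ t l = mx22 (resa t l) (resb t l) (resc t l) (- resa t l).
Proof.
move=> Dt cl; rewrite /conjJ matJE inv_det1 ?detm // /resa /resb /resc.
by apply: mx2_ext; rewrite !mxE2; ring.
Qed.

(** [J] has a pole at infinity; lower triangularity of [psi_-] there cancels it in [resa] and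
    [resb]. *)
Lemma psim01_Out t : D t -> Out (fun l => l * psim t l 0 1).
Proof. by move=> Dt; apply: Out_shift; [exact: psim_Out|exact: psim01]. Qed.

Lemma resa_Out t : D t -> Out (resa t).
Proof.
move=> Dt; apply: OutB; apply: OutM; try exact: psim_Out; exact: psim01_Out.
Qed.

Lemma resb_Out t : D t -> Out (resb t).
Proof.
move=> Dt; apply: OutB; apply: OutM; try exact: psim_Out; exact: psim01_Out.
Qed.

Variables (sigma : C) (theta : nat -> C) (K : C -> M2).
Hypothesis sg : LSL g.
Hypothesis hK : forall l, circle l ->
  delta sigma g l * (g l)^-1 + g l * K l * (g l)^-1 = loop_series theta l *: matJ l.

(** The weight [n + 1/2] is split: the series with [n] is [lambda d/dlambda] of the one in [t], and
    the half is the degree of [J]. *)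
Definition time_loop t l : C :=
  loop_series theta l
  + sigma * (loop_series (fun n => n%:R * t n) l + loop_series t l / 2).

Lemma psip_angle t l : D t -> circle l ->
  delta sigma (psip t) l * (psip t l)^-1 + psip t l * K l * (psip t l)^-1 =
  delta sigma (psim t) l * (psim t l)^-1 + time_loop t l *: conjJ t l.
Proof.
move=> Dt cl; have [x _ lx] := circleP cl.
have HE := mexp_angle (loop_series_cder x (st Dt)).
have Hpsi := mderM (mder_loop x (smm Dt)) (mderM HE (mder_loop x sg.1)).
have PE l' : circle l' -> psip t l' =
    psim t l' * (mexp (loop_series t l' *: matJ l') * g l').
  move=> cl'; have := psi_eq Dt cl'; rewrite /psi => ->.
  by rewrite mulrA divrr ?mul1r //; apply: det1_unit; exact: detm.
have Hp := mder_loop x (smp Dt).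
have EQ : (fun y => psip t (cis y)) = (fun y => psim t (cis y) *
    (mexp (loop_series t (cis y) *: matJ (cis y)) * g (cis y))).
  by apply/funext => y; exact: PE (circle_cis y).
rewrite EQ in Hp; have {Hpsi Hp HE EQ} := mder_unique Hp Hpsi; rewrite -lx => HD.
have two : (2 : C) != 0 by rewrite pnatr_eq0.
have ci0 : (ci : C) != 0 by rewrite -nrm_eq0 nrm_ci oner_eq0.
move: HD (PE l cl) (commJ_mexp (loop_series t l) cl).
set E := mexp _; set T := loop_series t l; set T1 := loop_series _ l => HD Pl EJ.
have LP : l *: circle_deriv (psip t) l = (l *: circle_deriv (psim t) l) * (E * g l) +
   psim t l * (((T1 + T / 2) *: (matJ l * E) - 4^-1 *: (matH * E - E * matH)) * g l
     + E * (l *: circle_deriv g l)).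
  exact: (angle_quot ci0 HD).
have HP := delta_prod sigma LP.
have {}HP : delta sigma (psip t) l = delta sigma (psim t) l * (E * g l)
   + (sigma * (T1 + T / 2)) *: (psim t l * matJ l * (E * g l)) + psim t l * E * delta sigma g l.
  by rewrite /delta -HP -Pl.
have ug : g l \is a GRing.unit by apply: det1_unit; exact: sg.2.
have um : psim t l \is a GRing.unit by apply: det1_unit; exact: detm.
have up : psip t l \is a GRing.unit by apply: det1_unit; exact: detp.
have G : delta sigma g l + g l * K l = (loop_series theta l *: matJ l) * g l.
  by rewrite -hK // mulrDl !divrK.
apply: (mulIr up); rewrite !mulrDl !divrK //.
have mp : (psim t l)^-1 * psip t l = E * g l by rewrite Pl mulKr.
have X : conjJ t l * psip t l = psim t l * matJ l * (E * g l) by rewrite /conjJ -mulrA mp.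
have Y : delta sigma (psim t) l / psim t l * psip t l = delta sigma (psim t) l * (E * g l).
  by rewrite -mulrA mp.
(* The hypothesis on [g] converts [delta g + g K] into [theta J g], and [J] moves to the left of the
   exponential, which commutes with it. *)
have Z : psim t l * E * delta sigma g l + psip t l * K l =
    loop_series theta l *: (psim t l * matJ l * (E * g l)).
  rewrite {1}Pl -!mulrA -!mulrDr G -scalerAl -!scalerAr.
  by rewrite [E * (matJ l * _)]mulrA EJ -!mulrA.
by rewrite -[time_loop t l *: conjJ t l * _]scalerAl X Y HP -!addrA Z /time_loop scalerDl [_ *: _ + _ *: _]addrC.
Qed.

Hypothesis KIn : forall i j, In (fun l => K l i j).
Hypothesis K10 : mean (fun l => K l 1 0) = 0.

(** At 0 both [psi_+] and [K] are upper triangular, so the [(0, 0)] entry of [psi_+ K psi_+^-1] is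
    there [p_00 K_00 p_11], and the determinant gives [p_00 p_11 = 1]. The two [delta] terms have
    mean 0. *)
Lemma mean_time_loop t : D t ->
  mean (fun l => time_loop t l * resa t l) = mean (fun l => K l 0 0).
Proof.
move=> Dt; have pIn i j := psip_In i j Dt.
have [cp mp] := mean_delta_In sigma (smp Dt) (fun l cl => detp Dt cl) pIn (psip10 Dt).
have [cm mm] := mean_delta_Out sigma (smm Dt) (fun l cl => detm Dt cl)
  (fun i j => psim_Out i j Dt) (psim01 Dt).
pose r0 l := psip t l 0 0 * K l 0 0 + psip t l 0 1 * K l 1 0.
pose r1 l := psip t l 0 0 * K l 0 1 + psip t l 0 1 * K l 1 1.
have I0 : In r0 by apply: InD; exact: InM.
have I1 : In r1 by apply: InD; exact: InM.
have c0 := In_ccont (InM I0 (pIn 1 1)); have c1 := In_ccont (InM I1 (pIn 1 0)).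
have c2 := ccontB c0 c1.
pose kk l := r0 l * psip t l 1 1 - r1 l * psip t l 1 0.
have E l : circle l -> time_loop t l * resa t l =
    (delta sigma (psip t) l * (psip t l)^-1) 0 0 + kk l
    - (delta sigma (psim t) l * (psim t l)^-1) 0 0.
  move=> cl; have /(congr1 (fun A : M2 => A 0 0)) := psip_angle Dt cl.
  rewrite !addE2 scaleE2 conjJE // mx22_00 => H.
  apply/eqP; rewrite eq_sym subr_eq [X in _ == X]addrC -H; apply/eqP; congr (_ + _).
  by rewrite inv_det1 ?detp // /kk /r0 /r1 !mxE2; ring.
have D1 : mean (fun l => psip t l 0 0) * mean (fun l => psip t l 1 1) = 1.
  have i0 := In_ccont (InM (pIn 0 0) (pIn 1 1)); have i1 := In_ccont (InM (pIn 0 1) (pIn 1 0)).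
  transitivity (mean (fun l => psip t l 0 0 * psip t l 1 1 - psip t l 0 1 * psip t l 1 0)).
    by rewrite (meanB i0 i1) !mean_InM // psip10 // mulr0 subr0.
  by rewrite -[RHS]mean_cst; apply: eq_mean => l cl; exact: det1E (detp Dt cl).
rewrite (eq_mean E) (meanB (ccontD cp c2) cm) (meanD cp c2) mp mm (meanB c0 c1).
rewrite (mean_InM I0 (pIn 1 1)) (mean_InM I1 (pIn 1 0)) psip10 //.
have j0 := InM (pIn 0 0) (KIn 0 0); have j1 := InM (pIn 0 1) (KIn 1 0).
rewrite (meanD (In_ccont j0) (In_ccont j1)) !mean_InM // K10.
by rewrite !mulr0 !addr0 add0r !subr0 mulrAC D1 mul1r.
Qed.

(** The mean is taken termwise by [mean_loop_series]; the two series are kept apart, as in [is_X]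
    and [string_sum]. *)
Lemma series_resa t : smooth_series theta -> D t -> exists S1 S2 : C,
  [/\ series (fun n => theta n * coef (resa t) n) @ \oo --> S1,
      series (fun n => (n%:R + 2^-1) * t n * coef (resa t) n) @ \oo --> S2
    & S1 + sigma * S2 = mean (fun l => K l 0 0)].
Proof.
move=> sth Dt; have ca := (resa_Out Dt).1.
have h0 := mean_loop_series sth ca.
have h1 := mean_loop_series (smooth_seriesM (st Dt)) ca.
have h2 := mean_loop_series (st Dt) ca.
have k0 := loop_series_ccont sth; have k1 := loop_series_ccont (smooth_seriesM (st Dt)).
have k2 := loop_series_ccont (st Dt).
set m0 := mean _ in h0; set m1 := mean _ in h1; set m2 := mean _ in h2.
exists m0, (m1 + 2^-1 * m2); split; first exact: h0.
- have h3 := cvg_lincomb (c := 2^-1) h1 h2.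
  apply: (eqf_cvg _ h3) => N.
  rewrite !seriesE mulr_sumr -big_split /=.
  by apply: eq_bigr => i _; ring.
rewrite -(mean_time_loop Dt) /m0 /m1 /m2 -(meanZ 2^-1); last by cc.
have c1 : ccont (fun l => loop_series (fun n => n%:R * t n) l * resa t l) by cc.
have c2 : ccont (fun l => 2^-1 * (loop_series t l * resa t l)) by cc.
have c3 : ccont (fun l => loop_series theta l * resa t l) by cc.
rewrite -(meanD c1 c2) -meanZ; last by cc.
have c4 := ccontD c1 c2; have c5 := ccontM (ccont_cst sigma) c4.
rewrite -(meanD c3 c5).
by apply: eq_mean => l _; rewrite /time_loop; ring.
Qed.

End Factorization.

(** * The string equation *)

Section Reduction.
Variable R : realType.
Local Notation C := (Cplx R).
Local Notation M2 := 'M[C]_2.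
Implicit Types (t : times R) (l : C) (D : set (times R)) (v w : times R -> C).

Lemma eq_uld (f f' : times R -> C -> C) n t (y y' : C -> C) :
  (forall s l, circle l -> f s l = f' s l) -> (forall l, circle l -> y l = y' l) ->
  uld f n t y -> uld f' n t y'.
Proof.
move=> ff yy H e e0; apply: filterS (H e e0) => h Hh l cl.
by rewrite -!ff // -yy // Hh.
Qed.

Lemma is_pd_cder n (f : times R -> C) t (d : C) : is_pd n f t d ->
  cder (fun s : R => f (set_time t n (t n + rc s))) 0 d.
Proof.
move=> /is_pd_cvg/cvg_nrmP H.
have c1 : circle (1 : C) by rewrite -cis0; exact: circle_cis.
apply: (@uld_cder _ (fun s _ => f s) n t (fun=> d) 1 _ c1) => e e0.
by apply: filterS (H e e0) => h Hh l _; rewrite nrmB ltW.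
Qed.

Lemma cvg_uniqueC (u : nat -> C) (x y : C) : u @ \oo --> x -> u @ \oo --> y -> x = y.
Proof. exact: cvg_unique. Qed.

Lemma mkdvS_termE Rn (A : nat -> C) v t : (forall n, A n = - mkdvS Rn v n t) ->
  forall n, pd 0 (dsubst (Rn n) (miura v)) t =
    - A n - 2 * v t * dsubst (Rn n) (miura v) t.
Proof. by move=> HA n; rewrite HA /mkdvS opprK addrK. Qed.

Lemma is_pd_time n t : is_pd 0 (fun s : times R => s n) t (n == 0%N)%:R.
Proof.
by case: n => [|n]; rewrite /is_pd /set_time /=; [exact: is_derive_id|exact: is_derive_cst].
Qed.

Lemma is_pd_theta_term Rn D theta v n t : open_in_times D -> smooth_t1 D v -> D t ->
  pd 0 (theta_term Rn theta v n) t = theta n * pd 0 (dsubst (Rn n) (miura v)) t.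
Proof.
move=> oD sv Dt; apply/is_pdE/is_pdZ.
by have H := pd_miura_dsubst (Rn n) oD sv Dt; rewrite (is_pdE H).
Qed.

Lemma is_pd_sigma_term Rn D v n t : open_in_times D -> smooth_t1 D v -> D t ->
  pd 0 (sigma_term Rn v n) t = (n%:R + 2^-1) *
    ((n == 0%N)%:R * dsubst (Rn n) (miura v) t + t n * pd 0 (dsubst (Rn n) (miura v)) t).
Proof.
move=> oD sv Dt; have H := pd_miura_dsubst (Rn n) oD sv Dt; rewrite (is_pdE H).
have K := is_pdM (is_pdZ (n%:R + 2^-1) (is_pd_time n t)) H.
by rewrite (is_pdE K) -mulrA -[_ * t n * _]mulrA mulrDr.
Qed.

Lemma combine_limits (x1 x2 x3 x4 y s S1 S2 : C) :
  x1 + 2 * y * x3 = - S1 -> x2 + 2 * y * x4 = - S2 + 4^-1 ->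
  x1 + s * x2 + 2 * y * (x3 + s * x4) = - (S1 + s * S2) + s / 4.
Proof.
move=> E1 E2; have -> : x1 + s * x2 + 2 * y * (x3 + s * x4) =
  (x1 + 2 * y * x3) + s * (x2 + 2 * y * x4) by ring.
by rewrite E1 E2; ring.
Qed.

(** Termwise, [d/dt_1 + 2 v] turns [R_n] into [S_n = - A_n]. The only extra term comes from the
    explicit [t_1] in the summand [n = 0] of [sigma_term]; it equals [1/2 * R_0 = 1/4]. *)
Lemma string_lhsE Rn (hRn : GelfandDickii Rn) D theta sigma v t (A : nat -> C) (S1 S2 : C) :
  open_in_times D -> smooth_t1 D v -> D t ->
  termwise_t1 D (theta_term Rn theta v) -> termwise_t1 D (sigma_term Rn v) ->
  (forall n, A n = - mkdvS Rn v n t) ->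
  series (fun n => theta n * A n) @ \oo --> S1 ->
  series (fun n => (n%:R + 2^-1) * t n * A n) @ \oo --> S2 ->
  string_lhs Rn theta sigma v t = - (S1 + sigma * S2) + sigma / 4.
Proof.
move=> oD sv Dt /(_ t Dt)[cth _ cdth isth] /(_ t Dt)[cs _ cds iss] HA h1 h2.
have PE := mkdvS_termE HA.
have H : is_pd 0 (string_sum Rn theta sigma v) t
    (csum (fun n => pd 0 (theta_term Rn theta v n) t)
     + sigma * csum (fun n => pd 0 (sigma_term Rn v n) t)).
  by apply: is_pdD; [exact: isth|exact: is_pdZ].
rewrite /string_lhs (is_pdE H) /string_sum.
have k1 := cvg_lincomb (c := 2 * v t) cdth cth.
have k2 := cvg_lincomb (c := 2 * v t) cds cs.
have E1 : csum (fun n => pd 0 (theta_term Rn theta v n) t)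
    + 2 * v t * csum (fun n => theta_term Rn theta v n t) = - S1.
  have j1 := cvg_mull_cst (c := -1) h1; rewrite mulN1r in j1.
  apply: (cvg_uniqueC k1); apply: (eqf_cvg _ j1) => N.
  rewrite !seriesE !mulr_sumr -big_split /=; apply: eq_bigr => i _.
  by rewrite (is_pd_theta_term Rn theta i oD sv Dt) PE /theta_term; ring.
have E2 : csum (fun n => pd 0 (sigma_term Rn v n) t)
    + 2 * v t * csum (fun n => sigma_term Rn v n t) = - S2 + 4^-1.
  have j2 := cvg_mull_cst (c := -1) h2; rewrite mulN1r in j2.
  (* Partial sums of the series whose only nonzero term, at index 0, is that extra 1/4. *)
  have j3 : (fun N => if (0 < N)%N then 4^-1 else 0 : C) @ \oo --> (4^-1 : C).
    by apply/cvg_nrmP => e e0; exists 1%N => // -[|N] //= _; rewrite subrr nrm0.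
  have j4 := cvg_lincomb (c := 1) j2 j3; rewrite mul1r in j4.
  apply: (cvg_uniqueC k2); apply: (eqf_cvg _ j4) => N.
  have -> : (if (0 < N)%N then 4^-1 else 0 : C) =
      \sum_(i < N) (i%:R + 2^-1) * ((i == 0%N :> nat)%:R * dsubst (Rn i) (miura v) t).
    case: N => [|N]; first by rewrite big_ord0.
    rewrite big_ord_recl big1 => [|i _]; last by rewrite mul0r mulr0.
    by rewrite /= addr0 /dsubst (gd_0 hRn); field; rewrite ?pnatr_eq0.
  rewrite !seriesE !mulr_sumr -!big_split /=; apply: eq_bigr => i _.
  by rewrite (is_pd_sigma_term Rn i oD sv Dt) PE /sigma_term; ring.
exact: combine_limits E1 E2.
Qed.

Section Hierarchy.
Variables (g : C -> M2) (D : set (times R)) (psim psip : times R -> C -> M2)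
  (dpsip : nat -> times R -> C -> M2).
Hypothesis fac : factorization g D (@BmSL R) (@BpSL R) psim psip dpsip.

Let oD : open_in_times D. Proof. by case: fac. Qed.

Let psim_pd n t : D t -> exists Y, is_loop_pd n psim t Y.
Proof. by case: fac => _ _ _ _ H Dt; have [_] := H n t Dt. Qed.

Let detm t l : D t -> circle l -> \det (psim t l) = 1.
Proof. by case: fac => _ _ H _ _ /H[[[_ d] _] _]; exact: d. Qed.

Let detp t l : D t -> circle l -> \det (psip t l) = 1.
Proof. by case: fac => _ _ H _ _ /H[_ [[_ d] _]]; exact: d. Qed.

(** Let [N = psi_- J psi_-^-1], with entries [a], [b], [c], [- a], and let [L] be the matrix
    prescribed for [t_1]. Then [psi_-' = L psi_- - psi_- J], so [N' = [L, N]], that is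
    [b' = - 2 v b - 2 a] and [a' = c - lambda b]. Eliminating [c] from [a^2 + b c = lambda] gives
    the relation of [resolvent_coef]. *)
Lemma resa_coef_mkdv Rn (hRn : GelfandDickii Rn) v n t : smooth_t1 D v ->
  (forall t, D t -> mean (fun l => psim t l 0 0) = 1) ->
  (forall t l, D t -> circle l -> dpsip 0%N t l * (psip t l)^-1 = mx22 (- v t) 1 l (v t)) ->
  D t -> coef (resa psim t) n = - mkdvS Rn v n t.
Proof.
move=> sv m1 HL Dt.
pose dA t l := resc psim t l - l * resb psim t l.
have cO i j s : D s -> ccont (fun l => psim s l i j) by move=> Ds; have [] := psim_Out fac i j Ds.
have cO1 s : D s -> ccont (fun l => l * psim s l 0 1) by move=> Ds; have [] := psim01_Out fac Ds.
have HY s : D s -> exists2 Y, is_loop_pd 0 psim s Y & forall l, circle l ->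
    Y l = mx22 (- v s) 1 l (v s) * psim s l - psim s l * matJ l.
  move=> Ds; have [Y Y1] := psim_pd 0 Ds; exists Y => // l cl.
  have um : psim s l \is a GRing.unit by apply: det1_unit; exact: detm.
  rewrite -HL // (psip_time fac Ds cl Y1) expr0 scale1r mulrDl divrK // /conjJ divrK //.
  by rewrite addrK.
have U s : D s -> uld (resb psim) 0 s (fun l => - 2 * v s * resb psim s l - 2 * resa psim s l)
    /\ uld (resa psim) 0 s (dA s).
  move=> Ds; have [Y Y1 YE] := HY s Ds.
  have u i j := is_loop_pd_uld i j Y1.
  have u1 := uld_circ_mul (u 0 1).
  have n1 : nrm (-1 : C) <= 1 by rewrite nrmN nrm1.
  have a1 := uldM oD Ds cO1 (cO 1 1) u1 (u 1 1).
  have a2 := uldM oD Ds (cO 0 0) (cO 1 0) (u 0 0) (u 1 0).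
  have b1 := uldM oD Ds (cO 0 0) (cO 0 0) (u 0 0) (u 0 0).
  have b2 := uldM oD Ds cO1 (cO 0 1) u1 (u 0 1).
  have E (i j : 'I_2) l : circle l -> Y l i j =
    (mx22 (- v s) 1 l (v s) * psim s l - psim s l * matJ l) i j by move=> cl; rewrite YE.
  split.
  - apply: (eq_uld _ _ (uld_lin b1 b2 n1)) => [s' l _|l cl]; first by rewrite mulN1r.
    by rewrite !E // matJE /resa /resb !mxE2; ring.
  - apply: (eq_uld _ _ (uld_lin a1 a2 n1)) => [s' l _|l cl]; first by rewrite mulN1r.
    by rewrite !E // matJE /dA /resc /resb !mxE2; ring.
have Ob s : D s -> Out (resb psim s) by move=> Ds; exact: (resb_Out fac Ds).
have Oa s : D s -> Out (resa psim s) by move=> Ds; exact: (resa_Out fac Ds).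
(* [resc] has a pole at infinity, so [dA] is placed in [Out] as the time derivative of [resa], not
   through its formula. *)
have Od s : D s -> Out (dA s) by move=> Ds; exact: (uld_Out oD Ds Oa (U s Ds).2).
have cb s : D s -> ccont (resb psim s) by case/Ob.
have ca s : D s -> ccont (resa psim s) by case/Oa.
have [||||] // := @resolvent_coef R Rn hRn D v (fun n t => coef (resa psim t) n)
  (fun n t => coef (resb psim t) n) (fun n t => coef (dA t) n) oD sv _ _ _ _ n t Dt.
- move=> s Ds; have o0 := psim_Out fac 0 0 Ds; have o1 := psim_Out fac 0 1 Ds.
  have o2 := psim01_Out fac Ds.
  rewrite coef0E /resb (meanB (OutM o0 o0).1 (OutM o2 o1).1) (mean_OutM o0 o0) (mean_OutM o2 o1).
  by rewrite m1 // (psim01 fac Ds) mulr0 subr0 mulr1.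
- move=> k s Ds; have := uld_coef k oD Ds cb (U s Ds).1.
  have c1 := ccontM (ccont_pow R k) (cb s Ds); have c2 := ccontM (ccont_pow R k) (ca s Ds).
  have c3 := ccontM (ccont_cst (- 2 * v s)) c1; have c4 := ccontM (ccont_cst 2) c2.
  congr is_pd; rewrite /coef -(meanZ (- 2 * v s) c1) -(meanZ 2 c2) -(meanB c3 c4).
  by apply: eq_mean => l _; ring.
- by move=> k s Ds; exact: (uld_coef k oD Ds ca (U s Ds).2).
move=> k s Ds; rewrite /conv -(coef_mul k.+1 (Ob s Ds) (Ob s Ds)) -(coef_mul k (Oa s Ds) (Oa s Ds)).
rewrite -(coef_mul k (Ob s Ds) (Od s Ds)) /coef.
have cbs := cb s Ds; have cas := ca s Ds; have cds := (Od s Ds).1.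
have c1 : ccont (fun l => l ^+ k.+1 * (resb psim s l * resb psim s l)) by cc.
have c2 : ccont (fun l => l ^+ k * (resa psim s l * resa psim s l)) by cc.
have c3 : ccont (fun l => l ^+ k * (resb psim s l * dA s l)) by cc.
rewrite -(meanD c1 c2) -(meanD (ccontD c1 c2) c3).
(* The right-hand side 0 is the mean of [l ^ k.+1], to which [l ^ k (a^2 + b c)] reduces. *)
rewrite -[RHS](mean_mono R k.+1 0); apply: eq_mean => l cl.
rewrite expr0 mulr1 /dA exprS.
have -> : l * l ^+ k * (resb psim s l * resb psim s l) + l ^+ k * (resa psim s l * resa psim s l)
   + l ^+ k * (resb psim s l * (resc psim s l - l * resb psim s l)) =
   l ^+ k * (resa psim s l * resa psim s l + resb psim s l * resc psim s l) by ring.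
have -> : resa psim s l * resa psim s l + resb psim s l * resc psim s l =
   l * (psim s l 0 0 * psim s l 1 1 - psim s l 0 1 * psim s l 1 0) ^+ 2.
  by rewrite /resa /resb /resc; ring.
by rewrite det1E ?detm // expr1n mulr1 mulrC.
Qed.

(** The value of [p_00] at 0 is constantly 1, so the [psi_+] side contributes nothing; on the other
    side [e^w d] meets [e^(- w)]. The remaining products vanish with [p_10] at 0 and with the
    derivative of [m_01] at infinity. *)
Lemma resa_coef_pmkdv w n t (d : C) :
  (forall t, D t -> mean (fun l => psip t l 0 0) = 1) ->
  (forall t, D t -> mean (fun l => psim t l 0 0) = cexp (w t)) ->
  (forall t, D t -> mean (fun l => psim t l 1 1) = cexp (- w t)) ->
  D t -> is_pd n w t d -> coef (resa psim t) n = - d.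
Proof.
move=> p1 m0 m1 Dt Hw; have [Y Y1] := psim_pd n Dt.
have [_ _ _ _ /(_ n t Dt)[P1 _]] := fac.
have up i j := is_loop_pd_uld i j P1; have um i j := is_loop_pd_uld i j Y1.
have dpI i j : In (fun l => dpsip n t l i j).
  by apply: (uld_In oD Dt _ (up i j)) => s Ds; exact: (psip_In fac).
have YO i j : Out (fun l => Y l i j).
  by apply: (uld_Out oD Dt _ (um i j)) => s Ds; exact: (psim_Out fac).
have pI i j := psip_In fac i j Dt; have mO i j := psim_Out fac i j Dt.
have cp i j s : D s -> ccont (fun l => psip s l i j) by move=> /(psip_In fac i j)/In_ccont.
have cm i j s : D s -> ccont (fun l => psim s l i j) by move=> /(psim_Out fac i j)[].
have dp00 : mean (fun l => dpsip n t l 0 0) = 0.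
  have H := uld_coef 0 oD Dt (cp 0 0) (up 0 0).
  rewrite -coef0E -(is_pdE H); apply: is_pdE.
  apply: (is_pd_eq oD Dt _ (is_pd_cst n 1 t)) => s Ds; by rewrite coef0E p1.
have Y01 : mean (fun l => Y l 0 1) = 0.
  have H := uld_coef 0 oD Dt (cm 0 1) (um 0 1).
  rewrite -coef0E -(is_pdE H); apply: is_pdE.
  apply: (is_pd_eq oD Dt _ (is_pd_cst n 0 t)) => s Ds; by rewrite coef0E (psim01 fac).
have Y00 : mean (fun l => Y l 0 0) = cexp (w t) * d.
  have H := is_pd_cder (uld_coef 0 oD Dt (cm 0 0) (um 0 0)).
  have K := cder_cexp (is_pd_cder Hw); rewrite rc0 addr0 set_timeK in K.
  rewrite -coef0E; apply: (cder_unique H); apply: (cder_near _ _ K).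
  - have := near_set_time n oD Dt; apply: filterS => s Ds.
    by rewrite add0r coef0E m0.
  - by rewrite rc0 addr0 set_timeK coef0E m0.
have E l : circle l -> l ^+ n * resa psim t l =
    (dpsip n t l 0 0 * psip t l 1 1 - dpsip n t l 0 1 * psip t l 1 0)
    - (Y l 0 0 * psim t l 1 1 - Y l 0 1 * psim t l 1 0).
  move=> cl; have /(congr1 (fun A : M2 => A 0 0)) := psip_time fac Dt cl Y1.
  rewrite addE2 scaleE2 (conjJE fac) // mx22_00 !inv_det1 ?detm ?detp // !mxE2.
  by rewrite !mulrN => ->; rewrite addrAC subrr add0r.
have x0 := InM (dpI 0 0) (pI 1 1); have x1 := InM (dpI 0 1) (pI 1 0).
have y0 := OutM (YO 0 0) (mO 1 1); have y1 := OutM (YO 0 1) (mO 1 0).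
rewrite /coef (eq_mean E) (meanB (In_ccont (InB x0 x1)) (OutB y0 y1).1).
rewrite (meanB (In_ccont x0) (In_ccont x1)) (meanB y0.1 y1.1) (mean_InM (dpI 0 0) (pI 1 1)).
rewrite (mean_InM (dpI 0 1) (pI 1 0)) (mean_OutM (YO 0 0) (mO 1 1)) (mean_OutM (YO 0 1) (mO 1 0)).
rewrite dp00 (psip10 fac Dt) Y01 Y00 m1 // !(mul0r, mulr0, subr0) sub0r; congr (- _).
by rewrite mulrAC cexpV mul1r.
Qed.

End Hierarchy.
End Reduction.

(** * The two cases of the theorem *)

Section MainLemmas.
Variable R : realType.
Local Notation C := (Cplx R).
Local Notation M2 := 'M[C]_2.
Variables (Rn : nat -> dpoly R) (hRn : GelfandDickii Rn).
Variables (sigma : C) (theta : nat -> C) (htheta : smooth_series theta).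
Variables (g : C -> M2) (hg : LSL g).

Lemma factorization_sub D (P P' Q Q' : (C -> M2) -> Prop) psim psip dpsip :
  (forall f, P f -> P' f) -> (forall f, Q f -> Q' f) ->
  factorization g D P Q psim psip dpsip -> factorization g D P' Q' psim psip dpsip.
Proof.
by move=> PP QQ [oD st H e d]; split => // t /H[p q]; split; [exact: PP|exact: QQ].
Qed.

Lemma NmSL_BmSL (f : C -> M2) : NmSL f -> BmSL f.
Proof. by case=> lf [A eA [lA _]]; split => //; exists A. Qed.

Lemma NpSL_BpSL (f : C -> M2) : NpSL f -> BpSL f.
Proof. by case=> lf [A eA [lA _]]; split => //; exists A. Qed.

Lemma mkdv_string (K : C -> M2) D v : Bpsl K ->
  (forall l, circle l -> delta sigma g l * (g l)^-1 + g l * K l * (g l)^-1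
     = loop_series theta l *: matJ l) ->
  mkdv_corresponds Rn g D v ->
  termwise_t1 D (theta_term Rn theta v) -> termwise_t1 D (sigma_term Rn v) ->
  forall t, D t ->
    string_lhs Rn theta sigma v t = - mean (fun l => K l 0 0) + sigma / 4.
Proof.
move=> [_ [A extK upA]] hK [[sv _] [psim [psip [dpsip [fac hL]]]]] tw1 tw2 t Dt.
have fac' := factorization_sub NmSL_BmSL (fun f H => H) fac.
have KIn i j : In (fun l => K l i j) by have [] := extends_in_In i j extK.
have K10 : mean (fun l => K l 1 0) = 0 by have [_ ->] := extends_in_In 1 0 extK.
have m1 s : D s -> mean (fun l => psim s l 0 0) = 1.
  case: fac => _ _ H _ _ /H[[_ [B extB [_ [B0 _]]]] _].
  by have [_ ->] := extends_out_Out 0 0 extB.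
have oD : open_in_times D by case: fac.
have [S1 [S2 [h1 h2 <-]]] := series_resa fac' hg hK KIn K10 htheta Dt.
apply: (string_lhsE hRn sigma oD sv Dt tw1 tw2 _ h1 h2) => n.
exact: (resa_coef_mkdv fac' hRn n sv m1 hL Dt).
Qed.

(** As [dw/dt_n = - a_n], the two series of [X w] are those of [series_resa] up to sign, and their
    combination is [- K(0)_00 = 0]. *)
Lemma pmkdv_self_similar (K : C -> M2) D w : Npsl K ->
  (forall l, circle l -> delta sigma g l * (g l)^-1 + g l * K l * (g l)^-1
     = loop_series theta l *: matJ l) ->
  pmkdv_corresponds Rn g D w ->
  (forall t, D t -> is_X theta sigma w t 0) /\
  (termwise_t1 D (theta_term Rn theta (pd 0 w)) ->
   termwise_t1 D (sigma_term Rn (pd 0 w)) ->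
   forall t, D t -> string_lhs Rn theta sigma (pd 0 w) t = 0 + sigma / 4).
Proof.
move=> [_ [A extK [upA [A0 _]]]] hK [[sv dw] [psim [psip [dpsip [fac hw]]]]].
have fac' := factorization_sub (fun f H => H) NpSL_BpSL fac.
have KIn i j : In (fun l => K l i j) by have [] := extends_in_In i j extK.
have K10 : mean (fun l => K l 1 0) = 0 by have [_ ->] := extends_in_In 1 0 extK.
have K00 : mean (fun l => K l 0 0) = 0 by have [_ ->] := extends_in_In 0 0 extK.
have oD : open_in_times D by case: fac.
have p1 s : D s -> mean (fun l => psip s l 0 0) = 1.
  case: fac => _ _ H _ _ /H[_ [_ [B extB [_ [B0 _]]]]].
  by have [_ ->] := extends_in_In 0 0 extB.
have m0 s : D s -> mean (fun l => psim s l 0 0) = cexp (w s).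
  by move=> /hw[B extB [<- _]]; have [_ ->] := extends_out_Out 0 0 extB.
have m1 s : D s -> mean (fun l => psim s l 1 1) = cexp (- w s).
  by move=> /hw[B extB [_ <-]]; have [_ ->] := extends_out_Out 1 1 extB.
have HA t n : D t -> coef (resa psim t) n = - mkdvS Rn (pd 0 w) n t.
  by move=> Dt; exact: (resa_coef_pmkdv fac' p1 m0 m1 Dt (dw n t Dt)).
split=> [t Dt|tw1 tw2 t Dt]; have [S1 [S2 [h1 h2]]] := series_resa fac' hg hK KIn K10 htheta Dt;
  rewrite K00 => S0; last first.
  rewrite (string_lhsE hRn sigma oD sv Dt tw1 tw2 (fun n => HA t n Dt) h1 h2).
  by rewrite S0 oppr0.
have j1 := cvg_mull_cst (c := -1) h1; have j2 := cvg_mull_cst (c := -1) h2.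
exists (-1 * S1), (-1 * S2); split.
- apply: (eqf_cvg _ j1) => N; rewrite !seriesE mulr_sumr; apply: eq_bigr => i _.
  by rewrite (is_pdE (dw i t Dt)) HA //; ring.
- apply: (eqf_cvg _ j2) => N; rewrite !seriesE mulr_sumr; apply: eq_bigr => i _.
  by rewrite (is_pdE (dw i t Dt)) HA //; ring.
- by rewrite [sigma * _]mulrCA -mulrDr S0 mulr0.
Qed.
End MainLemmas.

Theorem theorem3p1 (R : realType) (Rn : nat -> dpoly R)
    (hRn : GelfandDickii Rn)
    (sigma : Cplx R) (theta : nat -> Cplx R) (htheta : smooth_series theta)
    (g : Cplx R -> 'M[Cplx R]_2) (hg : LSL g) :
  ((exists2 K : Cplx R -> 'M[Cplx R]_2, Bpsl K &
      forall l, circle l ->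
        delta sigma g l * (g l)^-1 + g l * K l * (g l)^-1
        = loop_series theta l *: matJ l) ->
   forall (D : set (times R)) (v : times R -> Cplx R),
     mkdv_corresponds Rn g D v ->
     termwise_t1 D (theta_term Rn theta v) ->
     termwise_t1 D (sigma_term Rn v) ->
     (forall t, D t -> is_pd 0 (string_lhs Rn theta sigma v) t 0) /\
     (exists c : Cplx R, forall t, D t ->
        string_lhs Rn theta sigma v t = c + sigma / 4%:R))
  /\
  ((exists2 K : Cplx R -> 'M[Cplx R]_2, Npsl K &
      forall l, circle l ->
        delta sigma g l * (g l)^-1 + g l * K l * (g l)^-1
        = loop_series theta l *: matJ l) ->
   forall (D : set (times R)) (w : times R -> Cplx R),
     pmkdv_corresponds Rn g D w ->
     (forall t, D t -> is_X theta sigma w t 0) /\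
     (termwise_t1 D (theta_term Rn theta (pd 0 w)) ->
      termwise_t1 D (sigma_term Rn (pd 0 w)) ->
      forall t, D t ->
        string_lhs Rn theta sigma (pd 0 w) t = 0 + sigma / 4%:R)).
Proof.
split=> [[K hK eK] D v hv tw1 tw2|[K hK eK] D w hw].
  have H t : D t -> string_lhs Rn theta sigma v t = - mean (fun l => K l 0 0) + sigma / 4.
    exact: (mkdv_string hRn htheta hg hK eK hv tw1 tw2).
  split; last by exists (- mean (fun l => K l 0 0)).
  move=> t Dt; have oD : open_in_times D by have [_ [? [? [? [[]]]]]] := hv.
  by apply: (is_pd_eq oD Dt _ (is_pd_cst 0 _ t)) => s Ds; rewrite H.
exact: (pmkdv_self_similar hRn htheta hg hK eK hw).
Qed.
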